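(* Oeljeklaus-Toma manifolds of complex dimension $n\ge 4$ never admit astheno-Kähler metrics.
   Context: Oeljeklaus-Toma manifolds: let $s,t\ge 1$ be integers and $K$ a number field with exactly $s$ real embeddings $\sigma_1,\dots,\sigma_s$ and $2t$ non-real complex embeddings $\sigma_{s+1},\dots,\sigma_{s+2t}$, labelled so that $\sigma_{s+t+j}=\overline{\sigma_{s+j}}$ for $1\le j\le t$. Let $\mathcal O_K$ be the ring of integers and $\mathcal O_K^{*,+}$ the group of totally positive units (units $u$ with $\sigma_j(u)>0$ for $1\le j\le s$). Let $\mathbb H\subset\mathbb C$ be the upper half-plane. On $\mathbb H^s\times\mathbb C^t$, $a\in\mathcal O_K$ acts by translation by $(\sigma_1(a),\dots,\sigma_{s+t}(a))$ and $u\in\mathcal O_K^{*,+}$ acts by multiplying the $j$-th coordinate by $\sigma_j(u)$. A subgroup $U\subset\mathcal O_K^{*,+}$ of rank $s$ is admissible if the resulting fixed-point-free action of $\mathcal O_K\rtimes U$ on $\mathbb H^s\times\mathbb C^t$ is properly discontinuous and co-compact (by construction $\{(\log\sigma_1(u),\dots,\log\sigma_s(u)):u\in U\}$ is a lattice of rank $s$ in $\mathbb R^s$). For admissible $U$, the Oeljeklaus-Toma manifold of type $(s,t)$ is the compact complex manifold $X(K,U)=(\mathbb H^s\times\mathbb C^t)/(\mathcal O_K\rtimes U)$, of complex dimension $n=s+t$. An astheno-Kähler metric on a complex manifold of complex dimension $n\ge 3$ is a Hermitian metric whose associated $(1,1)$-form $\omega=g(J\cdot,\cdot)$ satisfies $\partial\overline\partial\omega^{n-2}=0$.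 *)

(* Defs.v *)
From HB Require Import structures.
From mathcomp Require Import all_boot all_order all_algebra all_field.
From mathcomp Require Import generic_quotient finmap complex.
From mathcomp Require Import all_classical all_reals all_analysis.
From mathcomp Require Import ring lra.

Set Implicit Arguments.
Unset Strict Implicit.
Unset Printing Implicit Defensive.

Import Order.TTheory GRing.Theory Num.Theory numFieldNormedType.Exports.

Local Open Scope classical_set_scope.
Local Open Scope ring_scope.
Local Open Scope quotient_scope.
Local Open Scope complex_scope.

(* The usual topology and norm on the complex numbers R[i]. *)
#[warnings="-redundant-canonical-projection"]
HB.instance Definition _ (R : rcfType) := NormedModule.copy R[i] R[i]^o.

Section Calculus.
Variables (R : realType) (n : nat).
Implicit Types (f : 'rV[R[i]]_n -> R[i]) (v z : 'rV[R[i]]_n).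

(* Differentiability and derivative of f at z along v with respect to a real
   parameter: f need not be holomorphic. *)
Definition rderivable f v z : Prop :=
  derivable (fun x : R => complex.Re (f (z + x%:C *: v))) 0 1 /\
  derivable (fun x : R => complex.Im (f (z + x%:C *: v))) 0 1.

Definition rderive v f : 'rV[R[i]]_n -> R[i] := fun z =>
  derive1 (fun x : R => complex.Re (f (z + x%:C *: v))) 0 +i*
  derive1 (fun x : R => complex.Im (f (z + x%:C *: v))) 0.

Fixpoint of_class_C (k : nat) (V : set 'rV[R[i]]_n) f : Prop :=
  (forall z, V z -> {for z, continuous f}) /\
  if k is k'.+1 then
    forall v, (forall z, V z -> rderivable f v z) /\
              of_class_C k' V (rderive v f)
  else True.

Definition smooth_on (V : set 'rV[R[i]]_n) f : Prop :=
  forall k, of_class_C k V f.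

(* Wirtinger derivatives d/dz_j = (d/dx_j - i d/dy_j) / 2 and
   d/dzbar_j = (d/dx_j + i d/dy_j) / 2. *)
Definition dz (j : 'I_n) f : 'rV[R[i]]_n -> R[i] := fun z =>
  2%:R^-1 * (rderive (delta_mx 0 j) f z - 'i * rderive ('i *: delta_mx 0 j) f z).

Definition dzbar (j : 'I_n) f : 'rV[R[i]]_n -> R[i] := fun z =>
  2%:R^-1 * (rderive (delta_mx 0 j) f z + 'i * rderive ('i *: delta_mx 0 j) f z).

End Calculus.

Section Forms.
Variables (R : realType) (n : nat).

(* A complex-valued differential form in n complex coordinates, given by its
   coefficients in the basis of the exterior algebra generated by
   dz_0, ..., dz_(n-1), dzbar_0, ..., dzbar_(n-1), in this order: the covector
   of index lshift n j is dz_j, that of index rshift n j is dzbar_j, and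
   a S z is the coefficient at z of the product, in increasing order, of the
   covectors with index in S. *)
Definition form := {set 'I_(n + n)} -> 'rV[R[i]]_n -> R[i].

Implicit Types a b : form.

(* (-1) to the number of inversions: e_A /\ e_B = wedge_sign A B e_(A u B) for
   disjoint A and B. *)
Definition wedge_sign (A B : {set 'I_(n + n)}) : R[i] :=
  (-1) ^+ #|[set p in finset.setX A B | (p.2 < p.1)%N]|.

Definition wedge a b : form := fun S z =>
  \sum_(A : {set 'I_(n + n)} | A \subset S)
     wedge_sign A (S :\: A) * a A z * b (S :\: A) z.

Definition one_form1 : form := fun S _ => (S == finset.set0)%:R.

Definition wedge_pow (a : form) (k : nat) : form := iter k (wedge a) one_form1.

Definition covector (m : 'I_(n + n)) : form := fun S _ => (S == [set m]%SET)%:R.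

(* \partial a = \sum_j dz_j /\ (d a / dz_j), and similarly for \bar\partial. *)
Definition del a : form := fun S z =>
  \sum_(j < n) wedge (covector (lshift n j)) (fun T => dz j (a T)) S z.

Definition delbar a : form := fun S z =>
  \sum_(j < n) wedge (covector (rshift n j)) (fun T => dzbar j (a T)) S z.

(* A field of Hermitian matrices h stands for the Hermitian metric
   g(v, w) = Re (\sum_(j, k) h_jk v_j conj(w_k)); its fundamental form
   g(J v, w) is then (i/2) \sum_(j, k) h_jk dz_j /\ dzbar_k, see
   fundamental_formE below. *)
Definition fundamental_form (h : 'rV[R[i]]_n -> 'M[R[i]]_n) : form := fun S z =>
  \sum_(j < n) \sum_(k < n) 'i / 2%:R * h z j k *
     wedge (covector (lshift n j)) (covector (rshift n k)) S z.

End Forms.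

Definition herm (R : realType) (n : nat) (h : 'M[R[i]]_n) (v w : 'rV[R[i]]_n) :
  R[i] := (v *m h *m (map_mx conjc w)^T) 0 0.

(* The 2-form (i/2) \sum h_jk dz_j /\ dzbar_k, evaluated on (v, w), is
   g(J v, w), where g is the real part of the sesquilinear form of matrix h. *)
Lemma fundamental_formE (R : realType) (n : nat) (h : 'M[R[i]]_n)
    (v w : 'rV[R[i]]_n) : (map_mx conjc h)^T = h ->
  \sum_(j < n) \sum_(k < n) 'i / 2%:R * h j k *
     (v 0 j * (w 0 k)^* - w 0 j * (v 0 k)^*) =
  (complex.Re (herm h ('i *: v) w))%:C.
Proof.
move=> hh.
have hjk j k : (h j k)^* = h k j by rewrite -[in RHS]hh !mxE.
have hermE a b : herm h a b = \sum_j \sum_k h j k * a 0 j * (b 0 k)^*.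
  rewrite /herm !mxE exchange_big/=; apply: eq_bigr => k _.
  rewrite !mxE big_distrl/=; apply: eq_bigr => j _.
  by rewrite [h j k * _]mulrC.
have cJ a b : (herm h a b)^* = herm h b a.
  rewrite !hermE raddf_sum exchange_big/=; apply: eq_bigr => k _.
  rewrite raddf_sum; apply: eq_bigr => j _ /=.
  rewrite !rmorphM /= hjk conjcK. by rewrite mulrAC.
rewrite ReJ_add cJ.
have -> : herm h ('i *: v) w = 'i * herm h v w.
  by rewrite /herm -!scalemxAl mxE.
have -> : herm h w ('i *: v) = - 'i * herm h w v.
  rewrite -[LHS]conjcK cJ /herm -!scalemxAl mxE rmorphM/= -/(herm h v w) cJ.
  by congr (_ * _); apply/eqP; rewrite eq_complex /= oppr0 !eqxx.
rewrite mulNr -mulrBr mulrAC !hermE -sumrB mulr_sumr; apply: eq_bigr => j _.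
rewrite -sumrB mulr_sumr; apply: eq_bigr => k _.
by rewrite -!mulrA; congr (_ * (_ * _)); rewrite mulrBr.
Qed.

(* A complex manifold of dimension n: a Hausdorff second countable space with
   an atlas, given by holomorphic local parametrizations par c (the inverses
   of the coordinate charts), with par c only meaningful on the open set
   dom c. *)
Record complex_manifold (R : realType) (n : nat) := ComplexManifold {
  carrier :> topologicalType;
  chart : Type;
  dom : chart -> set 'rV[R[i]]_n;
  par : chart -> 'rV[R[i]]_n -> carrier;
  carrier_hausdorff : hausdorff_space carrier;
  carrier_second_countable : @second_countable carrier;
  dom_open : forall c, open (dom c);
  par_inj : forall c z w, dom c z -> dom c w -> par c z = par c w -> z = w;
  (* par c is a homeomorphism from dom c onto an open set *)
  par_open : forall c (W : set 'rV[R[i]]_n), W `<=` dom c ->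
    (open W <-> open (par c @` W));
  par_cover : forall p : carrier, exists c, exists2 z, dom c z & par c z = p;
  (* the transition maps are holomorphic, that is, complex differentiable *)
  transition : forall c c' z z', dom c z -> dom c' z' -> par c z = par c' z' ->
    exists (V : set 'rV[R[i]]_n) (tau : 'rV[R[i]]_n -> 'rV[R[i]]_n),
    [/\ open V, V z, V `<=` dom c,
        (forall w, V w -> dom c' (tau w) /\ par c' (tau w) = par c w) &
        (forall w, V w -> differentiable tau w)]
}.

(* A Hermitian metric on M: in each chart, a smooth field of positive definite
   Hermitian matrices, compatible with changes of charts (row v of the tangent
   space at z is mapped by tau to v *m 'J tau z). *)
Record hermitian_metric (R : realType) (n : nat) (M : complex_manifold R n) :=
HermitianMetric {
  metric_mx :> chart M -> 'rV[R[i]]_n -> 'M[R[i]]_n;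
  metric_smooth : forall c j k, smooth_on (dom c) (fun z => metric_mx c z j k);
  metric_hermitian : forall c z, dom c z ->
    (map_mx conjc (metric_mx c z))^T = metric_mx c z;
  metric_pos : forall c z v, dom c z -> v != 0 -> 0 < herm (metric_mx c z) v v;
  metric_compat : forall c c' (V : set 'rV[R[i]]_n) tau,
    open V -> V `<=` dom c ->
    (forall w, V w -> dom c' (tau w) /\ par c' (tau w) = par c w) ->
    forall z, V z ->
      metric_mx c z =
        'J tau z *m metric_mx c' (tau z) *m (map_mx conjc ('J tau z))^T
}.

Definition astheno_kahler (R : realType) (n : nat) (M : complex_manifold R n)
    (g : hermitian_metric M) : Prop :=
  forall c z S, dom c z ->
    del (delbar (wedge_pow (fundamental_form (g c)) (n - 2))) S z = 0.

Section OeljeklausToma.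
Variables (R : realType) (s t : nat) (K : fieldExtType rat).
Variable sigma : 'I_(s + t + t) -> {rmorphism K -> R[i]}.

(* sigma lists the embeddings of K, each of them once: first the s real ones,
   then t non-real ones, then their complex conjugates in the same order. *)
Record embedding_labelling : Prop := EmbeddingLabelling {
  sigma_inj : forall i j, sigma i =1 sigma j -> i = j;
  sigma_surj : forall f : {rmorphism K -> R[i]}, exists i, f =1 sigma i;
  sigma_real : forall (j : 'I_s) x,
    sigma (lshift t (lshift t j)) x \is Num.real;
  sigma_nonreal : forall j : 'I_t, exists x,
    sigma (lshift t (rshift s j)) x \isn't Num.real;
  sigma_conj : forall (j : 'I_t) x,
    sigma (rshift (s + t) j) x = (sigma (lshift t (rshift s j)) x)^*
}.

Definition ring_of_integers : set K := [set x | integralOver (intr : int -> K) x].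

Definition totally_positive_unit : set K :=
  [set u | [/\ u != 0, ring_of_integers u, ring_of_integers u^-1 &
    forall j : 'I_s, 0 < sigma (lshift t (lshift t j)) u]].

(* H^s x C^t, the upper half-planes being the first s coordinates. *)
Definition HC : set 'rV[R[i]]_(s + t) :=
  [set z | forall j : 'I_s, 0 < complex.Im (z 0 (lshift t j))].

(* The action of (a, u) in the semidirect product of O_K by the group of totally
   positive units: multiplication by u followed by translation by a. *)
Definition act (a u : K) (z : 'rV[R[i]]_(s + t)) : 'rV[R[i]]_(s + t) :=
  \row_j (sigma (lshift t j) u * z 0 j + sigma (lshift t j) a).

Record unit_subgroup (U : set K) : Prop := UnitSubgroup {
  unit_subgroup_sub : U `<=` totally_positive_unit;
  unit_subgroup1 : U 1;
  unit_subgroupM : forall u v, U u -> U v -> U (u * v);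
  unit_subgroupV : forall u, U u -> U u^-1
}.

Definition mult_independent (k : nat) (u : 'I_k -> K) : Prop :=
  forall e : 'I_k -> int, \prod_(i < k) u i ^ e i = 1 -> forall i, e i = 0.

(* The multiplicative group U has rank r: r is the largest number of
   multiplicatively independent elements. *)
Definition has_rank (U : set K) (r : nat) : Prop :=
  (exists u : 'I_r -> K, (forall i, U (u i)) /\ mult_independent u) /\
  (forall u : 'I_r.+1 -> K, (forall i, U (u i)) -> ~ mult_independent u).

Definition properly_discontinuous (U : set K) : Prop :=
  forall D : set 'rV[R[i]]_(s + t), compact D -> D `<=` HC ->
    finite_set [set g : K * K | [/\ ring_of_integers g.1, U g.2 &
                                 exists2 z, D z & D (act g.1 g.2 z)]].

Definition cocompact (U : set K) : Prop :=
  exists D : set 'rV[R[i]]_(s + t), [/\ compact D, D `<=` HC &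
    forall z, HC z -> exists a u w,
      [/\ ring_of_integers a, U u, D w & z = act a u w]].

Record admissible (U : set K) : Prop := Admissible {
  admissible_subgroup :> unit_subgroup U;
  admissible_rank : has_rank U s;
  admissible_pd : properly_discontinuous U;
  admissible_cocompact : cocompact U
}.

End OeljeklausToma.

Arguments HC : clear implicits.

Section CoordinateBoxes.
Variables (R : realType) (m : nat).
Local Notation C := R[i].
Local Notation Cn := 'rV[C]_m.

Definition cbox (z : Cn) (e : R) : set Cn := [set w | forall j,
  `|complex.Re (w 0 j) - complex.Re (z 0 j)| <= e /\
  `|complex.Im (w 0 j) - complex.Im (z 0 j)| <= e].

Lemma normc_Re_Im (x : C) : `|x| <= (`|complex.Re x| + `|complex.Im x|)%:C.
Proof.
rewrite {1}[x]complexE (le_trans (ler_normD _ _))// rmorphD /= lerD//.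
  by rewrite normc_def/= expr0n addr0 sqrtr_sqr.
by rewrite normrM !normc_def/= !expr0n/= add0r addr0 expr1n sqrtr1 mul1r sqrtr_sqr.
Qed.

Lemma Re_le_normc (x : C) (e : R) : `|x| < e%:C -> `|complex.Re x| <= e.
Proof. by move=> xe; rewrite -lecR (le_trans (normc_ge_Re x))// ltW. Qed.

Lemma Im_le_normc (x : C) (e : R) : `|x| < e%:C -> `|complex.Im x| <= e.
Proof.
move=> xe; rewrite -normrN -ReiNIm; apply: Re_le_normc.
by rewrite normrM [X in _ * X]normc_def/= expr0n expr1n add0r sqrtr1 mulr1.
Qed.

Lemma cbox_nbhs (z : Cn) e : 0 < e -> nbhs z (cbox z e).
Proof.
move=> e0; apply/nbhs_ballP; exists e%:C => /=; first by rewrite ltcR.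
move=> w [_ /(_ 0) zw] j; have {}zw : `|w 0 j - z 0 j| < e%:C.
  by rewrite distrC; exact: zw.
by split; [have := Re_le_normc zw|have := Im_le_normc zw]; rewrite raddfB.
Qed.

Lemma nbhs_cbox (z : Cn) (W : set Cn) : nbhs z W ->
  exists2 e : R, 0 < e & cbox z e `<=` W.
Proof.
move=> /nbhs_ballP[[e1 e2]/=]; rewrite ltcE/= => /andP[/eqP -> e0] zW.
exists (e1 / 3) => [|w zw]; first by rewrite divr_gt0.
apply: zW; split=> [|i j]; rewrite ?ltcR// !ord1.
change (`|z 0 j - w 0 j| < e1%:C); rewrite distrC.
apply: (le_lt_trans (normc_Re_Im _)); rewrite ltcR.
have [zw1 zw2] := zw j; rewrite !raddfB/=.
by apply: (le_lt_trans (lerD zw1 zw2)); lra.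
Qed.

Lemma cbox_compact (z : Cn) e : compact (cbox z e).
Proof.
pose sq (c : C) := (fun p : R * R => p.1 +i* p.2) @`
  (`[complex.Re c - e, complex.Re c + e]%classic `*`
   `[complex.Im c - e, complex.Im c + e]%classic).
have csq c : compact (sq c).
  apply: continuous_compact; last first.
    by apply: compact_setX; exact: segment_compact.
  apply: continuous_subspaceT => p W /nbhs_ballP[[e1 e2]/=].
  rewrite ltcE/= => /andP[/eqP -> e0] pW.
  have d0 : 0 < e1 / 3 by rewrite divr_gt0.
  apply/nbhs_ballP; exists (e1 / 3) => //= q [pq1 pq2].
  apply: pW; change (`|p.1 +i* p.2 - (q.1 +i* q.2)| < e1%:C).
  apply: (le_lt_trans (normc_Re_Im _)); rewrite ltcR/=.
  have {}pq1 : `|p.1 - q.1| < e1 / 3 by exact: pq1.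
  have {}pq2 : `|p.2 - q.2| < e1 / 3 by exact: pq2.
  by apply: (lt_trans (ltrD pq1 pq2)); lra.
rewrite (_ : cbox z e = [set v | forall j, sq (z 0 j) (v ord0 j)]).
  by apply: (@rV_compact R[i] m (fun j => sq (z 0 j))) => j; exact: csq.
apply/seteqP; split=> w zw j.
  have [zw1 zw2] := zw j; exists (complex.Re (w 0 j), complex.Im (w 0 j)) => /=.
    by split; rewrite /= in_itv/= -ler_distl.
  by case: (w 0 j).
by have [[a b]/= [] + + <-] := zw j; rewrite !in_itv/= -!ler_distl.
Qed.

Definition rbox (q : 'rV[rat]_m * 'rV[rat]_m * nat) : set Cn :=
  [set w | forall j,
     `|complex.Re (w 0 j) - ratr (q.1.1 0 j)| < q.2.+1%:R^-1 /\
     `|complex.Im (w 0 j) - ratr (q.1.2 0 j)| < q.2.+1%:R^-1].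

Lemma rbox_open q : open (rbox q).
Proof.
rewrite openE => w wq; rewrite /interior.
pose d : R := q.2.+1%:R^-1.
pose rr j := Num.max `|complex.Re (w 0 j) - ratr (q.1.1 0 j)|
                `|complex.Im (w 0 j) - ratr (q.1.2 0 j)|.
pose r : R := \big[Num.max/0]_(j < m) rr j.
have rd : r < d.
  rewrite /r; apply: bigmax_lt; first by rewrite invr_gt0.
  by move=> j _; rewrite /rr gt_max; have [-> ->] := wq j.
have : nbhs w (cbox w ((d - r) / 2)).
  by apply: cbox_nbhs; rewrite divr_gt0// subr_gt0.
apply: filterS => u uw j; have [uw1 uw2] := uw j.
have rj : rr j <= r by exact: le_bigmax.
have /andP[w1 w2] : (`|complex.Re (w 0 j) - ratr (q.1.1 0 j)| <= r) &&
   (`|complex.Im (w 0 j) - ratr (q.1.2 0 j)| <= r) by rewrite -ge_max.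
split; rewrite -/d.
  rewrite -[X in X - _](subrK (complex.Re (w 0 j))) -addrA.
  by apply: (le_lt_trans (ler_normD _ _)); lra.
rewrite -[X in X - _](subrK (complex.Im (w 0 j))) -addrA.
by apply: (le_lt_trans (ler_normD _ _)); lra.
Qed.

Lemma rbox_nbhs (z : Cn) (W : set Cn) : nbhs z W ->
  exists2 q, rbox q z & rbox q `<=` W.
Proof.
move=> /nbhs_cbox[e e0 zW].
have [k] : exists k, k.+1%:R^-1 < e / 2.
  have [k] := @ltr_add_invr R 0 (e / 2) (divr_gt0 e0 (ltr0Sn _ _)).
  by rewrite add0r; exists k.
set d := k.+1%:R^-1 => ke; have d0 : 0 < d by rewrite invr_gt0.
have H x : exists q : rat, `|x - ratr q| < d.
  have [q] := @rat_in_itvoo R (x - d) (x + d) ltac:(by rewrite ltrBlDr -addrA ltrDl addr_gt0).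
  by rewrite in_itv/= -ltr_distl distrC; exists q.
pose q x := projT1 (cid (H x)); have qP x : `|x - ratr (q x)| < d.
  exact: projT2 (cid (H x)).
exists (\row_j q (complex.Re (z 0 j)), \row_j q (complex.Im (z 0 j)), k).
  by move=> j; rewrite !mxE; split; exact: qP.
move=> w wq; apply: zW => j; have := wq j; rewrite !mxE/= -/d => -[w1 w2].
have := qP (complex.Re (z 0 j)); have := qP (complex.Im (z 0 j)).
rewrite distrC => z2; rewrite distrC => z1; split.
  rewrite -(subrK (ratr (q (complex.Re (z 0 j)))) (complex.Re (w 0 j))) -addrA.
  by apply: (le_trans (ler_normD _ _)); lra.
rewrite -(subrK (ratr (q (complex.Im (z 0 j)))) (complex.Im (w 0 j))) -addrA.
by apply: (le_trans (ler_normD _ _)); lra.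
Qed.

End CoordinateBoxes.

Section OTspace.
Variables (R : realType) (s t : nat) (K : fieldExtType rat).
Variable sigma : 'I_(s + t + t) -> {rmorphism K -> R[i]}.
Variable U : set K.
Hypothesis hU : unit_subgroup sigma U.

Lemma O_K0 : @ring_of_integers K 0.
Proof. exact: (mxpoly.integral0 (intr : {rmorphism int -> K})). Qed.

Lemma O_K_opp a : @ring_of_integers K a -> ring_of_integers (- a).
Proof. exact: (@integral_opp int K (intr : {rmorphism int -> K})). Qed.

Lemma O_K_add a b : @ring_of_integers K a -> ring_of_integers b ->
  ring_of_integers (a + b).
Proof. exact: (@integral_add int K (intr : {rmorphism int -> K})). Qed.

Lemma O_K_mul a b : @ring_of_integers K a -> ring_of_integers b ->
  ring_of_integers (a * b).
Proof. exact: (@integral_mul int K (intr : {rmorphism int -> K})). Qed.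

Lemma act1 z : act sigma 0 1 z = z.
Proof. by apply/rowP => j; rewrite mxE rmorph1 rmorph0 mul1r addr0. Qed.

Lemma actM a u b v z :
  act sigma a u (act sigma b v z) = act sigma (a + u * b) (u * v) z.
Proof. by apply/rowP => j; rewrite !mxE rmorphD !rmorphM/=; ring. Qed.

Lemma unit_subgroup_neq0 u : U u -> u != 0.
Proof. by move=> /(unit_subgroup_sub hU)[]. Qed.

Lemma unit_subgroup_int u : U u -> ring_of_integers u.
Proof. by move=> /(unit_subgroup_sub hU)[]. Qed.

Definition orbit_rel : rel (HC R s t) := fun x y =>
  `[< exists a u, [/\ ring_of_integers a, U u &
                      \val y = act sigma a u (\val x)] >].

Lemma orbit_rel_refl : reflexive orbit_rel.
Proof.
move=> x; apply/asboolP; exists 0, 1; split; rewrite ?act1//.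
  exact: O_K0.
exact: unit_subgroup1 hU.
Qed.

Lemma act_inv a u z w : U u -> w = act sigma a u z ->
  z = act sigma (- (u^-1 * a)) u^-1 w.
Proof.
move=> /unit_subgroup_neq0 u0 ->.
by rewrite actM mulVf// addNr act1.
Qed.

Lemma inv_int a u : ring_of_integers a -> U u -> ring_of_integers (- (u^-1 * a)).
Proof.
move=> ia Uu; apply: O_K_opp; apply: O_K_mul => //.
exact: (unit_subgroup_int (unit_subgroupV hU Uu)).
Qed.

Lemma orbit_rel_sym : symmetric orbit_rel.
Proof.
have H x y : orbit_rel x y -> orbit_rel y x; last first.
  by move=> x y; apply/idP/idP; exact: H.
move=> /asboolP[a [u [ia Uu xy]]]; apply/asboolP.
exists (- (u^-1 * a)), u^-1; split; [exact: inv_int| |exact: act_inv].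
exact: (unit_subgroupV hU Uu).
Qed.

Lemma orbit_rel_trans : transitive orbit_rel.
Proof.
move=> y x z /asboolP[a [u [ia Uu xy]]] /asboolP[b [v [ib Uv yz]]].
apply/asboolP; exists (b + v * a), (v * u); split.
- apply: O_K_add => //; apply: O_K_mul => //.
  exact: unit_subgroup_int.
- exact: (unit_subgroupM hU).
- by rewrite yz xy actM.
Qed.

Definition orbit_equiv : equiv_rel (HC R s t) :=
  EquivRel orbit_rel orbit_rel_refl orbit_rel_sym orbit_rel_trans.

(* The quotient of H^s x C^t by the action of the semidirect product of O_K by
   U, with the quotient topology. *)
Definition OT_space : topologicalType :=
  quotient_topology {eq_quot orbit_equiv}.

Lemma HC_i : HC R s t (const_mx 'i : 'rV[R[i]]_(s + t)).
Proof. by move=> j; rewrite mxE /= ltr01. Qed.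

Definition HC_base : HC R s t := 
  exist (fun z => z \in HC R s t) (const_mx 'i) (mem_set HC_i).

(* The projection H^s x C^t -> OT_space, with a junk value elsewhere. *)
Definition OT_proj (z : 'rV[R[i]]_(s + t)) : OT_space :=
  \pi_{eq_quot orbit_equiv} (insubd HC_base z).

Local Notation P := OT_proj.
Local Notation HC := (HC R s t).

Lemma val_insubd z : HC z -> \val (insubd HC_base z) = z.
Proof. by move=> Hz; rewrite insubdK//; exact: mem_set. Qed.

Lemma OT_projP z w : HC z -> HC w ->
  P z = P w <->
  exists a u, [/\ ring_of_integers a, U u & w = act sigma a u z].
Proof.
move=> Hz Hw; split.
  move/eqmodP => /asboolP[a [u [ia Uu]]]; rewrite !val_insubd// => wz.
  by exists a, u.
move=> [a [u [ia Uu wz]]]; apply/eqmodP/asboolP; exists a, u; split => //.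
by rewrite !val_insubd.
Qed.

Lemma OT_proj_surj (p : OT_space) : exists2 z, HC z & P z = p.
Proof.
exists (\val (repr p)); first exact: (set_mem (valP (repr p))).
by rewrite /P valKd reprK.
Qed.

Lemma OT_openE (A : set OT_space) : open A <-> exists2 G : set 'rV[R[i]]_(s + t),
  open G & G `&` HC = [set z | HC z /\ A (P z)].
Proof.
split.
  move=> [G oG GA]; exists G => //; apply/seteqP; split=> z /=.
    move=> [Gz Hz]; split => //.
    have : (\val @^-1` G) (insubd HC_base z) by rewrite /= val_insubd.
    by rewrite GA.
  move=> [Hz Az]; split => //.
  have : (\val @^-1` G) (insubd HC_base z) by rewrite GA.
  by rewrite /= val_insubd.
move=> [G oG GA]; exists G => //; apply/seteqP; split=> x /=.
  move=> Gx; have : (G `&` HC) (\val x) by split => //; exact: (set_mem (valP x)).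
  by rewrite GA => -[_]; rewrite /P valKd.
move=> Ax; have : [set z | HC z /\ A (P z)] (\val x).
  by split; [exact: (set_mem (valP x))|rewrite /P valKd].
by rewrite -GA => -[].
Qed.

Lemma act_differentiable a u z : differentiable (act sigma a u) z.
Proof.
have -> : act sigma a u = \sum_(j < s + t) (fun z : 'rV[R[i]]_(s + t) =>
    (sigma (lshift t j) u * z 0 j + sigma (lshift t j) a) *:
      (delta_mx 0 j : 'rV[R[i]]_(s + t))).
  apply/funext => w; rewrite fct_sumE [LHS]row_sum_delta.
  by apply: eq_bigr => j _; rewrite mxE.
apply: differentiable_sum => j.
apply: differentiableZl; apply: differentiableD; last exact: differentiable_cst.
apply: differentiableM; first exact: differentiable_cst.
exact: differentiable_coord.
Qed.

Lemma act_continuous a u : continuous (act sigma a u).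
Proof. move=> z; exact/differentiable_continuous/act_differentiable. Qed.

Lemma HC_open : open HC.
Proof.
rewrite openE => z Hz; rewrite /interior.
pose e := \big[Num.min/1]_(j < s) (complex.Im (z 0 (lshift t j)) / 2).
have e0 : 0 < e by apply: lt_bigmin => // j _; rewrite divr_gt0.
apply: filterS (cbox_nbhs z e0) => w zw j.
have := bigmin_le 1 j (fun j => complex.Im (z 0 (lshift t j)) / 2).
have [_] := zw (lshift t j); rewrite ler_distl -/e => /andP[+ _].
by have := Hz j; lra.
Qed.

Hypothesis hs : (0 < s)%N.
Hypothesis hsigma : embedding_labelling sigma.

Lemma act_HC a u z : U u -> HC z -> HC (act sigma a u z).
Proof.
move=> /(unit_subgroup_sub hU)[_ _ _ u0] Hz j; rewrite mxE.
have := u0 j; have := Hz j.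
have /complex_realP[x ->] := sigma_real hsigma j a.
case: (sigma _ u) => u1 u2; rewrite ltcE/= => zj /andP[/eqP -> u10].
by case: (z 0 _) zj => z1 z2/= z20; rewrite addr0 mul0r addr0 mulr_gt0.
Qed.

Lemma act_fixed a u z : U u -> HC z -> act sigma a u z = z -> a = 0 /\ u = 1.
Proof.
move=> Uu Hz az; pose j := Ordinal hs.
have [_ _ _ /(_ j) u0] := unit_subgroup_sub hU Uu.
have /complex_realP[x ax] := sigma_real hsigma j a.
have := congr1 (fun w : 'rV_(s + t) => w 0 (lshift t j)) az; rewrite mxE ax.
have [y uy] : exists y, sigma (lshift t (lshift t j)) u = y%:C.
  by apply/complex_realP; exact: gtr0_real.
have := Hz j; rewrite uy; case: (z 0 _) => z1 z2 /= z20 [].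
rewrite !mul0r subr0 !addr0 => + yz.
have y1 : y = 1 by apply: (mulIf (lt0r_neq0 z20)); rewrite mul1r.
rewrite y1 mul1r => /(canRL (addKr _)); rewrite addNr => x0.
split; apply: (fmorph_inj (sigma (lshift t (lshift t j)))).
  by rewrite ax x0 !rmorph0.
by rewrite uy y1 !rmorph1.
Qed.

Lemma OT_proj_open (W : set 'rV[R[i]]_(s + t)) : W `<=` HC -> open W ->
  open (P @` W).
Proof.
move=> WH oW; apply/OT_openE.
exists (\bigcup_(g in [set g : K * K | ring_of_integers g.1 /\ U g.2])
   (act sigma g.1 g.2 @^-1` W)).
  apply: bigcup_open => g _; apply: open_comp => // z _; exact: act_continuous.
apply/seteqP; split=> z.
  move=> [[[a u]/= [ia Uu] Wz] Hz]; split => //; exists (act sigma a u z) => //.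
  apply/esym/OT_projP => //; first exact: act_HC.
  by exists a, u.
move=> [Hz [w Ww /esym Pzw]].
have [a [u [ia Uu wz]]] := (OT_projP Hz (WH _ Ww)).1 Pzw.
by split => //; exists (a, u) => //=; rewrite -wz.
Qed.

Hypothesis pd : properly_discontinuous sigma U.

Lemma act_separation z w : HC z -> HC w ->
  exists V W, [/\ [/\ open V, V z & V `<=` HC], [/\ open W, W w & W `<=` HC] &
    forall a u x, ring_of_integers a -> U u -> V x -> W (act sigma a u x) ->
      act sigma a u z = w].
Proof.
move=> Hz Hw.
have [e1 e10 ze1] := nbhs_cbox (open_nbhs_nbhs (conj HC_open Hz)).
have [e2 e20 we2] := nbhs_cbox (open_nbhs_nbhs (conj HC_open Hw)).
have /pd : compact (cbox z e1 `|` cbox w e2).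
  by apply: compactU; exact: cbox_compact.
move=> /(_ ltac:(by rewrite subUset)) /finite_fsetP[F FE].
pose G (g : K * K) : set ('rV[R[i]]_(s + t) * 'rV[R[i]]_(s + t)) :=
  [set p | act sigma g.1 g.2 z = w \/ act sigma g.1 g.2 p.1 <> p.2].
have nG g : g \in F -> nbhs (z, w) (G g).
  move=> _; have [gz|gz] := pselect (act sigma g.1 g.2 z = w).
    by apply: filterS filterT => p _; left.
  have := @norm_hausdorff R[i] 'rV[R[i]]_(s + t); rewrite open_hausdorff.
  move=> /(_ _ _ (introN eqP gz))[[A B]/= [Az Bw] [oA oB AB]].
  exists (act sigma g.1 g.2 @^-1` A, B) => /=.
    split; last by apply: open_nbhs_nbhs; split => //; exact: set_mem.
    apply: act_continuous; apply: open_nbhs_nbhs; split => //; exact: set_mem.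
  move=> [p q]/= [Ap Bq]; right => /= pq.
  have : (A `&` B) q by split => //; rewrite -pq.
  by rewrite (eqP AB).
have [[A B]/= [zA wB] AB] := filter_bigI _ nG.
exists (A `&` cbox z e1)°, (B `&` cbox w e2)°; split.
- split; first exact: open_interior.
    by apply: filterI => //; exact: cbox_nbhs.
  by move=> x /interior_subset[_ /ze1].
- split; first exact: open_interior.
    by apply: filterI => //; exact: cbox_nbhs.
  by move=> x /interior_subset[_ /we2].
move=> a u x ia Uu /interior_subset[Ax zx] /interior_subset[Bx wx].
have Fau : [set` F] (a, u).
  by rewrite -FE/=; split => //; exists x; [left|right].
by have [] := AB (x, act sigma a u x) (conj Ax Bx) (a, u) Fau.
Qed.

Lemma OT_space_hausdorff : hausdorff_space OT_space.
Proof.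
rewrite open_hausdorff => p q /eqP.
have [z Hz <-] := OT_proj_surj p; have [w Hw <-] := OT_proj_surj q => zw.
have [V [W [[oV Vz VH] [oW Ww WH] VW]]] := act_separation Hz Hw.
exists (P @` V, P @` W) => /=; first by split; apply/mem_set; [exists z|exists w].
split; [exact: OT_proj_open|exact: OT_proj_open|].
apply/eqP/seteqP; split=> // _ [[x Vx <-] [y Wy /esym]].
move=> /(OT_projP (VH _ Vx) (WH _ Wy))[a [u [ia Uu yx]]]; apply: zw.
apply/OT_projP => //; exists a, u; split => //; apply/esym.
by apply: (VW a u x) => //; rewrite -yx.
Qed.

Lemma OT_space_second_countable : @second_countable OT_space.
Proof.
exists (range (fun q => P @` (rbox q `&` HC))).
  exact/(card_le_trans (card_image_le _ _))/countableP.
split=> [_ [q _ <-]|p A].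
  by apply: OT_proj_open; [move=> ? []|apply: openI HC_open; exact: rbox_open].
rewrite nbhsE => -[B [/OT_openE[G oG GB]]].
have [z Hz <-] := OT_proj_surj p => Bz BA.
have Gz : G z by have : [set z | HC z /\ B (P z)] z by []; rewrite -GB => -[].
have [q qz qG] := rbox_nbhs (open_nbhs_nbhs (conj oG Gz)).
exists (P @` (rbox q `&` HC)); first by split; [exists q|exists z].
move=> _ [w [/qG Gw Hw] <-]; apply: BA.
by have : (G `&` HC) w by []; rewrite GB => -[].
Qed.

(* The inverse branches of the projection are local coordinates. *)
Record OT_chart := OTChart {
  OT_dom : set 'rV[R[i]]_(s + t);
  OT_dom_open : open OT_dom;
  OT_dom_sub : OT_dom `<=` HC;
  OT_proj_inj : forall z w, OT_dom z -> OT_dom w -> P z = P w -> z = w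
}.

Lemma OT_chart_open (c : OT_chart) (W : set 'rV[R[i]]_(s + t)) :
  W `<=` OT_dom c -> (open W <-> open (P @` W)).
Proof.
move=> Wc; have oV := @OT_dom_open c; have VH : OT_dom c `<=` HC by exact: OT_dom_sub.
split.
  by move=> oW; apply: OT_proj_open => // z /Wc /VH.
move=> /OT_openE[G oG GW]; rewrite (_ : W = G `&` OT_dom c); first exact: openI.
apply/seteqP; split=> z.
  move=> Wz; split; last exact: Wc.
  suff : (G `&` HC) z by case.
  by rewrite GW; split; [exact/VH/Wc|exists z].
move=> [Gz cz].
have : (G `&` HC) z by split=> //; exact: VH.
rewrite GW => -[_ [w Ww]] /(OT_proj_inj (Wc _ Ww) cz) <- //.
Qed.

Lemma OT_chart_cover (p : OT_space) :
  exists c : OT_chart, exists2 z, OT_dom c z & P z = p.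
Proof.
have [z Hz <-] := OT_proj_surj p.
have [V [W [[oV Vz VH] [oW Ww WH] VW]]] := act_separation Hz Hz.
have oVW := openI oV oW; have VWH : V `&` W `<=` HC by move=> x [/VH].
unshelve eexists; first apply: (OTChart oVW VWH); last by exists z.
move=> x y [Vx Wx] [Vy Wy].
move=> /(OT_projP (VH _ Vx) (VH _ Vy))[a [u [ia Uu yx]]].
have [|a0 u1] := @act_fixed a u z Uu Hz.
  by apply: (VW a u x) => //; rewrite -yx.
by rewrite yx a0 u1 act1.
Qed.

Lemma OT_transition (c c' : OT_chart) z z' : OT_dom c z -> OT_dom c' z' -> P z = P z' ->
  exists (V : set 'rV[R[i]]_(s + t)) (tau : 'rV[R[i]]_(s + t) -> 'rV[R[i]]_(s + t)),
    [/\ open V, V z, V `<=` OT_dom c,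
        (forall w, V w -> OT_dom c' (tau w) /\ P (tau w) = P w) &
        (forall w, V w -> differentiable tau w)].
Proof.
have oc := @OT_dom_open c; have cH : OT_dom c `<=` HC by exact: OT_dom_sub.
have oc' := @OT_dom_open c'; have cH' : OT_dom c' `<=` HC by exact: OT_dom_sub.
move=> cz cz' /(OT_projP (cH _ cz) (cH' _ cz'))[a [u [ia Uu zz']]].
exists (OT_dom c `&` act sigma a u @^-1` OT_dom c'), (act sigma a u); split.
- apply: openI => //; apply: open_comp => // x _; exact: act_continuous.
- by split => //=; rewrite -zz'.
- by move=> x [].
- move=> w [cw c'w]; split => //; apply/esym/OT_projP; [exact: cH|exact: cH'|].
  by exists a, u.
- by move=> w _; exact: act_differentiable.
Qed.

End OTspace.

Definition OT_manifold (R : realType) (s t : nat) (K : fieldExtType rat)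
    (sigma : 'I_(s + t + t) -> {rmorphism K -> R[i]}) (U : set K)
    (hs : (0 < s)%N) (hsigma : embedding_labelling sigma)
    (hU : admissible sigma U) : complex_manifold R (s + t) :=
  @ComplexManifold R (s + t) (OT_space hU) (OT_chart hU)
    (@OT_dom R s t K sigma U hU) (fun _ => OT_proj hU)
    (OT_space_hausdorff hsigma (admissible_pd hU))
    (OT_space_second_countable hU hsigma)
    (@OT_dom_open R s t K sigma U hU) (@OT_proj_inj R s t K sigma U hU)
    (OT_chart_open hsigma)
    (OT_chart_cover hs hsigma (admissible_pd hU))
    (@OT_transition R s t K sigma U hU).

Lemma OT_manifold_compact (R : realType) (s t : nat) (K : fieldExtType rat)
    (sigma : 'I_(s + t + t) -> {rmorphism K -> R[i]}) (U : set K)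
    (hs : (0 < s)%N) (hsigma : embedding_labelling sigma)
    (hU : admissible sigma U) : compact [set: OT_manifold hs hsigma hU].
Proof.
have [D [cD DH Dcov]] := admissible_cocompact hU.
have -> : [set: OT_manifold hs hsigma hU] = OT_proj hU @` D.
  apply/seteqP; split=> // p _; have [z Hz <-] := OT_proj_surj p.
  have [a [u [w [ia Uu Dw zw]]]] := Dcov z Hz; exists w => //.
  by apply/OT_projP; [exact: DH| |exists a, u].
apply: continuous_compact => //; apply: continuous_in_subspaceT => z /set_mem Dz.
move=> B; rewrite nbhsE => -[A [/OT_openE[G oG GA] Az] AB].
have Gz : (G `&` HC R s t) z by rewrite GA; split => //; exact: DH.
rewrite -[nbhs _ _]/(nbhs z (OT_proj hU @^-1` B)).
apply: filterS (open_nbhs_nbhs (conj (openI oG (@HC_open R s t)) Gz)) => w.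
by rewrite GA => -[_ /AB].
Qed.

(* Main.v *)
(* Lift omega to H^s x C^t and multiply the coefficient of
   del delbar omega^(n-2) of index "all covectors but dz_j0 and dzbar_k0" by a
   monomial w in the y_j = Im z_j, j < s. Integrating by parts twice, with w such
   that d^2 w / dz_p dzbar_q vanishes for all but one of the relevant pairs
   (p, q), exhibits a principal minor of the metric times a monomial as the
   divergence of a vector field. If the weight of w cancels that of
   dz_j0 /\ dzbar_k0 under U, then, after multiplication by y_1 ... y_s, the
   minor becomes invariant, hence bounded below by a positive constant by
   cocompactness, while the field is bounded in the coordinates log y_j. The
   divergence theorem on boxes of large side gives a contradiction.
   If s >= 2, take j0 = 1, k0 = 2 and w = 1 / (y_1 y_2). If s = 1, then every
   element of U has a power in common with a fixed unit u; take j0 = k0 = k for a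
   complex place k and w = y^c with |sigma_k u|^2 (sigma_0 u)^c = 1. The minor
   comes with the factor c (c - 1), so that k must satisfy
   |sigma_k u|^2 <> 1, (sigma_0 u)^-1; such a k exists when t >= 2. *)

(* The coefficient that leaves out dz_j0 and dzbar_k0 only contains second derivatives along dz_p,
   dzbar_q with p <> j0 and q <> k0, so the pair also decides which second derivatives of w matter.
   The surviving pair (p0, q0) must satisfy {j0, p0} = {k0, q0}, since only a principal minor has a
   sign. With two real places, the two coordinates swap roles; with one, p0 = q0 is the real place
   and j0 = k0 has to be complex, so that the exponent of w is dictated by U and suits all of U only
   because U has rank 1. The factor y_1 ... y_s comes from the product formula: units have norm 1,
   so u multiplies Lebesgue measure by the product of its real embeddings, just as it multiplies y_1
   ... y_s. Working upstairs on boxes avoids integration on the quotient: cocompactness only serves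
   to bound functions. The price is that the components of the field outside the directions log y_j
   are bounded only where the y_j are. This rests on proper discontinuity, which leaves finitely
   many units whose real embeddings lie in a given compact subset of the positive reals. *)
Require Import Defs.
From HB Require Import structures.
From mathcomp Require Import all_boot all_order all_fingroup all_algebra all_field.
From mathcomp Require Import finmap complex sesquilinear spectral.
From mathcomp Require Import all_classical all_reals all_analysis.
From mathcomp Require Import ring lra zify.
Require Import Defs.
Set Implicit Arguments.
Unset Strict Implicit.
Unset Printing Implicit Defensive.
Import Order.TTheory GRing.Theory Num.Theory numFieldNormedType.Exports.
Local Open Scope classical_set_scope.
Local Open Scope ring_scope.
Local Open Scope complex_scope.
Local Arguments rderive : simpl never.
Local Arguments dz : simpl never.
Local Arguments dzbar : simpl never.

(** * The divergence theorem on boxes *)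

Section DivergenceOnBoxes.
Variable R : realType.

(** Only x is confined to A, while y may leave it: in [divergence_on_box] the mean value points then
    need not be located in the box. *)
Lemma compact_uniform_continuity m (A : set 'rV[R]_m) (f : 'rV[R]_m -> R)
    (e : R) : compact A -> continuous f -> 0 < e ->
  exists2 d : R, 0 < d &
    forall x y, A x -> `|y - x| < d -> `|f y - f x| <= e.
Proof.
move=> cA cf e0.
pose P d x := forall y, `|y - x| < d -> `|f y - f x| <= e.
have : \forall d \near 0^'+, A `<=` P d.
  apply: ((@compact_near_coveringP _ A).1 cA).
  move=> x Ax; have e2 : 0 < e / 2 by rewrite divr_gt0.
  have /cvgrPdist_lt/(_ _ e2)/nbhs_ballP[r /= r0 rP] := cf x.
  exists (ball x (r / 2), [set d | d < r / 2]) => /=.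
    split; first by apply: nbhsx_ballx; rewrite divr_gt0.
    by apply: nbhs_right_lt; rewrite divr_gt0.
  move=> [x' d]/= [xx' dr] y yx'.
  have r2 : r / 2 < r by lra.
  have h1 : `|f x - f x'| < e / 2.
    by apply: rP; apply: le_ball xx'; exact: ltW.
  have h2 : `|f x - f y| < e / 2.
    apply: rP; apply: (@ball_splitl _ _ x') => //.
    by rewrite -ball_normE/=; apply: lt_trans dr.
  rewrite (_ : f y - f x' = (f x - f x') - (f x - f y)); last by lra.
  by rewrite (le_trans (ler_normB _ _))//; lra.
move=> /nbhs_ballP[d /= d0 dP]; exists (d / 2); first by rewrite divr_gt0.
  move=> x y Ax; apply: (dP (d / 2)) => //.
    by rewrite /ball/= sub0r normrN gtr0_norm ?divr_gt0//; lra.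
  by rewrite divr_gt0.
Qed.

Lemma is_derive_at0 (g : R -> R) (t d : R) :
  is_derive (0 : R) 1 (fun h => g (t + h)) d -> is_derive t 1 g d.
Proof.
move=> gd.
have -> : g = (fun h => g (t + h)) \o (fun x => x - t).
  by apply/funext => x /=; rewrite addrC subrK.
rewrite -[d]mulr1; apply: is_derive1_comp; first by rewrite subrr.
by apply: is_derive_eq; rewrite subr0.
Qed.

(** All values of k i are equally frequent, since exchanging a and b in coordinate i is an
    involution of the grid. For a = [ord_max] this is the share of grid points at which a cyclic
    shift wraps around. *)
Lemma sum_ffun_coord_eq m N (i : 'I_m) (a : 'I_N.+1) :
  \sum_(k : {ffun 'I_m -> 'I_N.+1}) (k i == a)%:R =
  #|{ffun 'I_m -> 'I_N.+1}|%:R / N.+1%:R :> R.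
Proof.
have E b : \sum_(k : {ffun 'I_m -> 'I_N.+1}) (k i == b)%:R =
    \sum_(k : {ffun 'I_m -> 'I_N.+1}) (k i == a)%:R :> R.
  pose h (k : {ffun 'I_m -> 'I_N.+1}) :=
    [ffun j => if j == i then tperm a b (k j) else k j].
  have hK : involutive h.
    by move=> k; apply/ffunP => j; rewrite !ffunE; case: eqP => // _; rewrite tpermK.
  rewrite (reindex_inj (inv_inj hK)); apply: eq_bigr => k _.
  by rewrite ffunE eqxx -(inj_eq (@perm_inj _ (tperm a b))) tpermK tpermR.
apply: (canRL (mulfK _)); first by rewrite pnatr_eq0.
rewrite mulr_natr -[X in _ *+ X](card_ord N.+1) -sumr_const.
under eq_bigr => b _ do rewrite -(E b).
rewrite exchange_big /= -sum1_card natr_sum; apply: eq_bigr => k _.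
rewrite (bigD1 (k i))//= eqxx big1 ?addr0// => b bk.
by rewrite eq_sym (negbTE bk).
Qed.

(* Shifting cyclically in direction [i], the increments cancel except where the
   shift wraps around. *)
Lemma sum_increments_le m N (i : 'I_m) (p : {ffun 'I_m -> 'I_N.+1} -> 'rV[R]_m)
    (v : 'rV[R]_m) (V : 'rV[R]_m -> R) (B : R) :
  (forall k : {ffun 'I_m -> 'I_N.+1}, k i != ord_max ->
    p [ffun j => if j == i then ordS (k j) else k j] = p k + v) ->
  (forall k, `|V (p k)| <= B) -> (forall k, `|V (p k + v)| <= B) ->
  \sum_k (V (p k + v) - V (p k)) <= #|{ffun 'I_m -> 'I_N.+1}|%:R / N.+1%:R * (2 * B).
Proof.
move=> pv VB VvB.
pose h (k : {ffun 'I_m -> 'I_N.+1}) :=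
  [ffun j => if j == i then ordS (k j) else k j].
have hI : injective h.
  pose h' (k : {ffun 'I_m -> 'I_N.+1}) :=
    [ffun j => if j == i then ord_pred (k j) else k j].
  apply: (@can_inj _ _ h h').
  by move=> k; apply/ffunP => j; rewrite !ffunE; case: eqP => // _; rewrite ordSK.
rewrite sumrB [X in _ - X](reindex_inj hI) -sumrB -(sum_ffun_coord_eq i ord_max).
rewrite mulr_suml; apply: ler_sum => k _.
have [ki|ki] := eqVneq (k i) ord_max; last by rewrite mul0r pv// subrr.
rewrite mul1r; have := VB (h k); have := VvB k.
by rewrite !ler_norml => /andP[_ +] /andP[+ _]; lra.
Qed.

(* Instead of integrating, sum over a fine grid and compare [D i] with the
   increments of [V i] by the mean value theorem. *)
Lemma divergence_on_box m (V D : 'I_m -> 'rV[R]_m -> R) (L B : 'I_m -> R)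
    (c : R) :
  (forall i, 0 < L i) ->
  (forall i x, is_derive (0 : R) 1 (fun t : R => V i (x + t *: delta_mx 0 i))
     (D i x)) ->
  (forall i, continuous (D i)) ->
  (forall i (x : 'rV[R]_m), (forall j, 0 <= x 0 j <= L j) -> `|V i x| <= B i) ->
  (forall x : 'rV[R]_m, (forall j, 0 <= x 0 j <= L j) -> c <= \sum_i D i x) ->
  c <= \sum_i 2 * B i / L i.
Proof.
move=> L0 dV cD VB Dc.
pose A : set 'rV[R]_m := [set v | forall i, `[0, L i]%classic (v ord0 i)].
have AP x : A x <-> (forall j, 0 <= x 0 j <= L j).
  by split=> H j; have := H j; rewrite /= in_itv.
have cA : compact A.
  by apply: (@rV_compact R m (fun i => `[0, L i]%classic)) => i; exact: segment_compact.
apply/ler_addgt0Pr => e e0.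
have [e' e'0 e'e] : exists2 e' : R, 0 < e' & e' *+ m <= e.
  (* Each of the m directions may contribute an error e'; [m.+1] keeps the divisor nonzero when m =
     0. *)
  exists (e / m.+1%:R); first by rewrite divr_gt0//.
  rewrite -[_ *+ m]mulr_natr mulrAC ler_pdivrMr//.
  by apply: ler_wpM2l; [exact: ltW|rewrite ler_nat].
have [d d0 dP] : exists2 d : R, 0 < d & forall i x y, A x -> `|y - x| < d ->
    `|D i y - D i x| <= e'.
  have /choice[dd ddP] : forall i, exists d : R, 0 < d /\
      forall x y, A x -> `|y - x| < d -> `|D i y - D i x| <= e'.
    by move=> i; have [d] := compact_uniform_continuity cA (cD i) e'0; exists d.
  exists (\big[Num.min/1]_i dd i).
    by apply: lt_bigmin => // i _; have [] := ddP i.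
  move=> i x y Ax xy; have [_] := ddP i; apply => //.
  exact: lt_le_trans xy (bigmin_le _ _ _).
have [N NL] : exists N : nat, forall i, L i / N.+1%:R < d.
  exists (Num.truncn (\big[Num.max/0]_i (L i / d))) => i.
  rewrite ltr_pdivrMr// mulrC -ltr_pdivrMr//.
  apply: le_lt_trans (truncnS_gt _); exact: (le_bigmax _ (fun i => L i / d)).
pose del i := L i / N.+1%:R.
have del0 i : 0 < del i by rewrite divr_gt0.
pose G := {ffun 'I_m -> 'I_N.+1}.
pose p (k : G) : 'rV[R]_m := \row_i ((k i)%:R * del i).
have pA k : A (p k).
  apply/AP => j; rewrite mxE mulr_ge0 ?(ltW (del0 _))//=.
  by rewrite /del mulrCA ger_pMr// ler_pdivrMr// mul1r ler_nat ltnW.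
have mvt i k : del i * D i (p k) <= V i (p k + del i *: delta_mx 0 i) - V i (p k) + e' * del i.
  have dVt t : is_derive (t : R) 1 (fun t : R => V i (p k + t *: delta_mx 0 i))
      (D i (p k + t *: delta_mx 0 i)).
    apply: is_derive_at0; have := dV i (p k + t *: delta_mx 0 i).
    by under eq_fun do rewrite -addrA -scalerDl.
  have [|xi] := @MVT_segment R (fun t => V i (p k + t *: delta_mx 0 i)) (fun t => D i (p k + t *: delta_mx 0 i)) 0 (del i) (ltW (del0 i)).
    apply: continuous_subspaceT => t; apply: differentiable_continuous.
    by apply/derivable1_diffP; have [] := dVt t.
  rewrite in_itv/= => /andP[xi0 xi1] ; rewrite scale0r addr0 subr0 => ->.
  rewrite mulrC -mulrDl ler_pM2r//.
  have : `|D i (p k + xi *: delta_mx 0 i) - D i (p k)| <= e'.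
    apply: dP => //; rewrite addrAC subrr add0r normrZ.
    apply: le_lt_trans (NL i); rewrite ger0_norm// -/(del i) -[leRHS]mulr1.
    apply: ler_pM => //; rewrite -[Num.norm _]/(mx_norm _) mx_normrE; apply: bigmax_le => // a _.
    by rewrite mxE; case: (_ && _); rewrite ?normr0 ?normr1.
  by rewrite ler_norml => /andP[]; lra.
have c0 : 0 < #|{: G}|%:R :> R by rewrite ltr0n; apply/card_gt0P; exists [ffun=> ord0].
have -> : c = (\sum_(k : G) c) / #|{: G}|%:R.
  by rewrite sumr_const -[c *+ _]mulr_natr mulfK ?gt_eqF.
rewrite ler_pdivrMr//.
apply: (@le_trans _ _ (\sum_(k : G) \sum_i D i (p k))).
  by apply: ler_sum => k _; exact/Dc/AP/pA.
apply: (@le_trans _ _ (\sum_i (2 * B i / L i + e') * #|{: G}|%:R)); last first.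
  rewrite -mulr_suml ler_pM2r// big_split/= lerD2l sumr_const card_ord//.
rewrite exchange_big/=; apply: ler_sum => i _.
(* Multiplied by the grid step, derivatives become increments. The factor 1 / N.+1 in the step
   matches the share of wrapped points, which leaves 2 B_i / L_i whatever N is. *)
rewrite -(ler_pM2l (del0 i)) mulr_sumr.
apply: le_trans (ler_sum _ (fun k _ => mvt i k)) _.
rewrite big_split/= sumr_const -[X in _ + X]mulr_natr.
rewrite [leRHS](_ : _ = #|{: G}|%:R / N.+1%:R * (2 * B i) + e' * del i * #|{: G}|%:R).
  rewrite lerD2r; apply: (sum_increments_le (i := i)).
  - move=> k ki; apply/rowP => j; rewrite !mxE ffunE eqxx /=.
    have [->|ji] := eqVneq j i; last by rewrite mulr0 addr0.
    rewrite mulr1 /= modn_small; first by rewrite -natr1 mulrDl mul1r.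
    rewrite ltn_neqAle ltn_ord andbT.
    by apply: contra_neq ki => /eqP ki; apply: val_inj => /=; move/eqP: ki => [].
  - by move=> k; exact/VB/AP/pA.
  - move=> k; apply: VB => j; rewrite !mxE eqxx/=.
    have := (AP (p k)).1 (pA k) j; rewrite mxE.
    have [->|ji] := eqVneq j i; last by rewrite mulr0 addr0.
    rewrite mulr1 => /andP[h1 _]; rewrite addr_ge0 ?(ltW (del0 _))//=.
    rewrite -[X in _ + X]mul1r -mulrDl natr1 /del mulrCA ger_pMr//.
    by rewrite ler_pdivrMr// mul1r ler_nat.
by rewrite /del; field; rewrite ?gt_eqF.
Qed.

End DivergenceOnBoxes.

(** * Wirtinger calculus *)

Section RealDerivatives.
Variables (R : realType) (n : nat).
Local Notation C := R[i].
Local Notation Cn := 'rV[C]_n.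
Implicit Types (f g : Cn -> C) (u v w z : Cn) (V W : set Cn).

Lemma line_continuous z v : continuous (fun x : R => z + x%:C *: v).
Proof.
move=> x W /nbhs_cbox[e e0 eW].
pose b := 1 + \sum_j (`|complex.Re (v 0 j)| + `|complex.Im (v 0 j)|).
have b0 : 0 < b by rewrite ltr_pwDl// sumr_ge0// => j _; rewrite addr_ge0.
have bj j : `|complex.Re (v 0 j)| <= b /\ `|complex.Im (v 0 j)| <= b.
  rewrite /b (bigD1 j)//=; set S := \sum_(_ | _) _.
  have S0 : 0 <= S by rewrite sumr_ge0// => k _; rewrite addr_ge0.
  have := normr_ge0 (complex.Re (v 0 j)); have := normr_ge0 (complex.Im (v 0 j)).
  by split; lra.
apply/nbhs_ballP; exists (e / b); first by rewrite /= divr_gt0.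
move=> y xy; have {}xy : `|x - y| < e / b by exact: xy.
have lE j : (z + y%:C *: v) 0 j = z 0 j + y%:C * v 0 j.
  by rewrite mxE [X in _ + X]mxE.
have lE' j : (z + x%:C *: v) 0 j = z 0 j + x%:C * v 0 j.
  by rewrite mxE [X in _ + X]mxE.
apply: eW => j; rewrite lE lE'.
have H a : `|a| <= b -> `|(y - x) * a| <= e.
  move=> ab; rewrite normrM distrC -[leRHS](divfK (lt0r_neq0 b0)).
  by apply: ler_pM => //; exact: ltW.
have [/H h1 /H h2] := bj j; move: h1 h2; case: (v 0 j) => a1 a2 /=; case: (z 0 j) => z1 z2 /=.
by split; [move: h1|move: h2]; congr (`|_| <= _); ring.
Qed.

(** [rderive] has a default value when there is no derivative; this relation carries existence and
    value together, so that the rules of calculus compose. *)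
Definition is_rderive v f z (d : C) : Prop :=
  is_derive (0 : R) 1 (fun x : R => complex.Re (f (z + x%:C *: v))) (complex.Re d) /\
  is_derive (0 : R) 1 (fun x : R => complex.Im (f (z + x%:C *: v))) (complex.Im d).

Lemma is_rderiveP v f z d :
  is_rderive v f z d <-> rderivable f v z /\ rderive v f z = d.
Proof.
have H (F : R -> R) : derivable F 0 1 -> is_derive (0 : R) 1 F (derive1 F 0).
  by rewrite derive1E; exact: derivableP.
split=> [[d1 d2]|[[d1 d2] <-]]; last by exact: (conj (H _ d1) (H _ d2)).
split; first by exact: (conj (@ex_derive _ _ _ _ _ _ _ d1) (@ex_derive _ _ _ _ _ _ _ d2)).
rewrite /rderive !derive1E (@derive_val _ _ _ _ _ _ _ d1) (@derive_val _ _ _ _ _ _ _ d2).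
by case: d {d1 d2}.
Qed.

Lemma is_rderive_near v f g z d : (\forall y \near z, f y = g y) ->
  is_rderive v f z d -> is_rderive v g z d.
Proof.
move=> fg [fd1 fd2].
have fgl : \forall x \near (0 : R), f (z + x%:C *: v) = g (z + x%:C *: v).
  by have := @line_continuous z v 0; rewrite /continuous_at scale0r addr0 => /(_ _ fg).
split.
- by apply: near_eq_is_derive fd1; apply: filterS fgl => x ->.
- by apply: near_eq_is_derive fd2; apply: filterS fgl => x ->.
Qed.

Lemma is_rderive_cst v (c : C) z : is_rderive v (fun=> c) z 0.
Proof. by split; exact: is_derive_cst. Qed.

Lemma is_rderiveD v f g z a b : is_rderive v f z a -> is_rderive v g z b ->
  is_rderive v (fun y => f y + g y) z (a + b).
Proof.
move=> [f1 f2] [g1 g2]; split.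
- rewrite (_ : (fun _ => _) = (fun x : R => complex.Re (f (z + x%:C *: v))) \+
    (fun x : R => complex.Re (g (z + x%:C *: v)))); last first.
    by apply/funext => x /=; rewrite raddfD.
  by rewrite raddfD; exact: is_deriveD.
- rewrite (_ : (fun _ => _) = (fun x : R => complex.Im (f (z + x%:C *: v))) \+
    (fun x : R => complex.Im (g (z + x%:C *: v)))); last first.
    by apply/funext => x /=; rewrite raddfD.
  by rewrite raddfD; exact: is_deriveD.
Qed.

Lemma is_rderiveM v f g z a b : is_rderive v f z a -> is_rderive v g z b ->
  is_rderive v (fun y => f y * g y) z (a * g z + f z * b).
Proof.
move=> [f1 f2] [g1 g2].
pose F1 (x : R) := complex.Re (f (z + x%:C *: v)); pose F2 (x : R) := complex.Im (f (z + x%:C *: v)).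
pose G1 (x : R) := complex.Re (g (z + x%:C *: v)); pose G2 (x : R) := complex.Im (g (z + x%:C *: v)).
have z0 : z + (0 : R)%:C *: v = z by rewrite scale0r addr0.
split.
- rewrite (_ : (fun _ => _) = F1 * G1 - F2 * G2); last first.
    apply/funext => x; rewrite /F1 /F2 /G1 /G2 !fctE.
    by case: (f _) => ? ?; case: (g _).
  apply: (is_derive_eq (is_deriveB (is_deriveM f1 g1) (is_deriveM f2 g2))).
  rewrite !z0; case: (a) => ? ?; case: (b) => ? ?; case: (f z) => ? ?; case: (g z) => ? ? /=.
  by rewrite /GRing.scale/=; ring.
- rewrite (_ : (fun _ => _) = F1 * G2 + F2 * G1); last first.
    apply/funext => x; rewrite /F1 /F2 /G1 /G2 !fctE.
    by case: (f _) => ? ?; case: (g _).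
  apply: (is_derive_eq (is_deriveD (is_deriveM f1 g2) (is_deriveM f2 g1))).
  rewrite !z0; case: (a) => ? ?; case: (b) => ? ?; case: (f z) => ? ?; case: (g z) => ? ? /=.
  by rewrite /GRing.scale/=; ring.
Qed.

Lemma is_rderive_sum (I : Type) (r : seq I) (P : pred I) v (F : I -> Cn -> C) z a :
  (forall i, P i -> is_rderive v (F i) z (a i)) ->
  is_rderive v (fun y => \sum_(i <- r | P i) F i y) z (\sum_(i <- r | P i) a i).
Proof.
move=> Fa; elim: r => [|i r IH].
  by rewrite big_nil; under eq_fun do rewrite big_nil; exact: is_rderive_cst.
rewrite big_cons; under eq_fun do rewrite big_cons; case: ifP => // Pi.
by apply: is_rderiveD => //; exact: Fa.
Qed.

Lemma is_rderive_scale (c : R) v f z a :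
  is_rderive v f z a -> is_rderive (c%:C *: v) f z (c%:C * a).
Proof.
have E (F : R -> R) b : is_derive (0 : R) 1 F b ->
    is_derive (0 : R) 1 (fun x => F (x * c)) (c * b).
  move=> Fb; rewrite mulrC.
  apply: (@is_derive1_comp _ F (fun x => x * c)); first by rewrite mul0r.
  rewrite -[X in is_derive _ _ _ X]mulr1.
  rewrite (_ : (fun x => _) = c *: (id : R -> R)); last by apply/funext => x; rewrite mulrC.
  exact: is_deriveZ.
have L x : z + x%:C *: (c%:C *: v) = z + (x * c)%:C *: v.
  by rewrite scalerA rmorphM.
move=> [/E d1 /E d2]; split.
- under eq_fun do rewrite L.
  by apply: (is_derive_eq d1); case: (a) => a1 a2/=; ring.
- under eq_fun do rewrite L.
  by apply: (is_derive_eq d2); case: (a) => a1 a2/=; ring.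
Qed.

End RealDerivatives.

Section ClassCk.
Variables (R : realType) (n : nat).
Local Notation C := R[i].
Local Notation Cn := 'rV[C]_n.
Implicit Types (f g : Cn -> C) (u v w z : Cn) (V W : set Cn) (k : nat).

Lemma Re_continuous : continuous (@complex.Re R : C -> R).
Proof.
move=> x W /nbhs_ballP[e /= e0 eW]; apply/nbhs_ballP.
exists (e / 2)%:C; first by rewrite /= ltcR divr_gt0.
move=> y xy; apply: eW; have e2 : e / 2 < e by move: (e0 : 0 < e); lra.
apply: le_lt_trans e2; rewrite -raddfB; apply: Re_le_normc; exact: xy.
Qed.

Lemma Im_continuous : continuous (@complex.Im R : C -> R).
Proof.
move=> x W /nbhs_ballP[e /= e0 eW]; apply/nbhs_ballP.
exists (e / 2)%:C; first by rewrite /= ltcR divr_gt0.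
move=> y xy; apply: eW; have e2 : e / 2 < e by move: (e0 : 0 < e); lra.
apply: le_lt_trans e2; rewrite -raddfB; apply: Im_le_normc; exact: xy.
Qed.

Lemma near_eq_continuous_at z f g : (\forall y \near z, f y = g y) ->
  {for z, continuous f} -> {for z, continuous g}.
Proof.
move=> fg fc; change (g x @[x --> z] --> g z); rewrite -(nbhs_singleton fg).
move=> A /fc; apply: filterS2 fg => y /= fgy; by rewrite fgy.
Qed.

(** Every clause of [of_class_C] is a condition at single points of V, so it may be checked on any W
    through the point. This glues the charts in [lifted_metric_smooth]. *)
Lemma of_class_C_local k V f :
  (forall z, V z -> exists2 W, W z & of_class_C k W f) -> of_class_C k V f.
Proof.
elim: k f => [|k IH] f H; split.
- by move=> z /H[W Wz [fc _]]; exact: (fc z Wz).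
- exact: I.
- by move=> z /H[W Wz [fc _]]; exact: (fc z Wz).
- move=> v; split; first by move=> z /H[W Wz [_ /(_ v)[fd _]]]; exact: (fd z Wz).
  by apply: IH => z /H[W Wz [_ /(_ v)[_ fd]]]; exists W.
Qed.

Lemma of_class_C_sub k V W f : W `<=` V -> of_class_C k V f -> of_class_C k W f.
Proof. by move=> WV Vf; apply: of_class_C_local => z /WV Vz; exists V. Qed.

Lemma of_class_CW k V f : of_class_C k.+1 V f -> of_class_C k V f.
Proof.
elim: k f => [|k IH] f; first by move=> [].
move=> [fc fd]; split; first exact: fc.
by move=> v; have [fv fv'] := fd v; split; [exact: fv|exact: IH].
Qed.

Lemma of_class_C_continuous k V f z : of_class_C k V f -> V z -> {for z, continuous f}.
Proof. by case: k => [|k] [fc _] Vz; exact: fc. Qed.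

Lemma of_class_C_rderive k V f v :
  of_class_C k.+1 V f -> of_class_C k V (rderive v f).
Proof. by move=> [_ /(_ v)[]]. Qed.

Lemma of_class_C_is_rderive k V f v z : of_class_C k.+1 V f -> V z ->
  is_rderive v f z (rderive v f z).
Proof. by move=> [_ /(_ v)[fd _]] Vz; apply/is_rderiveP; exact: (conj (fd z Vz) erefl). Qed.

Lemma rderiveE v f z d : is_rderive v f z d -> rderive v f z = d.
Proof. by move/is_rderiveP => []. Qed.

Lemma eq_of_class_C k V f g : open V -> (forall z, V z -> f z = g z) ->
  of_class_C k V f -> of_class_C k V g.
Proof.
move=> oV; have nV z : V z -> nbhs z V by move=> Vz; exact: open_nbhs_nbhs.
elim: k f g => [|k IH] f g fg [fc fd].
  split; last exact: I.
  move=> z Vz; apply: near_eq_continuous_at (fc z Vz).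
  exact: filterS (nV z Vz).
have fgd v z d : V z -> is_rderive v f z d -> is_rderive v g z d.
  by move=> Vz; apply: is_rderive_near; apply: filterS (nV z Vz).
split.
  move=> z Vz; apply: near_eq_continuous_at (fc z Vz).
  exact: filterS (nV z Vz).
move=> v; have [fv fv'] := fd v; split.
  move=> z Vz.
  have fz : is_rderive v f z (rderive v f z) by apply/is_rderiveP; exact: (conj (fv z Vz) erefl).
  exact: ((is_rderiveP _ _ _ _).1 (fgd v z _ Vz fz)).1.
apply: (IH _ _ _ fv') => z Vz; apply/esym/rderiveE/(fgd v z _ Vz)/is_rderiveP.
exact: (conj (fv z Vz) erefl).
Qed.

Lemma of_class_C_intro k V f (df : Cn -> Cn -> C) : open V ->
  (forall z, V z -> {for z, continuous f}) ->
  (forall v z, V z -> is_rderive v f z (df v z)) ->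
  (forall v, of_class_C k V (df v)) -> of_class_C k.+1 V f.
Proof.
move=> oV fc fd dfc; split; first exact: fc.
move=> v; split; first by move=> z /(fd v) /is_rderiveP [fz _]; exact: fz.
apply: (eq_of_class_C oV _ (dfc v)) => z Vz; apply/esym/rderiveE; exact: fd.
Qed.

Lemma of_class_C_cst k V (c : C) : open V -> of_class_C k V (fun=> c).
Proof.
move=> oV; elim: k c => [|k IH] c; first by split; [move=> z _; exact: cst_continuous|exact: I].
apply: (of_class_C_intro (df := fun _ _ => 0) oV).
- by move=> z _; exact: cst_continuous.
- by move=> v z _; exact: is_rderive_cst.
- by move=> v; exact: IH.
Qed.

Lemma of_class_CD k V f g : open V -> of_class_C k V f -> of_class_C k V g ->
  of_class_C k V (fun z => f z + g z).
Proof.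
move=> oV; elim: k f g => [|k IH] f g fk gk.
  split; last exact: I.
  move=> z Vz; apply: continuousD; [exact: of_class_C_continuous fk Vz|exact: of_class_C_continuous gk Vz].
apply: (of_class_C_intro (df := fun v z => rderive v f z + rderive v g z) oV).
- move=> z Vz; apply: continuousD; [exact: of_class_C_continuous fk Vz|exact: of_class_C_continuous gk Vz].
- by move=> v z Vz; apply: is_rderiveD; [exact: of_class_C_is_rderive fk Vz|exact: of_class_C_is_rderive gk Vz].
- by move=> v; apply: IH; exact: of_class_C_rderive.
Qed.

Lemma of_class_CM k V f g : open V -> of_class_C k V f -> of_class_C k V g ->
  of_class_C k V (fun z => f z * g z).
Proof.
move=> oV; elim: k f g => [|k IH] f g fk gk.
  split; last exact: I.
  move=> z Vz; apply: (@continuousM C Cn f g); [exact: of_class_C_continuous fk Vz|exact: of_class_C_continuous gk Vz].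
apply: (of_class_C_intro (df := fun v z => rderive v f z * g z + f z * rderive v g z) oV).
- move=> z Vz; apply: (@continuousM C Cn f g); [exact: of_class_C_continuous fk Vz|exact: of_class_C_continuous gk Vz].
- by move=> v z Vz; apply: is_rderiveM; [exact: of_class_C_is_rderive fk Vz|exact: of_class_C_is_rderive gk Vz].
- move=> v; apply: (of_class_CD oV).
    by apply: IH; [exact: of_class_C_rderive|exact: of_class_CW].
  by apply: IH; [exact: of_class_CW|exact: of_class_C_rderive].
Qed.

Lemma of_class_C_sum k V (I : Type) (r : seq I) (P : pred I) (F : I -> Cn -> C) :
  open V -> (forall i, P i -> of_class_C k V (F i)) ->
  of_class_C k V (fun z => \sum_(i <- r | P i) F i z).
Proof.
move=> oV Fk; elim: r => [|i r IH].
  by under eq_fun do rewrite big_nil; exact: of_class_C_cst.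
under eq_fun do rewrite big_cons; case Pi: (P i); last exact: IH.
by apply: (of_class_CD oV); [exact: Fk|exact: IH].
Qed.

Lemma mean_value0 (g dg : R -> R) (h : R) :
  (forall x : R, `|x| <= `|h| -> is_derive x 1 g (dg x)) ->
  exists2 x : R, `|x| <= `|h| & g h - g 0 = dg x * h.
Proof.
move=> gd; have [h0|h0] := leP 0 h.
  have I x : x \in `[0, h] -> `|x| <= `|h|.
    by rewrite in_itv/= => /andP[x0 xh]; rewrite !ger0_norm.
  have [||x xh] := @MVT_segment R g dg 0 h h0.
  - by move=> x /subset_itv_oo_cc/I/gd.
  - by apply: derivable_within_continuous => x /I/gd[].
  by rewrite subr0; exists x => //; exact: I.
have I x : x \in `[h, 0] -> `|x| <= `|h|.
  by rewrite in_itv/= => /andP[x0 xh]; rewrite !ler0_norm ?lerN2// ltW.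
have [||x xh] := @MVT_segment R g dg h 0 (ltW h0).
- by move=> x /subset_itv_oo_cc/I/gd.
- by apply: derivable_within_continuous => x /I/gd[].
by rewrite sub0r mulrN => /eqP; rewrite -eqr_oppLR opprB => /eqP; exists x => //; exact: I.
Qed.

(* Along [t |-> z + t (v + w)], one first moves by [t w] from [z + t v]: the mean
   value theorem turns the second increment into [t] times a derivative along [w]
   near [z]. *)
Lemma is_rderiveD_dir V f v w z : open V -> of_class_C 1 V f -> V z ->
  is_rderive (v + w) f z (rderive v f z + rderive w f z).
Proof.
move=> oV f1 Vz.
have key (F : Cn -> R) (dv : R) (dF : Cn -> R) :
    (forall y, V y -> is_derive (0 : R) 1 (fun x : R => F (y + x%:C *: w)) (dF y)) ->
    is_derive (0 : R) 1 (fun x : R => F (z + x%:C *: v)) dv ->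
    {for z, continuous dF} ->
    is_derive (0 : R) 1 (fun x : R => F (z + x%:C *: (v + w))) (dv + dF z).
  move=> Fw Fv dFc.
  pose G (x : R) := F (z + x%:C *: (v + w)) - F (z + x%:C *: v).
  have -> : (fun x : R => F (z + x%:C *: (v + w))) =
      (fun x : R => F (z + x%:C *: v)) \+ G.
    by apply/funext => x /=; rewrite /G [RHS]addrC subrK.
  apply: is_deriveD.
  have G0 : G 0 = 0 by rewrite /G !scale0r subrr.
  have cv : (fun h : R => h^-1 *: (G (h *: 1 + 0) - G 0)) @ (0 : R)^' --> dF z.
    apply/cvgrPdist_le => e e0.
    have /cvgrPdist_le/(_ _ e0) zU := dFc.
    (* Two displacements have to be small at once: h along v, and the mean value parameter along w,
       which is at most h in absolute value. *)
    have cp : {for (0, 0), continuous (fun p : R * R => (z + p.1%:C *: v) + (0 + p.2%:C *: w))}.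
      apply: continuousD.
        apply: (@continuous_comp _ _ _ (@fst R R) (fun x : R => z + x%:C *: v)).
          exact: cvg_fst.
        exact: line_continuous.
      apply: (@continuous_comp _ _ _ (@snd R R) (fun x : R => 0 + x%:C *: w)).
        exact: cvg_snd.
      exact: line_continuous.
    have nU : nbhs z (V `&` [set t | `|dF z - dF t| <= e]).
      by apply: filterI => //; exact: open_nbhs_nbhs.
    have z00 : z + (0 : R)%:C *: v + (0 + (0 : R)%:C *: w) = z by rewrite !scale0r !addr0.
    move: nU; rewrite -[X in nbhs X]z00 => nU'; have nU2 := cp _ nU'.
    pose L (p : R * R) := z + p.1%:C *: v + (0 + p.2%:C *: w).
    have /nbhs_ballP[d /= d0 dP] : nbhs ((0, 0) : R * R) (L @^-1` _) := nU2.
    have near_d : \forall h \near (0 : R)^', `|h| < d.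
      by apply: dnbhs0_lt.
    have near0 : \forall h \near (0 : R)^', h != 0 by exact: nbhs_dnbhs_neq.
    apply: filterS2 near_d near0 => h hd h0.
    have U x : `|x| <= `|h| -> V (z + h%:C *: v + x%:C *: w) /\
        `|dF z - dF (z + h%:C *: v + x%:C *: w)| <= e.
      move=> xh; have := dP (h, x); rewrite /L/= add0r; apply.
      by split; rewrite /ball/= sub0r normrN//; exact: le_lt_trans hd.
    have [|xi xih] := @mean_value0 (fun x => F (z + h%:C *: v + x%:C *: w))
        (fun x => dF (z + h%:C *: v + x%:C *: w)) h.
      move=> x /U[Vx _].
      have E : (fun t : R => F (z + h%:C *: v + (x + t)%:C *: w)) =
          (fun t : R => F (z + h%:C *: v + x%:C *: w + t%:C *: w)).
        by apply/funext => t; rewrite rmorphD scalerDl addrA.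
      have D := Fw _ Vx; rewrite -E in D.
      exact: (@is_derive_at0 R (fun x => F (z + h%:C *: v + x%:C *: w)) x _ D).
    move=> mv; have -> : h *: (1 : R) + 0 = h by rewrite addr0; exact: mulr1.
    have -> : G h = dF (z + h%:C *: v + xi%:C *: w) * h.
      rewrite -mv /G [in RHS]scale0r addr0; congr (F _ - F _).
      by rewrite scalerDr addrA.
    rewrite G0 subr0 [h^-1 *: _]mulrC mulfK//; exact: (U _ xih).2.
  by apply: DeriveDef; [apply/cvg_ex; exists (dF z)|exact: cvg_lim].
have fw y : V y -> is_rderive w f y (rderive w f y) := of_class_C_is_rderive w f1 (z := y).
have fv : is_rderive v f z (rderive v f z) by exact: of_class_C_is_rderive f1 Vz.
have fwc : {for z, continuous (rderive w f)}.
  exact: of_class_C_continuous (of_class_C_rderive w f1) Vz.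
have cRe : {for z, continuous (fun y => complex.Re (rderive w f y))}.
  exact: continuous_comp fwc (@Re_continuous _).
have cIm : {for z, continuous (fun y => complex.Im (rderive w f y))}.
  exact: continuous_comp fwc (@Im_continuous _).
split.
- rewrite raddfD; exact: (key (fun y => complex.Re (f y)) _ (fun y => complex.Re (rderive w f y))
    (fun y Vy => (fw y Vy).1) fv.1 cRe).
- rewrite raddfD; exact: (key (fun y => complex.Im (f y)) _ (fun y => complex.Im (rderive w f y))
    (fun y Vy => (fw y Vy).2) fv.2 cIm).
Qed.

End ClassCk.

Section Wirtinger.
Variables (R : realType) (n : nat).
Local Notation C := R[i].
Local Notation Cn := 'rV[C]_n.
Implicit Types (f g : Cn -> C) (u v w z : Cn) (V W : set Cn) (k : nat) (j : 'I_n).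

Lemma dzE j f z a b : is_rderive (delta_mx 0 j) f z a ->
  is_rderive ('i *: delta_mx 0 j) f z b -> dz j f z = 2%:R^-1 * (a - 'i * b).
Proof. by move=> /rderiveE fa /rderiveE fb; rewrite /dz fa fb. Qed.

Lemma dzbarE j f z a b : is_rderive (delta_mx 0 j) f z a ->
  is_rderive ('i *: delta_mx 0 j) f z b -> dzbar j f z = 2%:R^-1 * (a + 'i * b).
Proof. by move=> /rderiveE fa /rderiveE fb; rewrite /dzbar fa fb. Qed.

Lemma of_class_C_dz k V f j : open V -> of_class_C k.+1 V f -> of_class_C k V (dz j f).
Proof.
move=> oV fk; apply: (of_class_CM oV); first exact: of_class_C_cst.
apply: (of_class_CD oV); first exact: of_class_C_rderive.
under eq_fun do rewrite -mulNr.
by apply: (of_class_CM oV); [exact: of_class_C_cst|exact: of_class_C_rderive].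
Qed.

Lemma of_class_C_dzbar k V f j : open V -> of_class_C k.+1 V f -> of_class_C k V (dzbar j f).
Proof.
move=> oV fk; apply: (of_class_CM oV); first exact: of_class_C_cst.
apply: (of_class_CD oV); first exact: of_class_C_rderive.
by apply: (of_class_CM oV); [exact: of_class_C_cst|exact: of_class_C_rderive].
Qed.

Lemma dzM V f g j z : of_class_C 1 V f -> of_class_C 1 V g -> V z ->
  dz j (fun z => f z * g z) z = dz j f z * g z + f z * dz j g z.
Proof.
move=> f1 g1 Vz; have D v := is_rderiveM (of_class_C_is_rderive v f1 Vz) (of_class_C_is_rderive v g1 Vz).
rewrite (dzE (D _) (D _)) /dz.
move: (rderive ('i *: _) f z) (rderive ('i *: _) g z) (rderive _ f z) (rderive _ g z).
by move: (f z) (g z) => a b a1 b1 a2 b2; ring.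
Qed.

Lemma dzbarM V f g j z : of_class_C 1 V f -> of_class_C 1 V g -> V z ->
  dzbar j (fun z => f z * g z) z = dzbar j f z * g z + f z * dzbar j g z.
Proof.
move=> f1 g1 Vz; have D v := is_rderiveM (of_class_C_is_rderive v f1 Vz) (of_class_C_is_rderive v g1 Vz).
rewrite (dzbarE (D _) (D _)) /dzbar.
move: (rderive ('i *: _) f z) (rderive ('i *: _) g z) (rderive _ f z) (rderive _ g z).
by move: (f z) (g z) => a b a1 b1 a2 b2; ring.
Qed.

Lemma dz_sum V (I : Type) (r : seq I) (P : pred I) (F : I -> Cn -> C) j z :
  (forall i, P i -> of_class_C 1 V (F i)) -> V z ->
  dz j (fun z => \sum_(i <- r | P i) F i z) z = \sum_(i <- r | P i) dz j (F i) z.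
Proof.
move=> F1 Vz; have D v := is_rderive_sum r (fun i Pi => of_class_C_is_rderive v (F1 i Pi) Vz).
by rewrite (dzE (D _) (D _)) mulr_sumr -sumrB mulr_sumr.
Qed.

Lemma dzbar_sum V (I : Type) (r : seq I) (P : pred I) (F : I -> Cn -> C) j z :
  (forall i, P i -> of_class_C 1 V (F i)) -> V z ->
  dzbar j (fun z => \sum_(i <- r | P i) F i z) z = \sum_(i <- r | P i) dzbar j (F i) z.
Proof.
move=> F1 Vz; have D v := is_rderive_sum r (fun i Pi => of_class_C_is_rderive v (F1 i Pi) Vz).
by rewrite (dzbarE (D _) (D _)) mulr_sumr -big_split mulr_sumr.
Qed.

Lemma dz_cst j (c : C) z : dz j (fun=> c) z = 0.
Proof. by rewrite (dzE (is_rderive_cst _ _ _) (is_rderive_cst _ _ _)) mulr0 subr0 mulr0. Qed.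

Lemma dzbar_cst j (c : C) z : dzbar j (fun=> c) z = 0.
Proof. by rewrite (dzbarE (is_rderive_cst _ _ _) (is_rderive_cst _ _ _)) mulr0 addr0 mulr0. Qed.

Lemma dzZ V (c : C) f j z : open V -> of_class_C 1 V f -> V z ->
  dz j (fun z => c * f z) z = c * dz j f z.
Proof.
move=> oV f1 Vz; rewrite (dzM j (of_class_C_cst 1 c oV) f1 Vz).
by rewrite dz_cst mul0r add0r.
Qed.

Lemma dzbarZ V (c : C) f j z : open V -> of_class_C 1 V f -> V z ->
  dzbar j (fun z => c * f z) z = c * dzbar j f z.
Proof.
move=> oV f1 Vz; rewrite (dzbarM j (of_class_C_cst 1 c oV) f1 Vz).
by rewrite dzbar_cst mul0r add0r.
Qed.

Lemma eq_on_dz V f g j z : open V -> of_class_C 1 V f ->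
  (forall y, V y -> f y = g y) -> V z -> dz j f z = dz j g z.
Proof.
move=> oV f1 fg Vz; have D v : is_rderive v g z (rderive v f z).
  apply: is_rderive_near (of_class_C_is_rderive v f1 Vz).
  exact: filterS fg (open_nbhs_nbhs (conj oV Vz)).
by rewrite [RHS](dzE (D _) (D _)).
Qed.

Lemma eq_on_dzbar V f g j z : open V -> of_class_C 1 V f ->
  (forall y, V y -> f y = g y) -> V z -> dzbar j f z = dzbar j g z.
Proof.
move=> oV f1 fg Vz; have D v : is_rderive v g z (rderive v f z).
  apply: is_rderive_near (of_class_C_is_rderive v f1 Vz).
  exact: filterS fg (open_nbhs_nbhs (conj oV Vz)).
by rewrite [RHS](dzbarE (D _) (D _)).
Qed.

Section DiagonalAffine.
Variables (V : set Cn) (f : Cn -> C) (l b : 'I_n -> C) (j : 'I_n) (z : Cn).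
Let T (z : Cn) : Cn := \row_j (l j * z 0 j + b j).
Hypotheses (oV : open V) (f1 : of_class_C 1 V f) (VTz : V (T z)).

(** Moving z_j by x c moves the same coordinate of T z by x c l_j. Split c l_j into real and
    imaginary parts and use additivity in the direction, which is where class C^1 enters. *)
Let rderive_T (c : C) : is_rderive (c *: delta_mx 0 j) (fun z => f (T z)) z
  ((complex.Re (c * l j))%:C * rderive (delta_mx 0 j) f (T z) +
   (complex.Im (c * l j))%:C * rderive ('i *: delta_mx 0 j) f (T z)).
Proof.
set a1 := complex.Re _; set a2 := complex.Im _.
have D : is_rderive (a1%:C *: delta_mx 0 j + a2%:C *: ('i *: delta_mx 0 j)) f (T z)
  (a1%:C * rderive (delta_mx 0 j) f (T z) + a2%:C * rderive ('i *: delta_mx 0 j) f (T z)).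
  have S v a := is_rderive_scale a (of_class_C_is_rderive v f1 VTz).
  have := is_rderiveD_dir (a1%:C *: delta_mx 0 j) (a2%:C *: ('i *: delta_mx 0 j)) oV f1 VTz.
  by rewrite (rderiveE (S _ _)) (rderiveE (S _ _)).
have E x : T (z + x%:C *: (c *: delta_mx 0 j)) =
    T z + x%:C *: (a1%:C *: delta_mx 0 j + a2%:C *: ('i *: delta_mx 0 j)).
  have cl : a1%:C + a2%:C * 'i = c * l j.
    by rewrite [RHS]complexE -/a1 -/a2; congr (_ + _); exact: mulrC.
  rewrite [a2%:C *: _]scalerA -scalerDl cl.
  apply/rowP => i; rewrite !mxE; have [->|ij] := eqVneq i j; last by rewrite !mulr0 !addr0.
  by rewrite eqxx !mulr1; ring.
by move: D => [D1 D2]; split; under eq_fun do rewrite E.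
Qed.

(** T is holomorphic and diagonal, so d/dz_j brings out l_j and d/dzbar_j its conjugate: these are
    the weights of dz_j and dzbar_j under the action. *)
Lemma dz_affine (c : C) :
  dz j (fun z => c * f (T z)) z = c * l j * dz j f (T z).
Proof.
have D d := is_rderiveM (is_rderive_cst (d *: delta_mx 0 j) c z) (rderive_T d).
have := D 1; rewrite scale1r => D1.
rewrite (dzE D1 (D 'i)) /dz mul1r !mul0r !add0r.
move: (rderive ('i *: _) f (T z)) (rderive _ f (T z)); case: c {D D1} => c1 c2.
case: (l j) => a1 a2 d1 d2; apply/eqP; case: d1 => ? ?; case: d2 => ? ?.
by rewrite eq_complex /=; apply/andP; split; apply/eqP; field.
Qed.

Lemma dzbar_affine (c : C) :
  dzbar j (fun z => c * f (T z)) z = c * (l j)^* * dzbar j f (T z).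
Proof.
have D d := is_rderiveM (is_rderive_cst (d *: delta_mx 0 j) c z) (rderive_T d).
have := D 1; rewrite scale1r => D1.
rewrite (dzbarE D1 (D 'i)) /dzbar mul1r !mul0r !add0r.
move: (rderive ('i *: _) f (T z)) (rderive _ f (T z)); case: c {D D1} => c1 c2.
case: (l j) => a1 a2 d1 d2; apply/eqP; case: d1 => ? ?; case: d2 => ? ?.
by rewrite eq_complex /=; apply/andP; split; apply/eqP; field.
Qed.

End DiagonalAffine.

End Wirtinger.

(** * Monomials in the imaginary parts *)

Section Monomials.
Variables (R : realType) (n : nat).
Local Notation C := R[i].
Local Notation Cn := 'rV[C]_n.
Implicit Types (e : 'I_n -> R) (v z : Cn) (V : set Cn) (k : nat) (j : 'I_n).

(* The product of the powers (Im z_j)^(e j); a factor with [e j = 0] is 1 even if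
   [Im z_j <= 0]. *)
Definition mon e z : R := expR (\sum_j e j * ln (complex.Im (z 0 j))).

Definition decr e j : 'I_n -> R := fun i => e i - (i == j)%:R.

(** Exponent 0 imposes nothing, so that the complex coordinates of H^s x C^t remain unrestricted. *)
Definition mon_dom V e := forall z j, V z -> e j != 0 -> 0 < complex.Im (z 0 j).

Lemma mon_gt0 e z : 0 < mon e z.
Proof. exact: expR_gt0. Qed.

Lemma mon_decr e j z : 0 < complex.Im (z 0 j) ->
  mon e z = mon (decr e j) z * complex.Im (z 0 j).
Proof.
move=> zj; rewrite -[X in _ * X](lnK (x := complex.Im (z 0 j))) ?posrE// -expRD.
congr expR; rewrite (bigD1 j)//= [in RHS](bigD1 j)//= addrAC -[X in _ + X + _]mul1r.
rewrite -mulrDl /decr eqxx subrK; congr (_ + _); apply: eq_bigr => i /negbTE ->.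
by rewrite subr0.
Qed.

Lemma mon_dom_decr V e j : mon_dom V e -> e j != 0 -> mon_dom V (decr e j).
Proof.
move=> Ve ej z i Vz; have [-> _|ij] := eqVneq i j; first exact: Ve ej.
by rewrite /decr (negbTE ij) subr0; exact: Ve.
Qed.

Lemma sum_continuous_at (I : Type) (r : seq I) (F : I -> Cn -> R) z :
  (forall i, {for z, continuous (F i)}) ->
  {for z, continuous (fun z => \sum_(i <- r) F i z)}.
Proof.
move=> Fc; elim: r => [|i r IH].
  have -> : (fun z => \sum_(i <- [::]) F i z) = (fun=> 0).
    by apply/funext => y; rewrite big_nil.
  exact: cst_continuous.
have -> : (fun z => \sum_(j <- i :: r) F j z) = (fun z => F i z + \sum_(j <- r) F j z).
  by apply/funext => y; rewrite big_cons.
by apply: continuousD; [exact: Fc|exact: IH].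
Qed.

Lemma mon_continuous V e z : mon_dom V e -> V z -> {for z, continuous (fun z => (mon e z)%:C)}.
Proof.
move=> Ve Vz.
have cC : continuous (fun x : R => x%:C).
  move=> x W /nbhs_ballP[[r r'] /=]; rewrite ltcE/= => /andP[/eqP -> r0] rW.
  apply/nbhs_ballP; exists r => // y xy; apply: rW.
  change (`|x%:C - y%:C| < r%:C); rewrite -rmorphB normc_def/= expr0n addr0 sqrtr_sqr ltcR.
  exact: xy.
apply: (@continuous_comp _ _ _ (mon e) (fun x : R => x%:C)); last exact: cC.
apply: (@continuous_comp _ _ _ (fun z : Cn => \sum_j e j * ln (complex.Im (z 0 j))) expR);
  last exact: continuous_expR.
apply: sum_continuous_at => j; have [ej|ej] := eqVneq (e j) 0.
  have -> : (fun z : Cn => e j * ln (complex.Im (z 0 j))) = (fun=> 0).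
    by apply/funext => y; rewrite ej mul0r.
  exact: cst_continuous.
apply: (@continuousM R Cn (fun=> e j) (fun z : Cn => ln (complex.Im (z 0 j)))).
  exact: cst_continuous.
apply: (@continuous_comp Cn R R (fun z : Cn => complex.Im (z 0 j)) (@ln R)); last first.
  by apply: continuous_ln; exact: Ve ej.
apply: (@continuous_comp _ _ _ (fun z : Cn => z 0 j) (@complex.Im R)).
  exact: coord_continuous.
exact: Im_continuous.
Qed.

Lemma is_rderive_mon V e v z : mon_dom V e -> V z ->
  is_rderive v (fun z => (mon e z)%:C) z
    (\sum_j (complex.Im (v 0 j) * e j)%:C * (mon (decr e j) z)%:C).
Proof.
move=> Ve Vz.
have -> : \sum_j (complex.Im (v 0 j) * e j)%:C * (mon (decr e j) z)%:C =
    (\sum_j complex.Im (v 0 j) * e j * mon (decr e j) z)%:C.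
  by rewrite rmorph_sum; apply: eq_bigr => j _; rewrite -rmorphM.
split; last exact: is_derive_cst.
have -> : (fun x : R => complex.Re (mon e (z + x%:C *: v))%:C) =
    expR \o (\sum_j (fun x : R => e j * ln (complex.Im (z 0 j) + x * complex.Im (v 0 j)))).
  apply/funext => x; rewrite /mon fct_sumE /=; congr expR; apply: eq_bigr => j _.
  rewrite mxE [X in _ + X]mxE raddfD /=; case: (v 0 j) => a b /=.
  by rewrite mul0r addr0.
rewrite (_ : complex.Re _ = mon e z * (\sum_j e j * ((complex.Im (z 0 j))^-1 * complex.Im (v 0 j)))); last first.
  rewrite mulr_sumr /=; apply: eq_bigr => j _.
  have [->|ej] := eqVneq (e j) 0; first by rewrite mulr0 !mul0r mulr0.
  have zj := Ve z j Vz ej; rewrite (mon_decr e zj); field; exact: lt0r_neq0.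
apply: is_derive1_comp; last first.
  apply: is_derive_sum => j; have [->|ej] := eqVneq (e j) 0.
    by rewrite mul0r; under eq_fun do rewrite mul0r; exact: is_derive_cst.
  have zj := Ve z j Vz ej.
  have D1 : is_derive (0 : R) 1 (fun x : R => complex.Im (z 0 j) + x * complex.Im (v 0 j))
      (complex.Im (v 0 j)).
    have -> : (fun x : R => complex.Im (z 0 j) + x * complex.Im (v 0 j)) =
        cst (complex.Im (z 0 j)) \+ complex.Im (v 0 j) *: (id : R -> R).
      by apply/funext => x; rewrite /= [x * _]mulrC.
    rewrite -[X in is_derive _ _ _ X]add0r -[X in is_derive _ _ _ (_ + X)]mulr1.
    exact: (is_deriveD (is_derive_cst _ _ _) (is_deriveZ _ (is_derive_id _ _))).
  have D2 : is_derive (complex.Im (z 0 j) + 0 * complex.Im (v 0 j)) 1 (@ln R) (complex.Im (z 0 j))^-1.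
    by rewrite mul0r addr0; exact: is_derive1_ln.
  exact: (is_deriveZ _ (@is_derive1_comp R (@ln R)
    (fun x : R => complex.Im (z 0 j) + x * complex.Im (v 0 j)) 0 _ _ D2 D1)).
apply: is_derive_eq (is_derive_expR _) _; rewrite fct_sumE /mon; congr expR.
by apply: eq_bigr => j _; rewrite mul0r addr0.
Qed.

Lemma of_class_C_mon k V e : open V -> mon_dom V e -> of_class_C k V (fun z => (mon e z)%:C).
Proof.
move=> oV; elim: k e => [|k IH] e Ve.
  by split; [move=> z; exact: mon_continuous|exact: I].
apply: (of_class_C_intro (df := fun v z =>
  \sum_j (complex.Im (v 0 j) * e j)%:C * (mon (decr e j) z)%:C) oV).
- by move=> z; exact: mon_continuous.
- by move=> v z; exact: is_rderive_mon.
move=> v; apply: (of_class_C_sum _ oV) => j _.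
have [->|ej] := eqVneq (e j) 0.
  by under eq_fun do rewrite mulr0 mul0r; exact: of_class_C_cst.
apply: (of_class_CM oV); first exact: of_class_C_cst.
by apply/IH/mon_dom_decr.
Qed.

Lemma rderive_mon V e j z : mon_dom V e -> V z ->
  rderive (delta_mx 0 j) (fun z => (mon e z)%:C) z = 0 /\
  rderive ('i *: delta_mx 0 j) (fun z => (mon e z)%:C) z = (e j * mon (decr e j) z)%:C.
Proof.
move=> Ve Vz; rewrite !(rderiveE (is_rderive_mon _ Ve Vz)); split.
  by apply: big1 => i _; rewrite mxE; case: (_ && _); rewrite /= !mul0r.
rewrite (bigD1 j)//= big1 => [|i ij]; last first.
  by rewrite !mxE (negbTE ij) andbF mulr0 /= !mul0r.
by rewrite !mxE !eqxx mulr1 /= mul1r addr0 rmorphM.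
Qed.

(** The constants here and in [dzbar_mon] are dy/dz = -i/2 and dy/dzbar = i/2. *)
Lemma dz_mon V e j z : mon_dom V e -> V z ->
  dz j (fun z => (mon e z)%:C) z = (- 'i / 2%:R * (e j)%:C) * (mon (decr e j) z)%:C.
Proof.
by move=> Ve Vz; have [e1 e2] := rderive_mon j Ve Vz; rewrite /dz e1 e2 rmorphM; ring.
Qed.

Lemma dzbar_mon V e j z : mon_dom V e -> V z ->
  dzbar j (fun z => (mon e z)%:C) z = ('i / 2%:R * (e j)%:C) * (mon (decr e j) z)%:C.
Proof.
by move=> Ve Vz; have [e1 e2] := rderive_mon j Ve Vz; rewrite /dzbar e1 e2 rmorphM; ring.
Qed.

End Monomials.

(** * Vector fields on products of half-planes and planes *)

Section DivergenceOnHalfSpaces.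
Variables (R : realType) (n : nat) (P : pred 'I_n).
Local Notation C := R[i].
Local Notation Cn := 'rV[C]_n.

Definition half_spaces : set Cn := [set z | forall j, P j -> 0 < complex.Im (z 0 j)].

Definition half_weight : Cn -> R := mon (fun j => (P j)%:R).

Local Notation V := half_spaces.
Local Notation Y := half_weight.

Lemma half_spaces_open : open V.
Proof.
rewrite openE => z Vz; rewrite /interior.
pose e := \big[Num.min/1]_(j | P j) (complex.Im (z 0 j) / 2).
have e0 : 0 < e by apply: lt_bigmin => // j Pj; rewrite divr_gt0// Vz.
apply: filterS (cbox_nbhs z e0) => w zw j Pj.
have := bigmin_le_cond 1 (fun j => complex.Im (z 0 j) / 2) Pj.
have [_] := zw j; rewrite ler_distl -/e => /andP[+ _].
by have := Vz j Pj; lra.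
Qed.

Lemma mon_dom_half : mon_dom V (fun j => (P j)%:R).
Proof. by move=> z j Vz; case Pj: (P j); [move=> _; exact: Vz|rewrite eqxx]. Qed.

Lemma mon_line_real e (z : Cn) j (x : R) : mon e (z + x%:C *: delta_mx 0 j) = mon e z.
Proof.
congr expR; apply: eq_bigr => i _; congr (_ * ln _).
rewrite mxE [X in _ + X]mxE raddfD /= mxE; case: (_ && _) => /=;
  by rewrite ?mul0r ?mulr0 !addr0.
Qed.

Lemma mon_line e (z : Cn) j (c : C) : e j = 0 -> mon e (z + c *: delta_mx 0 j) = mon e z.
Proof.
move=> ej; congr expR; apply: eq_bigr => i _; rewrite mxE [X in _ + X]mxE mxE.
have [->|ij] := eqVneq i j; first by rewrite ej !mul0r.
by rewrite andbF mulr0 addr0.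
Qed.

(* Coordinates (x_j, log y_j) for j in P: [half_weight] absorbs the factor in
   d/d(log y_j) = y_j d/dy_j. *)
Definition log_coord (v : 'rV[R]_(n + n)) : Cn :=
  \row_j (v 0 (lshift n j) +i* (if P j then expR (v 0 (rshift n j)) else v 0 (rshift n j))).

Local Notation E := log_coord.

Lemma log_coord_half v : V (E v).
Proof. by move=> j Pj; rewrite mxE /= Pj expR_gt0. Qed.

Lemma log_coord_continuous : continuous E.
Proof.
move=> v W /nbhs_cbox[e e0 eW].
have c0 k : \forall u \near v, `|(u : 'rV[R]_(n + n)) 0 k - v 0 k| <= e.
  have /cvgrPdist_le/(_ _ e0) := @coord_continuous R 1 (n + n) 0 k v.
  by apply: filterS => u; rewrite distrC.
have c1 k : \forall u \near v, `|expR ((u : 'rV[R]_(n + n)) 0 k) - expR (v 0 k)| <= e.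
  have H : {for v, continuous (fun u : 'rV[R]_(n + n) => expR (u 0 k))}.
    apply: (@continuous_comp 'rV[R]_(n + n) R R (fun u => u 0 k) expR).
      exact: coord_continuous.
    exact: continuous_expR.
  move/cvgrPdist_le : H => /(_ _ e0) H.
  by apply: filterS H => u; rewrite distrC.
pose Q (j : 'I_n) : set 'rV[R]_(n + n) := [set u |
  `|u 0 (lshift n j) - v 0 (lshift n j)| <= e] `&`
  ([set u | `|u 0 (rshift n j) - v 0 (rshift n j)| <= e] `&`
   [set u | `|expR (u 0 (rshift n j)) - expR (v 0 (rshift n j))| <= e]).
have Qv j : nbhs v (Q j) by apply: filterI; [exact: c0|apply: filterI; [exact: c0|exact: c1]].
change (nbhs v (E @^-1` W)).
apply: filterS (@filter_forall _ _ Q _ _ Qv) => u uv; apply: eW => j; rewrite !mxE /=.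
by have [? [? ?]] := uv j; case: (P j).
Qed.

Lemma log_coord_lshift v (t : R) j :
  E (v + t *: delta_mx 0 (lshift n j)) = E v + t%:C *: delta_mx 0 j.
Proof.
apply/rowP => i; rewrite !mxE /= (inj_eq (@lshift_inj _ _)) eq_rlshift mulr0 addr0.
case: (i == j); rewrite ?mulr1 ?mulr0 ?addr0//.
by apply/eqP; rewrite eq_complex /= addr0 !eqxx.
Qed.

Lemma log_coord_rshift v (t : R) j :
  E (v + t *: delta_mx 0 (rshift n j)) = E v +
    (if P j then expR (v 0 (rshift n j)) * (expR t - 1) else t)%:C *: ('i *: delta_mx 0 j).
Proof.
apply/rowP => i; rewrite !mxE /= (inj_eq (@rshift_inj _ _)) eq_lrshift mulr0 addr0.
have [->|ij] := eqVneq i j; last by rewrite !mulr0 !addr0.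
rewrite !mulr1; apply/eqP; rewrite eq_complex /=; apply/andP; split; apply/eqP.
  by ring.
by case: (P j); rewrite ?expRD; ring.
Qed.

(* The sides of the box in the directions log y_j, j in P, are chosen first: this
   bounds y_j, hence the components of the field in the other directions, whose
   sides are then taken much longer. *)
Theorem no_positive_divergence (X Z : 'I_n -> Cn -> C) (c B : R) :
  0 < c ->
  (forall j, of_class_C 1 V (X j)) -> (forall j, of_class_C 1 V (Z j)) ->
  (forall j z, P j -> V z -> `|complex.Re (Z j z)| * Y z <= B * complex.Im (z 0 j)) ->
  (forall r, exists B', forall z j, V z -> (forall i, P i -> 1 <= complex.Im (z 0 i) <= r) ->
     `|complex.Re (X j z)| * Y z <= B' /\ `|complex.Re (Z j z)| * Y z <= B') ->
  ~ (forall z, V z -> c <= Y z * complex.Re (\sum_j (rderive (delta_mx 0 j) (X j) z +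
        rderive ('i *: delta_mx 0 j) (Z j) z))).
Proof.
move=> c0 X1 Z1 ZB XZB div.
have oV := half_spaces_open.
(* The boundary terms form three groups: the X_j, the Z_j along log y_j, and the other Z_j. Each is
   made at most c / 4, so that their total stays below c. *)
have nat_lt_div (a : R) : exists2 l : R, 0 < l & forall b, b <= a -> b *+ n / l < c / 4.
  exists (`|a| *+ n / c * 4 + 1).
    by rewrite ltr_wpDl// mulr_ge0// divr_ge0 ?mulrn_wge0// ltW.
  move=> b ba; rewrite ltr_pdivrMr; last first.
    by rewrite ltr_wpDl// mulr_ge0// divr_ge0 ?mulrn_wge0// ltW.
  apply: (@le_lt_trans _ _ (`|a| *+ n)); first by rewrite lerMn2r (le_trans ba)// ?ler_norm// orbT.
  rewrite mulrDr mulr1 (_ : c / 4 * _ = `|a| *+ n); last by field; exact: lt0r_neq0.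
  by rewrite ltrDl divr_gt0.
have [rho rho0 rhoP] := nat_lt_div (2 * B).
have [B' B'P] := XZB (expR rho).
have [l l0 lP] := nat_lt_div (2 * B').
pose Vf (i : 'I_(n + n)) (v : 'rV[R]_(n + n)) : R := match fintype.split i with
  | inl j => Y (E v) * complex.Re (X j (E v))
  (* For j in P the weight drops its factor y_j and so becomes constant along this direction;
     differentiation along log y_j restores the factor in [D]. *)
  | inr j => (if P j then mon (decr (fun j => (P j)%:R) j) (E v) else Y (E v)) * complex.Re (Z j (E v))
  end.
pose D (i : 'I_(n + n)) (v : 'rV[R]_(n + n)) : R := match fintype.split i with
  | inl j => Y (E v) * complex.Re (rderive (delta_mx 0 j) (X j) (E v))
  | inr j => Y (E v) * complex.Re (rderive ('i *: delta_mx 0 j) (Z j) (E v))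
  end.
pose L (i : 'I_(n + n)) := match fintype.split i with inl j => l | inr j => if P j then rho else l end.
pose Bd (i : 'I_(n + n)) := match fintype.split i with inl j => B' | inr j => if P j then B else B' end.
have L0 i : 0 < L i by rewrite /L; case: fintype.split => // j; case: ifP.
have dV i v : is_derive (0 : R) 1 (fun t : R => Vf i (v + t *: delta_mx 0 i)) (D i v).
  have iE : i = unsplit (fintype.split i) by rewrite splitK.
  have Vv := log_coord_half v; rewrite /Vf /D.
  move: iE; case: (fintype.split i) => j -> /=.
    have Dj := (of_class_C_is_rderive (delta_mx 0 j) (X1 j) Vv).1.
    have := is_deriveZ (Y (E v)) Dj.
    congr (is_derive _ _ _ _); apply/funext => t.
    have -> : Y (E (v + t *: delta_mx 0 (lshift n j))) = Y (E v).
      by rewrite log_coord_lshift; exact: mon_line_real.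
    by rewrite log_coord_lshift.
  have Dj := (of_class_C_is_rderive ('i *: delta_mx 0 j) (Z1 j) Vv).1.
  have Ej t : E (v + t *: delta_mx 0 (rshift n j)) = E v +
    ((if P j then expR (v 0 (rshift n j)) * (expR t - 1) else t)%:C * 'i) *: delta_mx 0 j.
    by rewrite log_coord_rshift scalerA.
  case Pj: (P j).
    set y := expR (v 0 (rshift n j)).
    have yE : complex.Im (E v 0 j) = y by rewrite mxE Pj.
    have Dg : is_derive (0 : R) 1 (fun t : R => y * (expR t - 1)) y.
      have := is_deriveZ y (is_deriveB (is_derive_expR (0 : R)) (is_derive_cst (1 : R) (0 : R) 1)).
      by rewrite expR0 subr0 [_ *: _]mulr1.
    have g0 : y * (expR 0 - 1) = 0 by rewrite expR0 subrr mulr0.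
    rewrite -g0 in Dj.
    have Dc := @is_derive1_comp R (fun x : R => complex.Re (Z j (E v + x%:C *: ('i *: delta_mx 0 j))))
      (fun t => y * (expR t - 1)) 0 _ _ Dj Dg.
    have := is_deriveZ (mon (decr (fun j => (P j)%:R) j) (E v)) Dc.
    have -> : Y (E v) = mon (decr (fun j => (P j)%:R) j) (E v) * y.
      by rewrite -yE -mon_decr// yE expR_gt0.
    rewrite -mulrA [y * _]mulrC.
    congr (is_derive _ _ _ _); apply/funext => t.
    have -> : mon (decr (fun j => (P j)%:R) j) (E (v + t *: delta_mx 0 (rshift n j))) =
        mon (decr (fun j => (P j)%:R) j) (E v).
      by rewrite Ej; apply: mon_line; rewrite /decr Pj eqxx subrr.
    by rewrite log_coord_rshift Pj.
  have := is_deriveZ (Y (E v)) Dj.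
  congr (is_derive _ _ _ _); apply/funext => t.
  have -> : Y (E (v + t *: delta_mx 0 (rshift n j))) = Y (E v).
    by rewrite Ej; apply: mon_line; rewrite Pj.
  by rewrite log_coord_rshift Pj.
have cE (F : Cn -> C) v : (forall z, V z -> {for z, continuous F}) ->
    {for v, continuous (fun v => complex.Re (F (E v)))}.
  move=> Fc; apply: (@continuous_comp _ _ _ (fun v => F (E v)) (@complex.Re R)).
    apply: continuous_comp; first exact: log_coord_continuous.
    exact/Fc/log_coord_half.
  exact: Re_continuous.
have cD i : continuous (D i).
  have ReM (y : R) (x : C) : y * complex.Re x = complex.Re (y%:C * x).
    by case: x => a b /=; rewrite mul0r subr0.
  move=> v; rewrite /D; case: (fintype.split i) => j.
    under eq_fun do rewrite ReM.
    apply: (cE (fun z => (Y z)%:C * rderive (delta_mx 0 j) (X j) z)) => z Vz.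
    apply: (@continuousM C Cn); first exact: mon_continuous mon_dom_half Vz.
    exact: (of_class_C_continuous (of_class_C_rderive (delta_mx 0 j) (X1 j)) Vz).
  under eq_fun do rewrite ReM.
  apply: (cE (fun z => (Y z)%:C * rderive ('i *: delta_mx 0 j) (Z j) z)) => z Vz.
  apply: (@continuousM C Cn); first exact: mon_continuous mon_dom_half Vz.
  exact: (of_class_C_continuous (of_class_C_rderive ('i *: delta_mx 0 j) (Z1 j)) Vz).
have VB i (v : 'rV[R]_(n + n)) : (forall j, 0 <= v 0 j <= L j) -> `|Vf i v| <= Bd i.
  move=> vL; rewrite /Vf /Bd.
  have EL k : P k -> 1 <= complex.Im (E v 0 k) <= expR rho.
    move=> Pk; rewrite mxE /= Pk; have := vL (rshift n k); rewrite /L.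
    by rewrite (unsplitK (inr k)) Pk -{1}expR0 !ler_expR//.
  case: (fintype.split i) => j.
    by rewrite normrM gtr0_norm ?expR_gt0// mulrC (B'P _ _ (log_coord_half v) EL).1.
  case: ifP => Pj; rewrite normrM gtr0_norm ?expR_gt0// mulrC.
    have yj : 0 < complex.Im (E v 0 j) by exact: log_coord_half.
    by rewrite -(ler_pM2r yj) -mulrA -mon_decr//; exact: ZB Pj (log_coord_half v).
  exact: (B'P _ _ (log_coord_half v) EL).2.
have Dc (v : 'rV[R]_(n + n)) : (forall j, 0 <= v 0 j <= L j) -> c <= \sum_i D i v.
  move=> _; apply: le_trans (div _ (log_coord_half v)) _.
  have -> : \sum_i D i v = \sum_j (D (lshift n j) v + D (rshift n j) v).
    by rewrite big_split_ord /= -big_split.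
  rewrite raddf_sum mulr_sumr; apply: ler_sum => j _.
  by rewrite /D (unsplitK (inl j)) (unsplitK (inr j)) raddfD mulrDr.
have := divergence_on_box L0 dV cD VB Dc.
apply/negP; rewrite -ltNge big_split_ord /=.
rewrite /L /Bd; under eq_bigr do rewrite (unsplitK (inl _)).
rewrite sumr_const card_ord.
have h1 := lP _ (lexx _); have h2 := rhoP _ (lexx _).
have h0 : 2 * B' / l *+ n < c / 4 by rewrite -mulrnAl.
apply: (@le_lt_trans _ _ (c / 4 + (c / 4 + c / 4))); last by lra.
apply: lerD; first exact: ltW.
have max_le x : x *+ n < c / 4 -> Num.max 0 x *+ n <= c / 4.
  case: (leP 0 x) => _ xc; first exact: ltW.
  by rewrite mul0rn divr_ge0// ltW.
(* B and B' may be negative; truncating at 0 allows every j to be charged for both of its possible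
   bounds. *)
pose b0 := Num.max 0 (2 * B / rho); pose b1 := Num.max 0 (2 * B' / l).
apply: (@le_trans _ _ (\sum_(i < n) (b0 + b1))).
  apply: ler_sum => j _; rewrite (unsplitK (inr j)); case: (P j).
    by rewrite (@le_trans _ _ b0)// ?lerDl /b0 /b1 !le_max !lexx ?orbT.
  by rewrite (@le_trans _ _ b1)// ?lerDr /b0 /b1 !le_max !lexx ?orbT.
rewrite big_split /= !sumr_const card_ord lerD//.
  by apply: max_le; rewrite -mulrnAl.
by apply: max_le; rewrite -mulrnAl.
Qed.

End DivergenceOnHalfSpaces.

(** * Exterior powers of the fundamental form *)

Section WedgeProducts.
Variables (R : realType) (n : nat).
Local Notation C := R[i].
Local Notation Cn := 'rV[C]_n.
Local Notation l := (lshift n).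
Local Notation r := (@rshift n n).
Implicit Types (a b : form R n) (S T : {set 'I_(n + n)}) (m : 'I_(n + n)) (z : Cn).

Lemma wedge_covector m b S z : wedge (covector m) b S z =
  if m \in S then wedge_sign R [set m]%SET (S :\ m) * b (S :\ m) z else 0.
Proof.
rewrite /wedge; case: ifP => mS.
  rewrite (bigD1 [set m]%SET)/=; last by rewrite finset.sub1set.
  rewrite /covector eqxx mulr1 big1 ?addr0// => A /andP[_ /negbTE ->].
  by rewrite mulr0 mul0r.
apply: big1 => A AS; rewrite /covector; case: eqP => [Am|_]; last by rewrite mulr0 mul0r.
by move: AS; rewrite Am finset.sub1set mS.
Qed.

Lemma fundamental_formS (h : Cn -> 'M[C]_n) S z : fundamental_form h S z =
  \sum_j \sum_k 'i / 2%:R * h z j k * (S == [set l j; r k]%SET)%:R.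
Proof.
apply: eq_bigr => j _; apply: eq_bigr => k _; congr (_ * _).
rewrite wedge_covector /covector; case: ifP => jS; last first.
  by case: eqP => // E; rewrite E !inE eqxx in jS.
have -> : (S :\ l j == [set r k])%SET = (S == [set l j; r k])%SET.
  apply/eqP/eqP => [E|->]; first by rewrite -(finset.setD1K jS) E.
  by rewrite finset.setU1K// inE eq_lrshift.
case: eqP => [->|_]; last by rewrite mulr0.
rewrite mulr1 finset.setU1K ?inE ?eq_lrshift// /wedge_sign.
rewrite (_ : [set _ in _ | _]%SET = finset.set0) ?cards0//.
apply/setP => -[p q]; rewrite !inE /=; case: eqP => //= ->; case: eqP => //= ->.
by rewrite ltnNge /= ltnW// ltn_addr.
Qed.

Lemma wedge_fundamental_form (h : Cn -> 'M[C]_n) b S z :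
  wedge (fundamental_form h) b S z = \sum_j \sum_k
    if (l j \in S) && (r k \in S) then
      'i / 2%:R * h z j k * (wedge_sign R [set l j; r k]%SET (S :\: [set l j; r k]) *
        b (S :\: [set l j; r k])%SET z)
    else 0.
Proof.
rewrite /wedge; under eq_bigr => A AS.
  rewrite fundamental_formS mulr_sumr mulr_suml.
  under eq_bigr do rewrite mulr_sumr mulr_suml.
  over.
rewrite exchange_big /=; apply: eq_bigr => j _.
rewrite exchange_big /=; apply: eq_bigr => k _.
case: ifP => jk.
  rewrite (bigD1 [set l j; r k]%SET)/=; last by rewrite finset.subUset !finset.sub1set.
  rewrite eqxx mulr1 big1 ?addr0; first by rewrite [RHS]mulrCA mulrA.
  by move=> A /andP[_ /negbTE ->]; rewrite !mulr0 mul0r.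
apply: big1 => A AS; case: eqP => [E|_]; last by rewrite !mulr0 mul0r.
by move: AS; rewrite E finset.subUset !finset.sub1set jk.
Qed.

Section Equivariance.
Variables (V : set Cn) (g : Cn -> Cn) (chi : 'I_(n + n) -> C).

(** The condition g^* a = a, for a map g whose pullback multiplies the covector m by chi m. *)
Definition equivariant_form a := forall S z, V z ->
  a S z = (\prod_(m in S) chi m) * a S (g z).

Lemma equivariant_wedge a b : equivariant_form a -> equivariant_form b ->
  equivariant_form (wedge a b).
Proof.
move=> ea eb S z Vz; rewrite /wedge mulr_sumr; apply: eq_bigr => A AS.
rewrite (ea A z Vz) (eb _ z Vz) [\prod_(m in S) _](finset.big_setID A) /= (finset.setIidPr AS).
by move: (a A (g z)) (b (S :\: A) (g z)) => x y; ring.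
Qed.

Lemma equivariant_wedge_pow a k : equivariant_form a -> equivariant_form (wedge_pow a k).
Proof.
move=> ea; elim: k => [|k IH]; last exact: equivariant_wedge.
move=> S z Vz; rewrite /wedge_pow /= /one_form1.
by case: eqP => [->|_]; rewrite ?finset.big_set0 ?mulr1// mulr0.
Qed.

Lemma equivariant_fundamental_form (h : Cn -> 'M[C]_n) :
  (forall z j k, V z -> h z j k = chi (l j) * chi (r k) * h (g z) j k) ->
  equivariant_form (fundamental_form h).
Proof.
move=> eh S z Vz; rewrite !fundamental_formS mulr_sumr; apply: eq_bigr => j _.
rewrite mulr_sumr; apply: eq_bigr => k _; rewrite (eh _ _ _ Vz).
case: eqP => [->|_]; last by rewrite !mulr0.
rewrite finset.big_setU1 ?inE ?eq_lrshift// finset.big_set1 /=.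
by move: (h (g z) j k) => x; ring.
Qed.

End Equivariance.

Section Smoothness.
Variables (V : set Cn) (oV : open V) (k : nat).

Lemma of_class_C_wedge a b : (forall S, of_class_C k V (a S)) ->
  (forall S, of_class_C k V (b S)) -> forall S, of_class_C k V (wedge a b S).
Proof.
move=> ak bk S; apply: (of_class_C_sum _ oV) => A _.
apply: (of_class_CM oV); last exact: bk.
by apply: (of_class_CM oV); [exact: of_class_C_cst|exact: ak].
Qed.

Lemma of_class_C_wedge_pow a p : (forall S, of_class_C k V (a S)) ->
  forall S, of_class_C k V (wedge_pow a p S).
Proof.
move=> ak; elim: p => [|p IH]; last exact: of_class_C_wedge.
by move=> S; exact: of_class_C_cst.
Qed.

Lemma of_class_C_fundamental_form (h : Cn -> 'M[C]_n) :
  (forall i j, of_class_C k V (fun z => h z i j)) ->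
  forall S, of_class_C k V (fundamental_form h S).
Proof.
move=> hk S; apply: (of_class_C_sum _ oV) => i _; apply: (of_class_C_sum _ oV) => j _.
apply: (of_class_CM oV); first by apply: (of_class_CM oV); [exact: of_class_C_cst|exact: hk].
by apply: of_class_C_wedge => T; exact: of_class_C_cst.
Qed.

End Smoothness.

Lemma del_delbarE V a S z : open V -> (forall T, of_class_C 2 V (a T)) -> V z ->
  del (delbar a) S z = \sum_(p | l p \in S) \sum_(q | r q \in S)
    wedge_sign R [set l p]%SET (S :\ l p) *
    wedge_sign R [set r q]%SET (S :\ l p :\ r q) *
    dz p (dzbar q (a (S :\ l p :\ r q)%SET)) z.
Proof.
move=> oV a2 Vz.
have dE T : delbar a T = fun y => \sum_(q | r q \in T)
    wedge_sign R [set r q]%SET (T :\ r q) * dzbar q (a (T :\ r q)%SET) y.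
  apply/funext => y; rewrite /delbar [RHS]big_mkcond; apply: eq_bigr => q _.
  by rewrite wedge_covector.
rewrite /del [RHS]big_mkcond; apply: eq_bigr => p _.
rewrite wedge_covector; case: ifP => // pS.
rewrite dE (dz_sum _ _ _ Vz); last first.
  move=> q _; apply: (of_class_CM oV); first exact: of_class_C_cst.
  exact: of_class_C_dzbar.
rewrite mulr_sumr; apply: eq_big => q; first by rewrite !inE eq_rlshift.
by move=> _; rewrite (dzZ _ p oV (of_class_C_dzbar q oV (a2 _)) Vz) mulrA.
Qed.

Lemma eq_on_del_delbar V a b S z : open V -> (forall T, of_class_C 2 V (a T)) ->
  (forall T y, V y -> a T y = b T y) -> V z ->
  del (delbar a) S z = del (delbar b) S z.
Proof.
move=> oV a2 ab Vz.
have b2 T : of_class_C 2 V (b T) by apply: eq_of_class_C (a2 T) => // y; exact: ab.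
rewrite (del_delbarE S oV a2 Vz) (del_delbarE S oV b2 Vz).
have E T q p : dz p (dzbar q (a T)) z = dz p (dzbar q (b T)) z.
  apply: (eq_on_dz p oV (of_class_C_dzbar q oV (a2 _)) _ Vz) => y Vy.
  by apply: (eq_on_dzbar q oV (of_class_CW (a2 _)) _ Vy) => x; exact: ab.
by apply: eq_bigr => p _; apply: eq_bigr => q _; rewrite E.
Qed.

End WedgeProducts.

(** * Coefficients of powers of the fundamental form as minors *)

Section Minors.
Variables (R : realType) (n : nat).
Local Notation C := R[i].
Local Notation Cn := 'rV[C]_n.
Local Notation l := (lshift n).
Local Notation r := (@rshift n n).

Definition increasing m (a : 'I_m -> 'I_n) := forall i j : 'I_m, (a i < a j)%N = (i < j)%N.

Lemma increasing_inj m (a : 'I_m -> 'I_n) : increasing a -> injective a.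
Proof.
move=> ai i j aij; case: (ltngtP i j) => [ij|ji|ij]; last exact: ord_inj.
  by have := ai i j; rewrite aij ltnn ij.
by have := ai j i; rewrite aij ltnn ji.
Qed.

Lemma increasing_lift m (a : 'I_m.+1 -> 'I_n) i : increasing a -> increasing (a \o lift i).
Proof. by move=> ai x y; rewrite /= ai /= /bump; case: leqP; case: leqP; lia. Qed.

(** The index of dz_(a 0) ... dz_(a (m-1)) dzbar_(b 0) ... dzbar_(b (m-1)). *)
Definition bi_index m (a b : 'I_m -> 'I_n) : {set 'I_(n + n)} :=
  ([set l (a i) | i : 'I_m] :|: [set r (b i) | i : 'I_m])%SET.

Lemma lshift_bi_index m (a b : 'I_m -> 'I_n) k :
  (l k \in bi_index a b) = (k \in [set a i | i : 'I_m]%SET).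
Proof.
rewrite inE; apply/orP/imsetP => [[/imsetP[i _ /lshift_inj ->]|/imsetP[i _ /eqP]]|[i _ ->]].
- by exists i.
- by rewrite eq_lrshift.
- by left; exact: finset.imset_f.
Qed.

Lemma rshift_bi_index m (a b : 'I_m -> 'I_n) k :
  (r k \in bi_index a b) = (k \in [set b i | i : 'I_m]%SET).
Proof.
rewrite inE; apply/orP/imsetP => [[/imsetP[i _ /eqP]|/imsetP[i _ /rshift_inj ->]]|[i _ ->]].
- by rewrite eq_rlshift.
- by exists i.
- by right; exact: finset.imset_f.
Qed.

Lemma sum_bi_index m (a b : 'I_m -> 'I_n) (F : 'I_(n + n) -> nat) :
  injective a -> injective b ->
  (\sum_(q in bi_index a b) F q = \sum_i F (l (a i)) + \sum_i F (r (b i)))%N.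
Proof.
move=> ia ib; rewrite big_mkcond big_split_ord /=.
under eq_bigr do rewrite lshift_bi_index; under [in X in (_ + X)%N]eq_bigr do rewrite rshift_bi_index.
by rewrite -!big_mkcond !big_imset /=; [|by move=> x y _ _; exact: ib|by move=> x y _ _; exact: ia].
Qed.

Lemma wedge_signE (A B : {set 'I_(n + n)}) :
  wedge_sign R A B = (-1) ^+ (\sum_(p in A) \sum_(q in B) (q < p)%N).
Proof.
rewrite /wedge_sign -sum1_card pair_big /=; congr (_ ^+ _).
rewrite [RHS](eq_bigr (fun x : 'I_(n + n) * 'I_(n + n) => if (x.2 < x.1)%N then 1%N else 0%N)).
  by rewrite -big_mkcondr; apply: eq_bigl => x; rewrite !inE.
by move=> x _; case: ltnP.
Qed.

Lemma sum_lift_lt m (i : 'I_m.+1) : (\sum_(x < m) (lift i x < i)%N = i)%N.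
Proof.
rewrite (eq_bigr (fun x : 'I_m => if (x < i)%N then 1%N else 0%N)) => [|x _].
  rewrite -big_mkcond /= sum1_card -[RHS](card_ord i).
  have im : (i <= m)%N by rewrite -ltnS.
  rewrite -sum1_card -(big_ord_widen m (fun=> 1%N) im) sum1_card //.
rewrite /= /bump; have [xi|ix] := ltnP x i; first by rewrite add0n xi.
by rewrite add1n ltnNge leqW.
Qed.

(** Inversions are counted by blocks: i of the remaining dz precede dz_(a i); all m of them, and j
    of the remaining dzbar, precede dzbar_(b j). *)
Lemma wedge_sign_bi_index m (a b : 'I_m.+1 -> 'I_n) i j : increasing a -> increasing b ->
  wedge_sign R [set l (a i); r (b j)]%SET (bi_index (a \o lift i) (b \o lift j)) =
  (-1) ^+ m * (-1) ^+ (i + j).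
Proof.
move=> ai bj; rewrite wedge_signE -exprD; congr (_ ^+ _).
rewrite finset.big_setU1 ?inE ?eq_lrshift// finset.big_set1.
rewrite !sum_bi_index; try by apply/increasing_inj/increasing_lift.
have -> : (\sum_(x < m) (l ((a \o lift i) x) < l (a i))%N = i)%N.
  by under eq_bigr do rewrite /= ai; exact: sum_lift_lt.
have -> : (\sum_(x < m) (r ((b \o lift j) x) < l (a i))%N = 0)%N.
  by rewrite big1// => x _; rewrite ltnNge /= ltnW// ltn_addr.
have -> : (\sum_(x < m) (l ((a \o lift i) x) < r (b j))%N = m)%N.
  under eq_bigr do rewrite /= ltn_addr//.
  by rewrite sum1_card card_ord.
have -> : (\sum_(x < m) (r ((b \o lift j) x) < r (b j))%N = j)%N.
  by under eq_bigr do rewrite /= ltn_add2l bj; exact: sum_lift_lt.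
by rewrite addn0 addnCA.
Qed.

Lemma bi_index_lift m (a b : 'I_m.+1 -> 'I_n) i j : injective a -> injective b ->
  bi_index a b :\: [set l (a i); r (b j)]%SET = bi_index (a \o lift i) (b \o lift j).
Proof.
have lift_image (c : 'I_m.+1 -> 'I_n) x k : injective c ->
    (k != c x) && (k \in [set c y | y : 'I_m.+1]%SET) =
    (k \in [set (c \o lift x) y | y : 'I_m]%SET).
  move=> ic; apply/andP/imsetP => [[kx /imsetP[y _ ky]]|[y _ ->]].
    move: kx; rewrite ky (inj_eq ic); case: (unliftP x y) => [w -> _|->]; last by rewrite eqxx.
    by exists w.
  by rewrite (inj_eq ic) eq_sym neq_lift; split=> //; exact: finset.imset_f.
move=> ia ib; apply/setP => q; rewrite finset.in_setD finset.in_set2 negb_or.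
rewrite -[q]splitK; case: (fintype.split q) => k; rewrite /unsplit.
  rewrite !lshift_bi_index (inj_eq (@lshift_inj _ _)) eq_lrshift andbT.
  exact: lift_image.
rewrite !rshift_bi_index (inj_eq (@rshift_inj _ _)) eq_rlshift /=.
exact: lift_image.
Qed.

(* The coefficients of omega^m are, up to the constant
   [\prod_(k < m) (-1)^k i/2 (k+1)], the minors of order m of the matrix of omega. *)
Definition wedge_pow_cst m : C := \prod_(k < m) ('i / 2%:R * (-1) ^+ k * k.+1%:R).

Lemma wedge_pow_cst_neq0 m : wedge_pow_cst m != 0.
Proof.
apply/prodf_neq0 => k _; rewrite !mulf_neq0 ?signr_eq0 ?invr_eq0 ?pnatr_eq0//.
by rewrite eq_complex /= eqxx oner_eq0.
Qed.

(** Splitting off one factor omega leaves the sum over all (i, j) of an entry times its cofactor,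
    that is, the Laplace expansion along each of the [m.+1] rows; hence the factor [k.+1] in
    [wedge_pow_cst]. *)
Lemma wedge_pow_minor (h : Cn -> 'M[C]_n) m (a b : 'I_m -> 'I_n) z :
  increasing a -> increasing b ->
  wedge_pow (fundamental_form h) m (bi_index a b) z =
  wedge_pow_cst m * \det (mxsub a b (h z)).
Proof.
elim: m a b => [|m IH] a b ai bi.
  rewrite /wedge_pow_cst big_ord0 mul1r det_mx00 /= /one_form1.
  by rewrite (_ : bi_index a b = finset.set0) ?eqxx//; apply/setP => q; rewrite !inE;
    apply/norP; split; apply/imsetP => -[[]].
have ia := increasing_inj ai; have ib := increasing_inj bi.
rewrite [wedge_pow _ _]/= wedge_fundamental_form.
have -> : \sum_j \sum_k (if (l j \in bi_index a b) && (r k \in bi_index a b) then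
      'i / 2%:R * h z j k * (wedge_sign R [set l j; r k]%SET (bi_index a b :\: [set l j; r k]) *
        wedge_pow (fundamental_form h) m (bi_index a b :\: [set l j; r k])%SET z)
    else 0) =
  \sum_i \sum_j 'i / 2%:R * h z (a i) (b j) * ((-1) ^+ m * (-1) ^+ (i + j) *
     (wedge_pow_cst m * \det (row' i (col' j (mxsub a b (h z)))))).
  have sumE (c : 'I_m.+1 -> 'I_n) (F : 'I_n -> C) : injective c ->
      \sum_j (if j \in [set c i | i : 'I_m.+1]%SET then F j else 0) = \sum_i F (c i).
    by move=> ic; rewrite -big_mkcond big_imset //= => x y _ _; exact: ic.
  pose G j k := 'i / 2%:R * h z j k *
    (wedge_sign R [set l j; r k]%SET (bi_index a b :\: [set l j; r k]) *
      wedge_pow (fundamental_form h) m (bi_index a b :\: [set l j; r k])%SET z).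
  transitivity (\sum_j (if j \in [set a i | i : 'I_m.+1]%SET then
      \sum_k (if k \in [set b i | i : 'I_m.+1]%SET then G j k else 0) else 0)).
    apply: eq_bigr => j _; rewrite lshift_bi_index; case: (j \in _); last exact: big1.
    by apply: eq_bigr => k _; rewrite rshift_bi_index.
  rewrite (sumE _ _ ia); apply: eq_bigr => i _.
  rewrite (sumE _ _ ib); apply: eq_bigr => j _; rewrite /G bi_index_lift//.
  rewrite (wedge_sign_bi_index i j ai bi) IH; [|exact: increasing_lift|exact: increasing_lift].
  rewrite (_ : mxsub (a \o lift i) (b \o lift j) (h z) = row' i (col' j (mxsub a b (h z))))//.
  by apply/matrixP => x y; rewrite !mxE.
have -> : wedge_pow_cst m.+1 = wedge_pow_cst m * ('i / 2%:R * (-1) ^+ m * m.+1%:R).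
  by rewrite /wedge_pow_cst big_ord_recr.
have E i : \sum_j mxsub a b (h z) i j * cofactor (mxsub a b (h z)) i j = \det (mxsub a b (h z)).
  by rewrite -expand_det_row.
transitivity (\sum_(i < m.+1) wedge_pow_cst m * ('i / 2%:R * (-1) ^+ m) * \det (mxsub a b (h z))).
  apply: eq_bigr => i _; rewrite -(E i) mulr_sumr; apply: eq_bigr => j _.
  by rewrite /cofactor mxE; move: (\det _) (h z _ _) => x y; ring.
by rewrite sumr_const card_ord -mulr_natr; move: (\det _) => x; ring.
Qed.

End Minors.

(** * Principal minors of positive definite Hermitian matrices *)

Section PositiveDefinite.
Variable R : realType.
Local Notation C := R[i].

(** Diagonalize h by a unitary Q: the determinant is the product of the eigenvalues, and the i-th
    eigenvalue is the value of the form at row i of Q, a unit vector. *)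
Lemma posdef_det_gt0 m (h : 'M[C]_m) : (map_mx conjc h)^T = h ->
  (forall v : 'rV_m, v != 0 -> 0 < herm h v v) -> 0 < \det h.
Proof.
move=> hh hpos.
have hN : h \is hermsymmx.
  by apply/is_hermitianmxP; rewrite expr0 scale1r -[LHS]hh map_trmx.
have /hermitian_normalmx/orthomx_spectralP := hN.
set Q := spectralmx h; set d := spectral_diag h => hE.
have Qu : Q \in unitmx by exact: spectral_unit.
have QQ : Q *m (map_mx conjc Q)^T = 1%:M.
  by have /unitarymxP := spectral_unitarymx h; rewrite -map_trmx.
have -> : \det h = \prod_i d 0 i.
  rewrite hE !det_mulmx det_inv mulrAC mulVr ?mul1r ?det_diag//.
apply: prodr_gt0 => i _.
have := hpos (row i Q); rewrite /herm.
have -> : row i Q *m h = d 0 i *: row i Q.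
  rewrite {1}hE !mulmxA -row_mul mulmxV// row1 -rowE row_diag_mx -scalemxAl -rowE.
  by [].
have E : (row i Q *m (map_mx conjc (row i Q))^T) 0 0 = 1.
  have /matrixP/(_ i i) := QQ; rewrite [1%:M _ _]mxE eqxx mulr1n => <-.
  by rewrite !mxE; apply: eq_bigr => k _; rewrite !mxE.
rewrite -scalemxAl mxE E mulr1; apply; apply/eqP => Qi0.
by move/eqP: E; rewrite Qi0 mul0mx mxE eq_sym oner_eq0.
Qed.

(** A principal submatrix is the matrix of the form restricted to a coordinate subspace, which v |->
    v Q embeds. *)
Lemma posdef_minor_gt0 n m (h : 'M[C]_n) (a : 'I_m -> 'I_n) : injective a ->
  (map_mx conjc h)^T = h -> (forall v : 'rV_n, v != 0 -> 0 < herm h v v) ->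
  0 < \det (mxsub a a h).
Proof.
move=> ia hh hpos; pose Q : 'M[C]_(m, n) := \matrix_(i, j) (j == a i)%:R.
have QE (A : 'M[C]_n) : mxsub a a A = Q *m A *m Q^T.
  apply/matrixP => i j; rewrite !mxE (bigD1 (a j))//= big1 => [|k kj].
    rewrite addr0 !mxE eqxx mulr1 (bigD1 (a i))//= big1 => [|k ki].
      by rewrite mxE eqxx mul1r addr0.
    by rewrite mxE (negbTE ki) mul0r.
  by rewrite !mxE (negbTE kj) mulr0.
apply: posdef_det_gt0 => [|v v0].
  by rewrite -[in RHS]hh; apply/matrixP => i j; rewrite !mxE.
have -> : herm (mxsub a a h) v v = herm h (v *m Q) (v *m Q).
  rewrite /herm QE map_mxM trmx_mul !mulmxA.
  rewrite (_ : (map_mx conjc Q)^T = Q^T)//.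
  by apply/matrixP => i j; rewrite !mxE; case: (_ == _); rewrite ?rmorph1 ?rmorph0.
apply: hpos; apply: contraNneq v0 => vQ; apply/eqP/rowP => i.
have /rowP/(_ (a i)) := vQ; rewrite !mxE (bigD1 i)//= big1 => [|k ki].
  by rewrite mxE eqxx mulr1 addr0.
by rewrite mxE (inj_eq ia) eq_sym (negbTE ki) mulr0.
Qed.

End PositiveDefinite.

(** * Units of the number field *)

Section Embeddings.
Variables (C : numClosedFieldType) (K : fieldExtType rat).

Lemma rat_char0 (L : fieldExtType rat) : [pchar L] =i pred0.
Proof. by move=> p; rewrite (fmorph_pchar (in_alg L)) pchar_num. Qed.

Lemma rat_primitive_element : exists theta : K, forall x : K,
  exists q : {poly rat}, x = (map_poly (in_alg K) q).[theta].
Proof.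
exists (separable_generator 1 {:K}%VS) => x.
have : x \in <<1; separable_generator 1 {:K}>>%VS.
  rewrite -eq_adjoin_separable_generator ?sub1v ?memvf//.
  by apply/separableP => y _; exact/pcharf0_separable/rat_char0.
by case/Fadjoin_polyP => p /polyOver1P[q ->] ->; exists q.
Qed.

Lemma rmorph_horner_alg (f : {rmorphism K -> C}) (q : {poly rat}) x :
  f (map_poly (in_alg K) q).[x] = (map_poly ratr q).[f x].
Proof.
rewrite -horner_map -map_poly_comp; congr _.[_]; apply: eq_map_poly => a /=.
exact: (fmorph_eq_rat (f \o in_alg K)).
Qed.

Variables (N : nat) (sigma : 'I_N -> {rmorphism K -> C}).
Hypothesis sigma_inj : forall i j, sigma i =1 sigma j -> i = j.
Hypothesis sigma_surj : forall f : {rmorphism K -> C}, exists i, f =1 sigma i.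

(** The embedding sends q(theta) to q(z). The polynomial of each x is picked by choice, but [ev]
    shows that q(z) depends on q(theta) only, as m divides differences; this gives additivity and
    multiplicativity. *)
Lemma embedding_exists (theta : K) (m : {poly rat}) (z : C) :
  (forall x : K, exists q : {poly rat}, x = (map_poly (in_alg K) q).[theta]) ->
  (forall q : {poly rat}, (map_poly (in_alg K) q).[theta] = 0 -> m %| q) ->
  root (map_poly ratr m) z -> exists i, sigma i theta = z.
Proof.
move=> /choice[q qP] mP mz.
have ev q1 q2 : (map_poly (in_alg K) q1).[theta] = (map_poly (in_alg K) q2).[theta] ->
    (map_poly ratr q1).[z] = (map_poly ratr q2).[z].
  move=> /eqP; rewrite -subr_eq0 -hornerN -hornerD -rmorphN -rmorphD => /eqP/mP/dvdpP[p pE].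
  apply/eqP; rewrite -subr_eq0 -hornerN -hornerD -rmorphN -rmorphD pE rmorphM hornerM.
  by rewrite (rootP mz) mulr0.
pose f x : C := (map_poly ratr (q x)).[z].
have fD : zmod_morphism f.
  move=> x y; rewrite /f -hornerN -hornerD -rmorphN -rmorphD; apply: ev.
  by rewrite rmorphD rmorphN hornerD hornerN -!qP.
have fM : monoid_morphism f.
  split=> [|x y].
    rewrite /f -[RHS](hornerC 1 z) -[1%:P](rmorph1 (map_poly ratr)); apply: ev.
    by rewrite -qP rmorph1 hornerC.
  by rewrite /f -hornerM -rmorphM; apply: ev; rewrite rmorphM hornerM -!qP.
pose faM := GRing.isZmodMorphism.Build _ _ f fD.
pose fmM := GRing.isMonoidMorphism.Build _ _ f fM.
pose fRM : {rmorphism K -> C} := HB.pack f faM fmM.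
have [i fi] := sigma_surj fRM; exists i; rewrite -fi /=.
rewrite /f -[RHS](hornerX z) -(map_polyX ratr); apply: ev.
by rewrite -qP map_polyX hornerX.
Qed.

(** The minimal polynomial of theta is separable and each of its roots defines an embedding; since
    sigma lists every embedding once, the sigma_j theta are exactly these roots. *)
Lemma primitive_root_poly : exists (theta : K) (m : {poly rat}),
  [/\ m \is monic, map_poly ratr m = \prod_j ('X - (sigma j theta)%:P),
      injective (fun j => sigma j theta) &
      forall x : K, exists q : {poly rat}, x = (map_poly (in_alg K) q).[theta]].
Proof.
have [theta gen] := rat_primitive_element.
have /polyOver1P[m mE] := minPolyOver 1%AS theta.
have mm : m \is monic by have := monic_minPoly 1%AS theta; rewrite mE map_monic.
have mP (q : {poly rat}) : (map_poly (in_alg K) q).[theta] = 0 -> m %| q.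
  move=> q0; rewrite -(dvdp_map (in_alg K)) -mE; apply: minPoly_dvdp.
    by apply/polyOver1P; exists q.
  exact/eqP.
have [r rE] := closed_field_poly_normal (map_poly (ratr : rat -> C) m).
have inj : injective (fun j => sigma j theta).
  move=> i j ij; apply: sigma_inj => x; have [q ->] := gen x.
  by rewrite !rmorph_horner_alg ij.
have ru : uniq r.
  rewrite -separable_prod_XsubC; move: rE; rewrite (monicP _) ?map_monic// scale1r => <-.
  rewrite separable_map -(separable_map (in_alg K)) -mE.
  exact/pcharf0_separable/rat_char0.
exists theta, m; split => //.
rewrite rE (monicP _) ?map_monic// scale1r -(big_map (fun j => sigma j theta) xpredT (fun z => 'X - z%:P)).
apply: perm_big; apply: uniq_perm => //.
  by rewrite map_inj_uniq// index_enum_uniq.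
have rroot z : (z \in r) = root (map_poly ratr m) z.
  by rewrite rE (monicP _) ?map_monic// scale1r root_prod_XsubC.
move=> z; rewrite rroot; apply/idP/mapP.
  by move=> /(embedding_exists gen mP)[i <-]; exists i; rewrite ?mem_index_enum.
move=> [i _ ->]; rewrite /root -rmorph_horner_alg -mE fmorph_eq0.
exact: root_minPoly.
Qed.

(** The Vandermonde matrix V of the conjugates of theta diagonalizes the companion matrix A of m. If
    x = q(theta), the rational matrix B = q(A), built by Horner's scheme, has eigenvalues sigma_j x,
    and its characteristic polynomial is the one sought. *)
Lemma embeddings_char_poly (x : K) :
  exists P : {poly rat}, map_poly ratr P = \prod_j ('X - (sigma j x)%:P).
Proof.
have [theta [m [mm mE inj gen]]] := primitive_root_poly.
have szm : (size m).-1 = N.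
  have := congr1 (fun p : {poly C} => size p) mE; rewrite size_map_poly => ->.
  by rewrite size_prod_XsubC -sum1_size sum1_card card_ord.
pose a : 'rV[C]_N := \row_j sigma j theta.
pose V := Vandermonde N a.
pose A : 'M[rat]_N := \matrix_(i, j) if (i == N.-1 :> nat) then - m`_j else (i.+1 == j :> nat)%:R.
have AV : map_mx ratr A *m V = V *m diag_mx a.
  apply/matrixP => i j; rewrite mul_mx_diag !mxE.
  have mj : (map_poly ratr m).[sigma j theta] = 0 :> C.
    by rewrite mE horner_prod (bigD1 j)//= !hornerE subrr mul0r.
  case: (eqVneq (i : nat) N.-1) => iN.
    have Ni : i.+1 = N by rewrite iN prednK// (leq_ltn_trans (leq0n i)).
    rewrite -exprSr Ni; move: mj; rewrite horner_coef size_map_poly.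
    have -> : size m = N.+1 by rewrite -szm prednK// lt0n size_poly_eq0 monic_neq0.
    have mN : (map_poly ratr m)`_N = 1 :> C.
      by rewrite coef_map -szm -lead_coefE (monicP mm); exact: rmorph1.
    rewrite big_ord_recr /= mN mul1r.
    move/eqP; rewrite addrC addr_eq0 => /eqP ->; rewrite -sumrN; apply: eq_bigr => k _.
    by rewrite !mxE iN eqxx coef_map rmorphN mulNr.
  have iN' : (i.+1 < N)%N by move: (ltn_ord i) iN; move: (nat_of_ord i) => k; lia.
  rewrite (bigD1 (Ordinal iN'))//= !mxE (negbTE iN) eqxx rmorph1 mul1r exprSr big1 ?addr0// => k ki.
  rewrite !mxE (negbTE iN) (_ : (i.+1 == k) = false) ?rmorph0 ?mul0r//.
  by apply: contra_neqF ki => /eqP ik; exact: val_inj.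
have [q xE] := gen x.
pose b (q : {poly rat}) : 'rV[C]_N := \row_j (map_poly ratr q).[sigma j theta].
have [B BV] : exists B : 'M[rat]_N, map_mx ratr B *m V = V *m diag_mx (b q).
  elim/poly_ind: (q) => [|p c [B BV]].
    exists 0; rewrite map_mx0 mul0mx; apply/matrixP => i j.
    by rewrite mul_mx_diag !mxE rmorph0 horner0 mulr0.
  exists (B *m A + c%:M); rewrite map_mxD map_mxM mulmxDl -mulmxA AV mulmxA BV.
  apply/matrixP => i j; rewrite map_scalar_mx mul_scalar_mx !mul_mx_diag !mxE.
  by rewrite rmorphD rmorphM /= map_polyX map_polyC !hornerE /=; ring.
exists (char_poly B); rewrite map_char_poly.
have detV : \det V != 0.
  rewrite det_Vandermonde; apply/prodf_neq0 => i _; apply/prodf_neq0 => j ij.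
  by rewrite !mxE subr_eq0 (inj_eq inj) gt_eqF.
have VP : \det (map_mx polyC V) != 0 by rewrite det_map_mx polyC_eq0.
apply: (mulIf VP); rewrite /char_poly /char_poly_mx -det_mulmx mulmxBl mul_scalar_mx.
rewrite -map_mxM BV map_mxM map_diag_mx -mul_mx_scalar -mulmxBr det_mulmx mulrC; congr (_ * _).
rewrite (_ : _ - _ = diag_mx (\row_j ('X - (sigma j x)%:P))).
  by rewrite det_diag; apply: eq_bigr => j _; rewrite mxE.
apply/matrixP => i j; rewrite !mxE; case: eqP => [->|_]; last by rewrite !mulr0n subr0.
by rewrite !mulr1n xE rmorph_horner_alg.
Qed.

End Embeddings.

Section Units.

Lemma integral_fmorph (F L : fieldType) (f : {rmorphism F -> L}) (x : F) :
  integralOver (intr : int -> L) (f x) <-> integralOver (intr : int -> F) x.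
Proof.
have E (p : {poly int}) : map_poly (intr : int -> L) p = map_poly f (map_poly intr p).
  by rewrite -map_poly_comp; apply: eq_map_poly => a /=; rewrite rmorph_int.
by split=> -[p mp]; [rewrite E fmorph_root|rewrite -(fmorph_root f) -E]; exists p.
Qed.

Lemma integral_rat_int (c : rat) : integralOver (intr : int -> rat) c ->
  exists m : int, c = m%:~R.
Proof.
move=> /(integral_fmorph (ratr : {rmorphism rat -> algC}))[p mp pc].
have : (ratr c : algC) \in Num.int.
  apply: Cint_rat_Aint; first exact: Crat_rat.
  apply: (root_monic_Aint pc); first exact: monic_map.
  by apply/polyOverP => i; rewrite coef_map /=; exact: rpred_int.
move=> /intrP[m cm]; exists m; apply: (fmorph_inj (ratr : {rmorphism rat -> algC})).
by rewrite /= cm rmorph_int.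
Qed.

Variables (C : numClosedFieldType) (K : fieldExtType rat).
Variables (N : nat) (sigma : 'I_N -> {rmorphism K -> C}).
Hypothesis sigma_inj : forall i j, sigma i =1 sigma j -> i = j.
Hypothesis sigma_surj : forall f : {rmorphism K -> C}, exists i, f =1 sigma i.

Lemma norm_rat (x : K) : exists c : rat, \prod_j sigma j x = ratr c.
Proof.
have [P PE] := embeddings_char_poly sigma_inj sigma_surj x.
exists ((-1) ^+ N * P.[0]); rewrite rmorphM rmorphXn rmorphN1 /= -horner_map /= rmorph0 PE.
rewrite horner_prod; under [in RHS]eq_bigr do rewrite !hornerE.
by rewrite prodrN card_ord mulrA -exprD addnn -mul2n exprM sqrrN expr1n expr1n mul1r.
Qed.

Lemma norm_int (x : K) : ring_of_integers x -> exists m : int, \prod_j sigma j x = m%:~R.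
Proof.
move=> xi; have [c cE] := norm_rat x.
have : integralOver (intr : int -> C) (ratr c).
  rewrite -cE; apply: (big_ind (integralOver (intr : int -> C))).
  - exact: (mxpoly.integral1 (intr : {rmorphism int -> C})).
  - exact: (@integral_mul int C (intr : {rmorphism int -> C})).
  - by move=> j _; apply/integral_fmorph.
by move=> /integral_fmorph/integral_rat_int[m cm]; exists m; rewrite cE cm rmorph_int.
Qed.

(** The norms of u and of its inverse are integers with product 1. *)
Lemma norm_unit (u : K) : u != 0 -> ring_of_integers u -> ring_of_integers u^-1 ->
  0 < \prod_j sigma j u -> \prod_j sigma j u = 1.
Proof.
move=> u0 /norm_int[m mE] /norm_int[m' m'E]; rewrite mE ltr0z => m0.
have : \prod_j sigma j u * \prod_j sigma j u^-1 = 1.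
  by rewrite -big_split big1//= => j _; rewrite -rmorphM divff// rmorph1.
rewrite mE m'E -intrM => /eqP; rewrite (eqr_int _ _ 1) => /eqP mm'.
have [m1|m1] : m = 1 \/ 1 < m by lia.
  by rewrite m1.
have [m'0|m'0] : m' <= 0 \/ 1 <= m' by lia.
  by have : m * m' <= 0; [rewrite pmulr_rle0|rewrite mm'].
by have : m <= m * m'; [rewrite ler_peMr// ltW|rewrite mm' leNgt m1].
Qed.

End Units.

Section Signature.
Variables (R : realType) (s t : nat) (K : fieldExtType rat).
Variable sigma : 'I_(s + t + t) -> {rmorphism K -> R[i]}.
Hypothesis hsigma : embedding_labelling sigma.

Lemma normCJ (x : R[i]) : x * x^* = `|x| ^+ 2.
Proof. by rewrite normCK. Qed.

Lemma prod_embeddings (u : K) : \prod_j sigma j u =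
  \prod_(j < s) sigma (lshift t (lshift t j)) u *
  \prod_(k < t) `|sigma (lshift t (rshift s k)) u| ^+ 2.
Proof.
rewrite big_split_ord big_split_ord /= -mulrA; congr (_ * _).
rewrite -big_split; apply: eq_bigr => k _ /=.
by rewrite (sigma_conj hsigma) normCJ.
Qed.

Lemma norm_totally_positive_unit (u : K) : totally_positive_unit sigma u ->
  \prod_j sigma j u = 1.
Proof.
move=> [u0 ui ui' up].
apply: (norm_unit (sigma_inj hsigma) (sigma_surj hsigma)) => //.
rewrite prod_embeddings mulr_gt0 ?prodr_gt0// => k _.
by rewrite exprn_gt0// normr_gt0 fmorph_eq0.
Qed.

(** The left side counts each complex place with its conjugate, but each real place twice: it is the
    norm, equal to 1, times the real embeddings. It is also the real Jacobian of u on H^s x C^t,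
    which thus scales like y_1 ... y_s. *)
Lemma prod_places_totally_positive_unit (u : K) : totally_positive_unit sigma u ->
  \prod_(j < s + t) `|sigma (lshift t j) u| ^+ 2 =
  \prod_(j < s) sigma (lshift t (lshift t j)) u.
Proof.
move=> up; have [_ _ _ u0] := up; have := norm_totally_positive_unit up.
rewrite prod_embeddings big_split_ord /= => n1.
rewrite (eq_bigr (fun j => sigma (lshift t (lshift t j)) u * sigma (lshift t (lshift t j)) u)).
  by rewrite big_split /= -mulrA n1 mulr1.
by move=> j _; rewrite gtr0_norm.
Qed.

End Signature.

Section OneRealPlace.
Variables (R : realType) (t : nat) (K : fieldExtType rat).
Variable sigma : 'I_(1 + t + t) -> {rmorphism K -> R[i]}.
Hypothesis hsigma : embedding_labelling sigma.

(* If `|sigma_k u| = 1, then [u^-1] is a conjugate of [u], so that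
   [(sigma_0 u)^-1] is one of the [sigma_j u]; if no place has
   `|sigma_k u| = 1, the product formula gives [(sigma_0 u)^(t - 1) = 1]. *)
Lemma complex_place_exponent (u : K) : (1 < t)%N ->
  totally_positive_unit sigma u -> u != 1 ->
  exists k : 'I_t, `|sigma (lshift t (rshift 1 k)) u| ^+ 2 != 1 /\
    `|sigma (lshift t (rshift 1 k)) u| ^+ 2 * sigma (lshift t (lshift t ord0)) u != 1.
Proof.
move=> t1 up u1; have [u0 _ _ /(_ ord0) a0] := up.
set a := sigma _ u in a0 *.
have a1 : a != 1.
  by apply: contra_neq u1 => a1; apply: (fmorph_inj (sigma (lshift t (lshift t ord0)))); rewrite rmorph1.
have aX n : (0 < n)%N -> a ^+ n != 1 by move=> n0; rewrite pexpr_eq1// ltW.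
pose b (k : 'I_t) := `|sigma (lshift t (rshift 1 k)) u| ^+ 2.
have [/existsP[k /andP[k1 k2]]|] := boolP [exists k, (b k != 1) && (b k * a != 1)].
  by exists k.
rewrite negb_exists => /forallP nb.
have {}nb k : b k = 1 \/ b k * a = 1.
  by have := nb k; rewrite negb_and !negbK => /orP[] /eqP; [left|right].
exfalso; have [/existsP[k /eqP bk]|] := boolP [exists k, b k == 1].
  have [P PE] := embeddings_char_poly (sigma_inj hsigma) (sigma_surj hsigma) u.
  have sk0 : sigma (lshift t (rshift 1 k)) u != 0 by rewrite fmorph_eq0.
  have Pu : (map_poly (in_alg K) P).[u^-1] = 0.
    apply: (fmorph_inj (sigma (lshift t (rshift 1 k)))); rewrite rmorph0 rmorph_horner_alg PE.
    rewrite horner_prod (bigD1 (rshift (1 + t) k))//= !hornerE (sigma_conj hsigma) fmorphV.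
    have -> : (sigma (lshift t (rshift 1 k)) u)^* = (sigma (lshift t (rshift 1 k)) u)^-1.
      by apply: (mulfI sk0); rewrite normCJ -/(b k) bk mulfV.
    by rewrite subrr mul0r.
  have : root (map_poly ratr P) a^-1.
    by rewrite /root /a -fmorphV -rmorph_horner_alg Pu rmorph0.
  rewrite PE -(big_map (fun j => sigma j u) xpredT (fun z => 'X - z%:P)) root_prod_XsubC => /mapP[j _ ja].
  (* At a complex place k', the conjugate a^-1 would give b k' = a^-2, which is neither 1 nor
     a^-1. *)
  have J (k' : 'I_t) : `|a^-1| ^+ 2 = b k' -> False.
    rewrite gtr0_norm ?invr_gt0// => aE; have := nb k'; rewrite -aE.
    case=> [/eqP|].
      by rewrite exprVn invr_eq1 (negbTE (aX 2 _)).
    rewrite expr2 mulrVK ?unitfE ?gt_eqF// => /eqP; rewrite invr_eq1.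
    exact/negP.
  move: ja; rewrite -[j]splitK; case: (fintype.split j) => [j'|k'] /=; last first.
    by rewrite (sigma_conj hsigma) => ja; apply: (J k'); rewrite ja norm_conjC.
  rewrite -[j']splitK; case: (fintype.split j') => [i'|k'] /=; last first.
    by move=> ja; apply: (J k'); rewrite ja.
  rewrite (_ : i' = ord0) -/a => [ja|]; last by apply: val_inj; case: i' => -[].
  by have := aX 2 isT; rewrite expr2 -{1}ja mulVf ?eqxx// gt_eqF.
rewrite negb_exists => /forallP b1.
have {}nb k : b k = a^-1.
  have [bk|bk] := nb k; first by have := b1 k; rewrite bk eqxx.
  by rewrite -[LHS]mulr1 -(mulfV (lt0r_neq0 a0)) mulrA bk mul1r.
have := norm_totally_positive_unit hsigma up; rewrite prod_embeddings//.
rewrite big_ord1 -/a (eq_bigr (fun=> a^-1)) => [|k _]; last exact: nb.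
rewrite prodr_const card_ord; case: (t) t1 => [//|[//|n]] _.
rewrite exprS mulrA mulfV ?gt_eqF// mul1r exprVn => /eqP.
by rewrite invr_eq1 (negbTE (aX _ _)).
Qed.

End OneRealPlace.

(** * The lifted metric *)

Section ActionDerivative.
Variables (R : realType) (s t : nat) (K : fieldExtType rat).
Variable sigma : 'I_(s + t + t) -> {rmorphism K -> R[i]}.
Local Notation Cn := 'rV[R[i]]_(s + t).

Lemma jacobian_act a u (z : Cn) :
  'J (act sigma a u) z = diag_mx (\row_j sigma (lshift t j) u).
Proof.
set D := diag_mx _.
have mE (w : Cn) : act sigma 0 u w = w *m D.
  by apply/rowP => j; rewrite mul_mx_diag !mxE rmorph0 addr0 mulrC.
have Dc : continuous (mulmxr D : Cn -> Cn).
  have <- : act sigma 0 u = (mulmxr D : Cn -> Cn) by apply/funext => w; exact: mE.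
  exact: act_continuous.
have dE : 'd (act sigma a u) z = mulmxr D :> (Cn -> Cn).
  pose b : Cn := \row_j sigma (lshift t j) a.
  have -> : act sigma a u = (mulmxr D : Cn -> Cn) + cst b.
    by apply/funext => w; rewrite fctE /= -mE; apply/rowP => j; rewrite !mxE rmorph0 addr0.
  have dL : differentiable (mulmxr D : Cn -> Cn) z by exact: linear_differentiable.
  have dC : differentiable (cst b : Cn -> Cn) z by exact: differentiable_cst.
  have e1 : 'd (mulmxr D : Cn -> Cn) z = mulmxr D :> (Cn -> Cn) := diff_lin z Dc.
  have e2 : 'd (cst b : Cn -> Cn) z = 0 :> (Cn -> Cn) := diff_cst b z.
  have e3 := diffD dL dC.
  apply: (etrans e3).
  apply/funext => w.
  have e1w := congr1 (fun f : Cn -> Cn => f w) e1.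
  have e2w := congr1 (fun f : Cn -> Cn => f w) e2.
  exact: (etrans (f_equal2 (@GRing.add Cn) e1w e2w) (addr0 _)).
apply/matrixP => i j; rewrite /jacobian mxE dE /= -rowE mxE.
by [].
Qed.

End ActionDerivative.

Section GlobalMetric.
Variables (R : realType) (s t : nat) (hs : (0 < s)%N) (K : fieldExtType rat).
Variable sigma : 'I_(s + t + t) -> {rmorphism K -> R[i]}.
Hypothesis hsigma : embedding_labelling sigma.
Variables (U : set K) (hU : admissible sigma U).
Variable g : hermitian_metric (OT_manifold hs hsigma hU).
Local Notation Cn := 'rV[R[i]]_(s + t).
Local Notation HC := (HC R s t).

(** The chart contains the prescribed z, whereas [OT_chart_cover] only provides some point of its
    orbit. *)
Lemma OT_chart_at (z : Cn) : HC z -> exists c : OT_chart hU, OT_dom c z.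
Proof.
move=> Hz.
have [V [W [[oV Vz VH] [oW Ww WH] VW]]] := act_separation (admissible_pd hU) Hz Hz.
have VWH : V `&` W `<=` HC by move=> x [/VH].
have inj x y : (V `&` W) x -> (V `&` W) y -> OT_proj hU x = OT_proj hU y -> x = y.
  move=> [Vx Wx] [Vy Wy] /(OT_projP hU (VH _ Vx) (VH _ Vy))[a [u [ia Uu yx]]].
  have az : act sigma a u z = z by apply: (VW a u x) => //; rewrite -yx.
  have [a0 u1] := act_fixed hU hs hsigma Uu Hz az.
  by rewrite yx a0 u1 act1.
by exists (OTChart (openI oV oW) VWH inj).
Qed.

(** Chart domains are subsets of H^s x C^t itself, so the pullback of the metric at z is its matrix
    in any chart around z; by [lifted_metricE] the choice does not matter. *)
Definition lifted_metric (z : Cn) : 'M[R[i]]_(s + t) :=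
  if pselect (HC z) is left Hz then metric_mx g (projT1 (cid (OT_chart_at Hz))) z else 0.

Local Notation h := lifted_metric.

Let dom_HC (c : OT_chart hU) z : OT_dom c z -> HC z.
Proof. exact: OT_dom_sub. Qed.

(** The action is itself a change of charts, so this is the compatibility of g. It yields both
    invariance under the group and, for a = 0 and u = 1, independence of the chart. *)
Let metric_act (c c' : OT_chart hU) a u z : ring_of_integers a -> U u ->
  OT_dom c z -> OT_dom c' (act sigma a u z) ->
  metric_mx g c z = diag_mx (\row_j sigma (lshift t j) u) *m
    metric_mx g c' (act sigma a u z) *m (map_mx conjc (diag_mx (\row_j sigma (lshift t j) u)))^T.
Proof.
move=> ia Uu cz c'z; pose V := OT_dom c `&` act sigma a u @^-1` OT_dom c'.
have oV : open V.
  apply: openI; first exact: OT_dom_open.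
  by apply: open_comp; [move=> x _; exact: act_continuous|exact: OT_dom_open].
have := @metric_compat R (s + t) (OT_manifold hs hsigma hU) g c c' V (act sigma a u) oV _ _ z.
rewrite jacobian_act; apply.
- by move=> w [].
- move=> w [cw c'w]; split; first exact: c'w.
  apply/esym/OT_projP; [exact: dom_HC cw|exact: dom_HC c'w|].
  by exists a, u.
- by split.
Qed.

Lemma lifted_metricE (c : OT_chart hU) z : OT_dom c z -> h z = metric_mx g c z.
Proof.
move=> cz; rewrite /h; case: pselect => [Hz|/(_ (dom_HC cz))//].
case: (cid _) => c0 /= c0z.
have cz' : OT_dom c (act sigma 0 1 z) by rewrite act1.
have := metric_act (O_K0 K) (unit_subgroup1 hU) c0z cz'.
rewrite act1 => ->.
have -> : diag_mx (\row_j sigma (lshift t j) 1) = 1%:M :> 'M[R[i]]_(s + t).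
  by apply/matrixP => i j; rewrite !mxE rmorph1.
by rewrite mul1mx map_mx1 trmx1 mulmx1.
Qed.

Lemma lifted_metric_act a u z j k : ring_of_integers a -> U u -> HC z ->
  h z j k = sigma (lshift t j) u * (sigma (lshift t k) u)^* * h (act sigma a u z) j k.
Proof.
move=> ia Uu Hz; have [c cz] := OT_chart_at Hz.
have [c' c'z] := OT_chart_at (act_HC hU hsigma a Uu Hz).
rewrite (lifted_metricE cz) (lifted_metricE c'z) (metric_act ia Uu cz c'z).
rewrite map_diag_mx tr_diag_mx mul_mx_diag mul_diag_mx !mxE.
by move: (metric_mx _ _ _ _ _) => x; ring.
Qed.

Lemma lifted_metric_smooth j k p : of_class_C p HC (fun z => h z j k).
Proof.
apply: of_class_C_local => z Hz; have [c cz] := OT_chart_at Hz.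
exists (OT_dom c) => //.
apply: (eq_of_class_C (OT_dom_open (o := c)) _ (metric_smooth g c j k p)) => y cy.
by rewrite (lifted_metricE cy).
Qed.

Lemma lifted_metric_hermitian z : HC z -> (map_mx conjc (h z))^T = h z.
Proof.
move=> Hz; have [c cz] := OT_chart_at Hz.
by rewrite (lifted_metricE cz); exact: (@metric_hermitian _ _ _ g c).
Qed.

Lemma lifted_metric_pos z v : HC z -> v != 0 -> 0 < herm (h z) v v.
Proof.
move=> Hz; have [c cz] := OT_chart_at Hz.
by rewrite (lifted_metricE cz); exact: (@metric_pos _ _ _ g c).
Qed.

Lemma lifted_astheno_kahler S z : astheno_kahler g -> HC z ->
  del (delbar (wedge_pow (fundamental_form h) (s + t - 2))) S z = 0.
Proof.
move=> ak Hz; have [c cz] := OT_chart_at Hz.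
have oc := OT_dom_open (o := c).
have W2 T : of_class_C 2 (OT_dom c) (wedge_pow (fundamental_form h) (s + t - 2) T).
  apply: (of_class_C_wedge_pow oc) => T'; apply: (of_class_C_fundamental_form oc) => i j.
  by apply: (of_class_C_sub _ (lifted_metric_smooth i j 2)) => y; exact: dom_HC.
rewrite (eq_on_del_delbar S (b := wedge_pow (fundamental_form (metric_mx g c)) (s + t - 2)) oc W2 _ cz).
  exact: ak.
move=> T y cy.
have E S' : fundamental_form h S' y = fundamental_form (metric_mx g c) S' y.
  by rewrite !fundamental_formS (lifted_metricE cy).
elim: (s + t - 2)%N T => [//|p IH] T /=.
by apply: eq_bigr => A _; rewrite E IH.
Qed.

End GlobalMetric.

Section ComplexNorm.
Variable R : realType.
Implicit Types x y : R[i].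

(* The norm of R[i] takes its values in R[i]; this is its real value. *)
Definition rnorm x : R := complex.Re `|x|.

Lemma rnormE x : `|x| = (rnorm x)%:C.
Proof. by rewrite /rnorm normc_def. Qed.

Lemma rnormM x y : rnorm (x * y) = rnorm x * rnorm y.
Proof. by apply: complexI; rewrite -rnormE normrM !rnormE -rmorphM. Qed.

Lemma rnormV x : rnorm x^-1 = (rnorm x)^-1.
Proof. by apply: complexI; rewrite -rnormE normfV !rnormE -fmorphV. Qed.

Lemma rnorm1 : rnorm 1 = 1.
Proof. by rewrite /rnorm normr1. Qed.

Lemma rnorm_ge0 x : 0 <= rnorm x.
Proof. by rewrite -lecR -rnormE normr_ge0. Qed.

Lemma rnorm_gt0 x : (0 < rnorm x) = (x != 0).
Proof. by rewrite -ltcR -rnormE normr_gt0. Qed.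

Lemma rnormJ x : rnorm x^* = rnorm x.
Proof. by rewrite /rnorm norm_conjC. Qed.

Lemma rnormC (a : R) : rnorm a%:C = `|a|.
Proof. by rewrite /rnorm normc_def /= expr0n addr0 sqrtr_sqr. Qed.

Lemma rnormD x y : rnorm (x + y) <= rnorm x + rnorm y.
Proof. by rewrite -lecR rmorphD -!rnormE ler_normD. Qed.

Lemma Re_le_rnorm x : `|complex.Re x| <= rnorm x.
Proof. by rewrite -lecR -rnormE normc_ge_Re. Qed.

Lemma rnorm_continuous : continuous (@rnorm : R[i] -> R).
Proof.
move=> x W /nbhs_ballP[e /= e0 eW]; apply/nbhs_ballP; exists e%:C; first by rewrite /= ltcR.
move=> y xy; apply: eW; have {}xy : rnorm (x - y) < e by rewrite -ltcR -rnormE; exact: xy.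
have yx : rnorm (y - x) = rnorm (x - y) by rewrite /rnorm distrC.
have := rnormD (x - y) y; have := rnormD (y - x) x; rewrite !subrK yx => h1 h2.
by rewrite /ball/= ltr_norml; apply/andP; split; lra.
Qed.

Lemma rnorm_prod (I : Type) (r : seq I) (P : pred I) (F : I -> R[i]) :
  rnorm (\prod_(i <- r | P i) F i) = \prod_(i <- r | P i) rnorm (F i).
Proof.
by apply: big_morph; [exact: rnormM|exact: rnorm1].
Qed.

End ComplexNorm.

(** * Equivariant functions *)

Section EquivariantFunctions.
Variables (R : realType) (s t : nat) (K : fieldExtType rat).
Variable sigma : 'I_(s + t + t) -> {rmorphism K -> R[i]}.
Hypothesis hsigma : embedding_labelling sigma.
Variables (U : set K) (hU : admissible sigma U).
Local Notation C := R[i].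
Local Notation Cn := 'rV[C]_(s + t).
Local Notation HC := (HC R s t).
Local Notation sg j u := (sigma (lshift t j) u).
Implicit Types (F : Cn -> C) (chi : K -> C) (z : Cn) (e : 'I_(s + t) -> R).

Definition real_place : pred 'I_(s + t) := fun j => (j < s)%N.

Lemma half_spaces_HC : half_spaces real_place = HC.
Proof.
apply/seteqP; split=> z Hz j; first by apply: Hz; rewrite /real_place /= ltn_ord.
move=> js; have := Hz (Ordinal js); congr (0 < complex.Im (z 0 _)).
exact: val_inj.
Qed.

Lemma real_placeP (Q : 'I_(s + t) -> Prop) :
  (forall j : 'I_s, Q (lshift t j)) -> forall j, real_place j -> Q j.
Proof.
move=> Qs j js; have := Qs (Ordinal js).
by rewrite (_ : lshift t _ = j)//; exact: val_inj.
Qed.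

Lemma embedding_real_place u : U u -> forall j, real_place j ->
  sg j u = (rnorm (sg j u))%:C /\ 0 < rnorm (sg j u).
Proof.
move=> /(unit_subgroup_sub hU)[_ _ _ up]; apply: real_placeP => j.
by rewrite -rnormE -ltcR -rnormE gtr0_norm.
Qed.

Lemma Im_act a u z : U u -> forall j, real_place j ->
  complex.Im (act sigma a u z 0 j) = rnorm (sg j u) * complex.Im (z 0 j).
Proof.
move=> Uu j Pj; have [sE _] := embedding_real_place Uu Pj.
have [x xE] : exists x, sg j a = x%:C.
  have := real_placeP (Q := fun j => exists x, sg j a = x%:C); apply => // i.
  exact/complex_realP/(sigma_real hsigma).
rewrite mxE xE; move: sE; move: (rnorm _) => y ->; case: (z 0 j) => z1 z2 /=.
by rewrite mul0r !addr0.
Qed.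

(** The character sending u to the product of the |sigma_j u|^(e j), obtained by evaluating [mon] at
    a point with imaginary parts |sigma_j u|. *)
Definition mon_factor e u : R := mon e (\row_j (0 +i* rnorm (sg j u))).

Lemma mon_factor_gt0 e u : 0 < mon_factor e u.
Proof. exact: mon_gt0. Qed.

Lemma mon_act e a u z : (forall j, e j != 0 -> real_place j) -> U u -> HC z ->
  mon e (act sigma a u z) = mon_factor e u * mon e z.
Proof.
move=> eP Uu Hz; rewrite /mon_factor /mon -expRD -big_split; congr expR.
apply: eq_bigr => j _ /=; have [->|ej] := eqVneq (e j) 0; first by rewrite !mul0r addr0.
have Pj := eP j ej; rewrite (Im_act _ _ Uu Pj) mxE /= lnM ?posrE ?mulrDr//.
  exact: (embedding_real_place Uu Pj).2.
by rewrite -half_spaces_HC in Hz; exact: Hz.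
Qed.

(** The transformation rule of a coefficient of an invariant form: u contributes a weight,
    translations contribute nothing. *)
Definition equi chi F := forall a u z, ring_of_integers a -> U u -> HC z ->
  F z = chi u * F (act sigma a u z).

Lemma eq_equi chi chi' F : (forall u, U u -> chi u = chi' u) -> equi chi F -> equi chi' F.
Proof. by move=> E H a u z ia Uu Hz; rewrite -E//; exact: H. Qed.

Lemma equiM chi chi' F F' : equi chi F -> equi chi' F' ->
  equi (fun u => chi u * chi' u) (fun z => F z * F' z).
Proof.
move=> H H' a u z ia Uu Hz; rewrite (H a u z)// (H' a u z)//.
by move: (F _) (F' _) => x y; ring.
Qed.

Lemma equiZ (c : C) chi F : equi chi F -> equi chi (fun z => c * F z).
Proof. by move=> H a u z ia Uu Hz; rewrite (H a u z)// mulrCA. Qed.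

Lemma equi_sum (I : Type) (r : seq I) (P : pred I) chi (F : I -> Cn -> C) :
  (forall i, P i -> equi chi (F i)) -> equi chi (fun z => \sum_(i <- r | P i) F i z).
Proof.
move=> H a u z ia Uu Hz; rewrite mulr_sumr; apply: eq_bigr => i Pi; exact: H.
Qed.

Lemma equi_mon e : (forall j, e j != 0 -> real_place j) ->
  equi (fun u => ((mon_factor e u)^-1)%:C) (fun z => (mon e z)%:C).
Proof.
move=> eP a u z ia Uu Hz; rewrite mon_act// -rmorphM mulrA mulVf ?mul1r//.
exact: lt0r_neq0 (mon_factor_gt0 _ _).
Qed.

Lemma equi_dz chi F j : of_class_C 1 HC F -> equi chi F ->
  equi (fun u => chi u * sg j u) (dz j F).
Proof.
move=> F1 H a u z ia Uu Hz; have Hz' := act_HC hU hsigma a Uu Hz.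
rewrite (eq_on_dz j (@HC_open R s t) F1 (fun y Hy => H a u y ia Uu Hy) Hz).
exact: (dz_affine (l := fun j => sg j u) (b := fun j => sg j a) j (@HC_open R s t) F1 Hz').
Qed.

Lemma equi_dzbar chi F j : of_class_C 1 HC F -> equi chi F ->
  equi (fun u => chi u * (sg j u)^*) (dzbar j F).
Proof.
move=> F1 H a u z ia Uu Hz; have Hz' := act_HC hU hsigma a Uu Hz.
rewrite (eq_on_dzbar j (@HC_open R s t) F1 (fun y Hy => H a u y ia Uu Hy) Hz).
exact: (dzbar_affine (l := fun j => sg j u) (b := fun j => sg j a) j (@HC_open R s t) F1 Hz').
Qed.

Lemma continuous_on_compact_bounded (D : set Cn) F : compact D -> D `<=` HC ->
  (forall z, HC z -> {for z, continuous F}) -> exists B, forall z, D z -> rnorm (F z) <= B.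
Proof.
move=> cD DH Fc.
have cf : {within D, continuous (fun z => rnorm (F z))}.
  apply: continuous_in_subspaceT => z /set_mem/DH/Fc Fz.
  exact: continuous_comp Fz (@rnorm_continuous R (F z)).
have /compact_bounded/pinfty_ex_gt0[M _ MP] := continuous_compact cf cD.
exists M => z Dz; rewrite -[rnorm _]ger0_norm ?rnorm_ge0//.
by apply: MP; exists z.
Qed.

Lemma invariant_bounded chi F : (forall z, HC z -> {for z, continuous F}) ->
  equi chi F -> (forall u, U u -> rnorm (chi u) = 1) ->
  exists B, forall z, HC z -> rnorm (F z) <= B.
Proof.
move=> Fc eF chi1; have [D [cD DH Dcov]] := admissible_cocompact hU.
have [B BP] := continuous_on_compact_bounded cD DH Fc; exists B => z Hz.
have [a [u [w [ia Uu Dw zw]]]] := Dcov z Hz.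
have := BP w Dw; rewrite (eF a u w ia Uu (DH _ Dw)) -zw rnormM chi1// mul1r.
exact.
Qed.

(** The point [i0] has complex coordinates 0, so u moves it only at the real places. All u whose
    real embeddings lie between lo and hi keep it in a fixed compact box; by proper discontinuity
    they are finitely many. *)
Lemma embedding_bounded (lo hi : R) p : 0 < lo -> exists B, forall u, U u ->
  (forall j, real_place j -> lo <= rnorm (sg j u) <= hi) -> rnorm (sg p u) <= B.
Proof.
(* The interval is enlarged to contain 1, so that the box contains [i0] as well as its images. *)
move=> lo0; pose m := Num.min lo 1; pose M := Num.max hi 1.
have m0 : 0 < m by rewrite lt_min lo0 ltr01.
have m1 : m <= 1 by rewrite ge_min lexx orbT.
have M1 : 1 <= M by rewrite le_max lexx orbT.
pose y0 : Cn := \row_j (0 +i* (if real_place j then (m + M) / 2 else 0)).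
pose D := cbox y0 ((M - m) / 2).
pose i0 : Cn := \row_j (0 +i* (if real_place j then 1 else 0)).
have e0 : 0 <= (M - m) / 2 by lra.
have DH : D `<=` HC.
  move=> z Dz; rewrite -half_spaces_HC => j Pj; have [_] := Dz j.
  by rewrite mxE /= Pj ler_distl => /andP[+ _]; lra.
have Di0 : D i0.
  move=> j; rewrite !mxE /= subrr normr0; split=> //; case: ifP => _; last by rewrite subrr normr0.
  by rewrite ler_distl; apply/andP; split; lra.
have Dact u : U u -> (forall j, real_place j -> lo <= rnorm (sg j u) <= hi) ->
    D (act sigma 0 u i0).
  move=> Uu lohi j; rewrite !mxE rmorph0 addr0; case: ifP => Pj; last first.
    have -> : (0 +i* 0 : C) = 0 by [].
    by rewrite mulr0 /= !subr0 !normr0.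
  have [-> _] := embedding_real_place Uu Pj; rewrite /= !mul0r !mulr0 !mulr1 subrr addr0 subr0 normr0.
  split=> //; have /andP[h1 h2] := lohi j Pj.
  have h3 : m <= rnorm (sg j u) by rewrite (le_trans _ h1)// ge_min lexx.
  have h4 : rnorm (sg j u) <= M by rewrite (le_trans h2)// le_max lexx.
  by rewrite ler_distl; apply/andP; split; lra.
have cD : compact D by exact: cbox_compact.
have /finite_fsetP[X XE] := admissible_pd hU cD DH.
exists (\big[Num.max/0]_(v <- enum_fset X) rnorm (sg p v.2)) => u Uu lohi.
have X0 : (0, u) \in enum_fset X.
  have : [set` X] (0, u).
    by rewrite -XE /=; split; [exact: O_K0|exact: Uu|exists i0; [exact: Di0|exact: Dact]].
  exact.
exact: (@le_bigmax_seq _ _ _ _ _ (0, u) xpredT (fun v : K * K => rnorm (sg p v.2)) X0 isT).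
Qed.

(** Written as monomials, y_j and its inverse inherit continuity and equivariance. *)
Lemma mon_delta j z : 0 < complex.Im (z 0 j) ->
  mon (fun i => (i == j)%:R) z = complex.Im (z 0 j) /\
  mon (decr (fun=> 0) j) z = (complex.Im (z 0 j))^-1.
Proof.
move=> zj; have m0 : mon (fun=> 0 : R) z = 1.
  by rewrite /mon big1 ?expR0// => i _; rewrite mul0r.
split.
  rewrite (mon_decr _ zj) (_ : decr _ j = fun=> 0) ?m0 ?mul1r//.
  by apply/funext => i; rewrite /decr subrr.
have := mon_decr (fun=> 0) zj; rewrite m0 => /esym/(canRL (mulfK _)) ->; last exact: lt0r_neq0.
by rewrite mul1r.
Qed.

Lemma Im_pos z j : HC z -> real_place j -> 0 < complex.Im (z 0 j).
Proof. by rewrite -half_spaces_HC => Hz Pj; exact: Hz. Qed.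

Lemma mon_dom_HC e : (forall j, e j != 0 -> real_place j) -> mon_dom HC e.
Proof. by move=> eP z j Hz /eP; exact: Im_pos. Qed.

Lemma decr0_place j : real_place j -> forall i, decr (fun=> 0 : R) j i != 0 -> real_place i.
Proof.
move=> Pj i; rewrite /decr; have [->//|_] := eqVneq i j.
by rewrite subr0 eqxx.
Qed.

Lemma compact_Im_bounded (D : set Cn) : compact D -> D `<=` HC ->
  exists2 M : R, 0 < M & forall z j, D z -> real_place j ->
    complex.Im (z 0 j) <= M /\ (complex.Im (z 0 j))^-1 <= M.
Proof.
move=> cD DH.
have /choice[M MP] j : exists M : R, forall z, D z -> real_place j ->
    complex.Im (z 0 j) <= M /\ (complex.Im (z 0 j))^-1 <= M.
  case Pj: (real_place j); last by exists 0.
  have eP i : ((i == j)%:R : R) != 0 -> real_place i.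
    by have [->//|_] := eqVneq i j; rewrite eqxx.
  have [B1 B1P] := continuous_on_compact_bounded cD DH
    (fun z => mon_continuous (mon_dom_HC eP) (z := z)).
  have [B2 B2P] := continuous_on_compact_bounded cD DH
    (fun z => mon_continuous (mon_dom_HC (decr0_place Pj)) (z := z)).
  exists (Num.max B1 B2) => z Dz _; have zj := Im_pos (DH _ Dz) Pj.
  have := B1P z Dz; have := B2P z Dz; have [-> ->] := mon_delta zj.
  rewrite !rnormC !gtr0_norm ?invr_gt0// => h2 h1.
  by rewrite !le_max h1 h2 orbT.
exists (\big[Num.max/1]_j M j); first by rewrite (lt_le_trans ltr01)// bigmax_ge_id.
move=> z j Dz Pj; have [h1 h2] := MP j z Dz Pj.
by split; [apply: le_trans h1 _|apply: le_trans h2 _]; exact: le_bigmax.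
Qed.

(** Write z = u w + a with w in a compact set; then |F z| = |sigma_p u| |F w|. On the slab, the real
    embeddings of u, being the quotients y_j(z) / y_j(w), are confined to a compact range, so
    [embedding_bounded] controls |sigma_p u| even when p is a complex place. *)
Lemma equi_bounded_slab chi F p r : (forall z, HC z -> {for z, continuous F}) ->
  equi chi F -> (forall u, U u -> rnorm (chi u) * rnorm (sg p u) = 1) ->
  exists B, forall z, HC z -> (forall i, real_place i -> 1 <= complex.Im (z 0 i) <= r) ->
    rnorm (F z) <= B.
Proof.
move=> Fc eF chip; have [D [cD DH Dcov]] := admissible_cocompact hU.
have [B BP] := continuous_on_compact_bounded cD DH Fc.
have [M M0 MP] := compact_Im_bounded cD DH.
have Mi : 0 < M^-1 by rewrite invr_gt0.
have [S SP] := embedding_bounded (r * M) p Mi.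
exists (S * B) => z Hz zr; have [a [u [w [ia Uu Dw zw]]]] := Dcov z Hz.
have -> : rnorm (F z) = rnorm (sg p u) * rnorm (F w).
  by rewrite (eF a u w ia Uu (DH _ Dw)) -zw rnormM mulrA [_ * rnorm (chi u)]mulrC chip// mul1r.
apply: ler_pM; [exact: rnorm_ge0|exact: rnorm_ge0| |exact: BP].
apply: SP => // j Pj; have wj := Im_pos (DH _ Dw) Pj; have [w1 w2] := MP w j Dw Pj.
have := zr j Pj; rewrite zw (Im_act _ _ Uu Pj) => /andP[h1 h2].
have sg0 := (embedding_real_place Uu Pj).2.
have rE : rnorm (sg j u) = rnorm (sg j u) * complex.Im (w 0 j) * (complex.Im (w 0 j))^-1.
  by rewrite mulfK ?lt0r_neq0.
apply/andP; split.
  rewrite -(ler_pM2r M0) mulVf ?lt0r_neq0//.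
  by apply: le_trans h1 _; rewrite ler_pM2l.
rewrite rE; apply: ler_pM => //; last by rewrite invr_ge0 ltW.
by rewrite mulr_ge0// ltW.
Qed.

Lemma mon_factor_decr0 p u : U u -> real_place p ->
  mon_factor (decr (fun=> 0) p) u = (rnorm (sg p u))^-1.
Proof.
move=> Uu Pp; rewrite /mon_factor.
have := @mon_delta p (\row_j (0 +i* rnorm (sg j u))); rewrite mxE /=.
by move=> /(_ (embedding_real_place Uu Pp).2)[].
Qed.

(** Division by y_p makes the weight of F one of modulus 1, so that F / y_p is bounded on all of H^s
    x C^t, without restriction to a slab. *)
Lemma equi_bounded_real chi F p : (forall z, HC z -> {for z, continuous F}) ->
  equi chi F -> (forall u, U u -> rnorm (chi u) * rnorm (sg p u) = 1) -> real_place p ->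
  exists B, forall z, HC z -> rnorm (F z) <= B * complex.Im (z 0 p).
Proof.
move=> Fc eF chip Pp; have dP := decr0_place Pp.
have [|||B BP] := @invariant_bounded (fun u => chi u * ((mon_factor (decr (fun=> 0) p) u)^-1)%:C)
    (fun z => F z * (mon (decr (fun=> 0) p) z)%:C).
- move=> z Hz; apply: (@continuousM C Cn F); first exact: Fc.
  exact: mon_continuous (mon_dom_HC dP) Hz.
- by apply: equiM eF _; exact: equi_mon.
- move=> u Uu; rewrite rnormM mon_factor_decr0// invrK rnormC ger0_norm ?rnorm_ge0//.
  exact: chip.
exists B => z Hz; have zp := Im_pos Hz Pp; have := BP z Hz.
rewrite rnormM rnormC (mon_delta zp).2 gtr0_norm ?invr_gt0//.
by rewrite ler_pdivrMr.
Qed.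

End EquivariantFunctions.

(** * Integration by parts *)

Section IntegrationByParts.
Variables (R : realType) (n : nat).
Local Notation C := R[i].
Local Notation Cn := 'rV[C]_n.

(** Both products have the same cross term, dz_p w times dzbar_q a. With this arrangement of
    derivatives their order never has to be exchanged. *)
Lemma dz_dzbar_parts (V : set Cn) (w a : Cn -> C) p q z : open V ->
  of_class_C 2 V w -> of_class_C 2 V a -> V z ->
  dzbar q (fun y => a y * dz p w y) z - dz p (fun y => w y * dzbar q a y) z =
  a z * dzbar q (dz p w) z - w z * dz p (dzbar q a) z.
Proof.
move=> oV w2 a2 Vz.
rewrite (dzM p (of_class_CW w2) (of_class_C_dzbar q oV a2) Vz).
rewrite (dzbarM q (of_class_CW a2) (of_class_C_dz p oV w2) Vz).
move: (dz p (dzbar q a) z) (dzbar q (dz p w) z) (dz p w z) (dzbar q a z) => x1 x2 x3 x4.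
by move: (a z) (w z) => x5 x6; ring.
Qed.

Lemma dzbar_dz_mon (V : set Cn) e p q z : open V -> mon_dom V e -> V z ->
  dzbar q (dz p (fun y => (mon e y)%:C)) z =
  (4^-1 * e p * decr e p q)%:C * (mon (decr (decr e p) q) z)%:C.
Proof.
move=> oV Ve Vz.
have w1 := of_class_C_dz p oV (of_class_C_mon 2 oV Ve).
rewrite (eq_on_dzbar q oV w1 (fun y Vy => dz_mon p Ve Vy) Vz).
(* If e p = 0, then [decr e p] has exponent -1 at p, where Im z_p need not be positive; the
   vanishing coefficient disposes of this case. *)
have [ep|ep] := eqVneq (e p) 0.
  have -> : (fun y : Cn => - 'i / 2 * (e p)%:C * (mon (decr e p) y)%:C) = (fun=> 0).
    by apply/funext => y; rewrite ep rmorph0 mulr0 mul0r.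
  by rewrite dzbar_cst ep mulr0 mul0r rmorph0 mul0r.
have Ve' := mon_dom_decr Ve ep.
rewrite (dzbarZ _ q oV (of_class_C_mon 1 oV Ve') Vz) (dzbar_mon q Ve' Vz).
move: (mon _ z) (e p) (decr e p q) => x1 x2 x3.
by apply/eqP; rewrite eq_complex /=; apply/andP; split; apply/eqP; field.
Qed.

(** The passage from the (1,0) and (0,1) components F, F' of a complex field to its components along
    x_j and y_j: collect d/dx and d/dy in dz_j F + dzbar_j F'. *)
Lemma dz_add_dzbar (V : set Cn) (F F' : Cn -> C) (k : C) j z : open V ->
  of_class_C 1 V F -> of_class_C 1 V F' -> V z ->
  rderive (delta_mx 0 j) (fun y => k * (2^-1 * (F y + F' y))) z +
  rderive ('i *: delta_mx 0 j) (fun y => k * ('i / 2 * (F' y + - 1 * F y))) z =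
  k * (dz j F z + dzbar j F' z).
Proof.
move=> oV F1 F'1 Vz.
have D v := of_class_C_is_rderive v F1 Vz; have D' v := of_class_C_is_rderive v F'1 Vz.
have Dc v (c : C) := is_rderive_cst v c z.
rewrite (rderiveE (is_rderiveM (Dc _ _) (is_rderiveM (Dc _ _) (is_rderiveD (D _) (D' _))))).
rewrite (rderiveE (is_rderiveM (Dc _ _) (is_rderiveM (Dc _ _) (is_rderiveD (D' _) (is_rderiveM (Dc _ _) (D _)))))).
rewrite /dz /dzbar.
move: (rderive ('i *: _) F z) (rderive ('i *: _) F' z) (rderive _ F z) (rderive _ F' z).
by move: (F z) (F' z) => x1 x2 x3 x4 x5 x6; field.
Qed.

End IntegrationByParts.

Lemma sum_single (V : nmodType) (I : finType) (P Q : pred I) (G : I -> I -> V) p0 q0 :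
  P p0 -> Q q0 -> (forall p q, P p -> Q q -> (p != p0) || (q != q0) -> G p q = 0) ->
  \sum_(p | P p) \sum_(q | Q q) G p q = G p0 q0.
Proof.
move=> Pp Qq G0; rewrite (bigD1 p0)//= (bigD1 q0)//= [X in _ + X + _]big1 ?addr0 => [|q /andP[Pq qq]].
  by rewrite big1 ?addr0// => p /andP[Pp' pp]; apply: big1 => q Pq; rewrite G0 ?pp.
by rewrite G0 ?qq ?orbT.
Qed.

(** * The obstruction attached to a monomial weight *)

Section WeightedObstruction.
Variables (R : realType) (s t : nat) (hs : (0 < s)%N) (K : fieldExtType rat).
Variable sigma : 'I_(s + t + t) -> {rmorphism K -> R[i]}.
Hypothesis hsigma : embedding_labelling sigma.
Variables (U : set K) (hU : admissible sigma U).
Variable g : hermitian_metric (OT_manifold hs hsigma hU).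
Local Notation n := (s + t)%N.
Local Notation C := R[i].
Local Notation Cn := 'rV[C]_(s + t).
Local Notation HC := (HC R s t).
Local Notation sg j u := (sigma (lshift t j) u).
Local Notation l := (lshift (s + t)).
Local Notation r := (@rshift (s + t) (s + t)).
Local Notation h := (lifted_metric g).
Local Notation equi := (equi sigma U).
Local Notation mf := (mon_factor sigma).

Variables (j0 k0 p0 q0 : 'I_(s + t)) (e : 'I_(s + t) -> R) (m : nat).
Hypothesis e_real : forall j, e j != 0 -> real_place j.
(* The weight of [mon e] is inverse to that of dz_j0 /\ dzbar_k0. *)
Hypothesis weight : forall u, U u -> mf e u * (rnorm (sg j0 u) * rnorm (sg k0 u)) = 1.
(** Up to the factor 1/4, e p * decr e p q is the coefficient of the second derivative of the weight
    along dz_p, dzbar_q. Among the pairs that occur in the coefficient of index S, it survives only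
    at (p0, q0). *)
Hypothesis e_p0q0 : e p0 * decr e p0 q0 != 0.
Hypothesis e_other : forall p q, p != j0 -> q != k0 -> e p * decr e p q != 0 ->
  p = p0 /\ q = q0.
Hypotheses (p0j0 : p0 != j0) (q0k0 : q0 != k0).
Hypothesis m_n : m = (n - 2)%N.
Variable al : 'I_m -> 'I_(s + t).
Hypothesis al_increasing : increasing al.
Local Notation S := (~: [set l j0; r k0])%SET.
(** The remaining index has the same dz and dzbar directions: the coefficient of omega^m there is a
    principal minor, hence of known sign. *)
Hypothesis S_al : (S :\ l p0 :\ r q0)%SET = bi_index al al.

Local Notation W := (wedge_pow (fundamental_form h) m).
Local Notation w := (fun z : Cn => (mon e z)%:C).
Local Notation one_real := (fun j : 'I_(s + t) => (real_place j)%:R : R).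
Local Notation Y := (mon one_real).

Let oHC : open HC := @HC_open R s t.

(** The factor by which pullback under u multiplies the covector b. *)
Let chi (b : 'I_(n + n)) (u : K) : C :=
  match fintype.split b with inl j => sg j u | inr k => (sg k u)^* end.

Let chil j u : chi (l j) u = sg j u.
Proof. by rewrite /chi (unsplitK (inl j)). Qed.

Let chir j u : chi (r j) u = (sg j u)^*.
Proof. by rewrite /chi (unsplitK (inr j)). Qed.

Let W_smooth p T : of_class_C p HC (W T).
Proof.
apply: (of_class_C_wedge_pow oHC) => T'; apply: (of_class_C_fundamental_form oHC) => i j.
exact: lifted_metric_smooth.
Qed.

Let W_equi (T : {set 'I_(n + n)}) : equi (fun u => \prod_(b in T) chi b u) (W T).
Proof.
move=> a u z ia Uu Hz.
have E : equivariant_form HC (act sigma a u) (fun b => chi b u) (fundamental_form h).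
  apply: equivariant_fundamental_form => y j k Hy.
  by rewrite chil chir; exact: lifted_metric_act.
exact: (equivariant_wedge_pow m E T Hz).
Qed.

Let w_dom : mon_dom HC e := mon_dom_HC e_real.

Let w_smooth p : of_class_C p HC w := of_class_C_mon p oHC w_dom.

Let one_real_real j : one_real j != 0 -> real_place j.
Proof. by rewrite /=; case: (real_place j) => //; rewrite eqxx. Qed.

Let Y_smooth p : of_class_C p HC (fun z => (Y z)%:C) :=
  of_class_C_mon p oHC (mon_dom_HC one_real_real).

Let mf_one_real u : U u -> mf one_real u = \prod_(j | real_place j) rnorm (sg j u).
Proof.
move=> Uu; rewrite /mon_factor /mon (big_morph expR (@expRD R) (@expR0 R)) [RHS]big_mkcond.
apply: eq_bigr => j _; rewrite mxE /=; case: ifP => Pj; last by rewrite mul0r expR0.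
by rewrite mul1r lnK// posrE (embedding_real_place hU Uu Pj).2.
Qed.

Let prod_rnorm u : U u -> \prod_j rnorm (sg j u) ^+ 2 = mf one_real u.
Proof.
move=> Uu; have := prod_places_totally_positive_unit hsigma (unit_subgroup_sub hU Uu).
move/(congr1 (@rnorm R)); rewrite !rnorm_prod mf_one_real// => E.
transitivity (\prod_j rnorm (`|sg j u| ^+ 2)).
  by apply: eq_bigr => j _; rewrite !expr2 rnormM rnormE rnormC ger0_norm ?rnorm_ge0.
rewrite E [RHS]big_split_ord /= [X in _ * X]big1 ?mulr1 => [|k]; last first.
  by rewrite /real_place /= ltnNge leq_addr.
by apply: eq_bigl => j; rewrite /real_place /= ltn_ord.
Qed.

(** By the product formula, the weights of all covectors multiply to that of y_1 ... y_s. Leaving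
    out dz_j0 and dzbar_k0 divides by their weight, which [weight] turns into a factor [mf e u]. *)
Let prod_chi_S u : U u -> \prod_(b in S) rnorm (chi b u) = mf one_real u * mf e u.
Proof.
move=> Uu.
have E : \prod_b rnorm (chi b u) = mf one_real u.
  rewrite -prod_rnorm// big_split_ord /= -big_split; apply: eq_bigr => j _ /=.
  by rewrite chil chir rnormJ expr2.
have wu := weight Uu.
have d0 : rnorm (sg j0 u) * rnorm (sg k0 u) != 0.
  by apply/eqP => d0; move: wu; rewrite d0 mulr0 => /eqP; rewrite eq_sym oner_eq0.
apply: (mulIf d0); rewrite -mulrA wu mulr1 -E [RHS](bigID (fun b => b \in S)) /=; congr (_ * _).
rewrite (eq_bigl (fun b => b \in [set l j0; r k0]%SET)) => [|b]; last by rewrite finset.in_setC negbK.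
by rewrite finset.big_setU1 ?inE ?eq_lrshift// finset.big_set1 chil chir rnormJ.
Qed.

Let eps p q : C := wedge_sign R [set l p]%SET (S :\ l p)%SET *
  wedge_sign R [set r q]%SET (S :\ l p :\ r q)%SET.

Let eps_neq0 p q : eps p q != 0.
Proof. by rewrite mulf_neq0// /wedge_sign signr_eq0. Qed.

Let a p q := W (S :\ l p :\ r q)%SET.

(* The vector field obtained by moving both derivatives from [a p q] to [w]: its
   (1,0) and (0,1) components. *)
Let F j (z : Cn) : C := if l j \in S then
  \sum_(q | r q \in S) - eps j q * (w z * dzbar q (a j q) z) else 0.

Let F' j (z : Cn) : C := if r j \in S then
  \sum_(p | l p \in S) eps p j * (a p j z * dz p w z) else 0.

Let F_smooth j : of_class_C 1 HC (F j).
Proof.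
rewrite /F; case: (l j \in S); last exact: of_class_C_cst.
apply: (of_class_C_sum _ oHC) => q _; apply: (of_class_CM oHC); first exact: of_class_C_cst.
by apply: (of_class_CM oHC); [exact: w_smooth|apply: of_class_C_dzbar oHC (W_smooth 2 _)].
Qed.

Let F'_smooth j : of_class_C 1 HC (F' j).
Proof.
rewrite /F'; case: (r j \in S); last exact: of_class_C_cst.
apply: (of_class_C_sum _ oHC) => q _; apply: (of_class_CM oHC); first exact: of_class_C_cst.
by apply: (of_class_CM oHC); [exact: W_smooth|exact: of_class_C_dz oHC (w_smooth 2)].
Qed.

Let inS_l p : (l p \in S) = (p != j0).
Proof. by rewrite finset.in_setC finset.in_set2 (inj_eq (@lshift_inj _ _)) eq_lrshift orbF. Qed.

Let inS_r q : (r q \in S) = (q != k0).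
Proof. by rewrite finset.in_setC finset.in_set2 (inj_eq (@rshift_inj _ _)) eq_rlshift. Qed.

(** After integration by parts, the terms that differentiate omega^m twice reassemble into w times
    the coefficient of index S of del delbar omega^m, which is 0. Those that differentiate w twice
    vanish except at (p0, q0). *)
Lemma divergence_identity z : astheno_kahler g -> HC z ->
  \sum_j (dz j (F j) z + dzbar j (F' j) z) =
  eps p0 q0 * (a p0 q0 z * dzbar q0 (dz p0 w) z).
Proof.
move=> ak Hz.
have T1 p q : of_class_C 1 HC (fun z => w z * dzbar q (a p q) z).
  by apply: (of_class_CM oHC); [exact: w_smooth|exact: of_class_C_dzbar oHC (W_smooth 2 _)].
have T2 p q : of_class_C 1 HC (fun z => a p q z * dz p w z).
  by apply: (of_class_CM oHC); [exact: W_smooth|exact: of_class_C_dz oHC (w_smooth 2)].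
have E1 : \sum_j dz j (F j) z = \sum_(p | l p \in S) \sum_(q | r q \in S)
    - eps p q * dz p (fun z => w z * dzbar q (a p q) z) z.
  rewrite [RHS]big_mkcond; apply: eq_bigr => j _; rewrite /F; case: (l j \in S); last exact: dz_cst.
  rewrite (dz_sum _ _ _ Hz) => [|q _].
    by apply: eq_bigr => q _; rewrite (dzZ _ j oHC (T1 j q) Hz).
  by apply: (of_class_CM oHC); [exact: of_class_C_cst|exact: T1].
have E2 : \sum_j dzbar j (F' j) z = \sum_(p | l p \in S) \sum_(q | r q \in S)
    eps p q * dzbar q (fun z => a p q z * dz p w z) z.
  rewrite [RHS]exchange_big [RHS]big_mkcond; apply: eq_bigr => j _; rewrite /F'.
  case: (r j \in S); last exact: dzbar_cst.
  rewrite (dzbar_sum _ _ _ Hz) => [|q _].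
    by apply: eq_bigr => q _; rewrite (dzbarZ _ j oHC (T2 q j) Hz).
  by apply: (of_class_CM oHC); [exact: of_class_C_cst|exact: T2].
have AK : \sum_(p | l p \in S) \sum_(q | r q \in S) eps p q * dz p (dzbar q (a p q)) z = 0.
  have := lifted_astheno_kahler S ak Hz; rewrite -m_n.
  by rewrite (del_delbarE S oHC (W_smooth 2) Hz).
rewrite big_split E1 E2 /= -big_split /=.
have -> : \sum_(p | l p \in S) (\sum_(q | r q \in S) - eps p q * dz p (fun z => w z * dzbar q (a p q) z) z +
    \sum_(q | r q \in S) eps p q * dzbar q (fun z => a p q z * dz p w z) z) =
  \sum_(p | l p \in S) \sum_(q | r q \in S) eps p q * (a p q z * dzbar q (dz p w) z) -
  w z * \sum_(p | l p \in S) \sum_(q | r q \in S) eps p q * dz p (dzbar q (a p q)) z.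
  rewrite mulr_sumr -sumrB; apply: eq_bigr => p _.
  rewrite mulr_sumr -sumrB -big_split; apply: eq_bigr => q _ /=.
  have E := dz_dzbar_parts p q oHC (w_smooth 2) (W_smooth 2 (S :\ l p :\ r q)%SET) Hz.
  rewrite mulNr addrC -mulrBr E -/(a p q).
  by rewrite mulrBr; congr (_ - _); exact: mulrCA.
rewrite AK mulr0 subr0.
have Z p q : p != j0 -> q != k0 -> (p != p0) || (q != q0) -> dzbar q (dz p w) z = 0.
  move=> pj qk pq; rewrite (dzbar_dz_mon p q oHC w_dom Hz).
  have [E|/(e_other pj qk)[pE qE]] := eqVneq (e p * decr e p q) 0.
    by rewrite -mulrA E mulr0 mul0r.
  by move: pq; rewrite pE qE !eqxx.
apply: (sum_single (P := fun p => l p \in S) (Q := fun q => r q \in S)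
  (G := fun p q => eps p q * (a p q z * dzbar q (dz p w) z))).
- by rewrite inS_l.
- by rewrite inS_r.
move=> p q; rewrite inS_l inS_r => pj qk pq.
by rewrite (Z p q pj qk pq) !mulr0.
Qed.

(** Differentiating along dzbar_q restores the weight of the covector that [a j q] lacks, so all
    summands share the weight of S without l j. *)
Let F_equi j : l j \in S ->
  equi (fun u => ((mf e u)^-1)%:C * \prod_(b in S :\ l j) chi b u) (F j).
Proof.
move=> jS; rewrite /F jS; apply: equi_sum => q qS; apply: equiZ.
have qS' : r q \in (S :\ l j)%SET by rewrite finset.in_setD1 eq_rlshift.
have := equiM (equi_mon hsigma hU e_real) (equi_dzbar hsigma hU q (W_smooth 1 _) (@W_equi (S :\ l j :\ r q)%SET)).
apply: eq_equi => u Uu; congr (_ * _).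
by rewrite [RHS](finset.big_setD1 (r q))//= chir mulrC.
Qed.

Let F'_equi j : r j \in S ->
  equi (fun u => ((mf e u)^-1)%:C * \prod_(b in S :\ r j) chi b u) (F' j).
Proof.
move=> jS; rewrite /F' jS; apply: equi_sum => p pS; apply: equiZ.
have pS' : l p \in (S :\ r j)%SET by rewrite finset.in_setD1 eq_lrshift.
have := equiM (@W_equi (S :\ l p :\ r j)%SET)
  (equi_dz hsigma hU p (w_smooth 1) (equi_mon hsigma hU e_real)).
apply: eq_equi => u Uu; rewrite mulrCA; congr (_ * _).
rewrite [RHS](finset.big_setD1 (l p))//= chil mulrC; congr (_ * _).
by apply: eq_bigl => b; rewrite !finset.in_setD1 andbCA.
Qed.

Let Y_equi := equi_mon hsigma hU one_real_real.

(** After multiplication by Y, the component j of the field has weight of modulus |sigma_j u|^-1, as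
    the component of an invariant vector field should; this is what [equi_bounded_real] and
    [equi_bounded_slab] ask for. *)
Let rnorm_factor b j u : U u -> b \in S -> rnorm (chi b u) = rnorm (sg j u) ->
  rnorm (((mf one_real u)^-1)%:C * (((mf e u)^-1)%:C * \prod_(b' in S :\ b) chi b' u)) *
    rnorm (sg j u) = 1.
Proof.
move=> Uu bS bj; have m1 := mon_factor_gt0 sigma one_real u; have m2 := mon_factor_gt0 sigma e u.
rewrite !rnormM !rnormC !gtr0_norm ?invr_gt0// rnorm_prod -bj -!mulrA.
rewrite [_ * rnorm (chi b u)]mulrC -(finset.big_setD1 b (F := fun b => rnorm (chi b u)) bS) prod_chi_S//.
move: (mf one_real u) (mf e u) m1 m2 => x y x0 y0; field.
by rewrite !lt0r_neq0.
Qed.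

Let smooth_continuous f : of_class_C 1 HC f -> forall z, HC z -> {for z, continuous f}.
Proof. by move=> f1 z Hz; exact: of_class_C_continuous f1 Hz. Qed.

(** The growth conditions of [no_positive_divergence] for the component j, in a form stable under
    complex linear combinations. *)
Definition tame (f : Cn -> C) j :=
  (real_place j -> exists B, forall z, HC z -> rnorm ((Y z)%:C * f z) <= B * complex.Im (z 0 j)) /\
  (forall ub, exists B, forall z, HC z ->
    (forall i, real_place i -> 1 <= complex.Im (z 0 i) <= ub) -> rnorm ((Y z)%:C * f z) <= B).

Let tame0 j : tame (fun=> 0) j.
Proof.
have E (z : Cn) : rnorm ((Y z)%:C * 0) = 0 by rewrite mulr0 /rnorm normr0.
by split=> [_|ub]; exists 0 => z Hz; [|move=> _]; rewrite E ?mul0r.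
Qed.

Let tame_equi b j f : of_class_C 1 HC f -> b \in S ->
  (forall u, rnorm (chi b u) = rnorm (sg j u)) ->
  equi (fun u => ((mf e u)^-1)%:C * \prod_(b' in S :\ b) chi b' u) f -> tame f j.
Proof.
move=> f1 bS bj ef; have Yfe := equiM Y_equi ef.
have Yf1 : forall z, HC z -> {for z, continuous (fun z => (Y z)%:C * f z)}.
  by apply: smooth_continuous; apply: (of_class_CM oHC); [exact: Y_smooth|exact: f1].
have nf u : U u -> rnorm (((mf one_real u)^-1)%:C * (((mf e u)^-1)%:C *
    \prod_(b' in S :\ b) chi b' u)) * rnorm (sg j u) = 1.
  by move=> Uu; exact: rnorm_factor.
split=> [Pj|ub]; first exact: (equi_bounded_real hsigma hU Yf1 Yfe nf Pj).
exact: (equi_bounded_slab hsigma hU ub Yf1 Yfe nf).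
Qed.

Let F_tame j : tame (F j) j.
Proof.
have [jS|jS] := boolP (l j \in S).
  by apply: (tame_equi (F_smooth j) jS _ (F_equi jS)) => u; rewrite chil.
by rewrite /F (negbTE jS); exact: tame0.
Qed.

Let F'_tame j : tame (F' j) j.
Proof.
have [jS|jS] := boolP (r j \in S).
  by apply: (tame_equi (F'_smooth j) jS _ (F'_equi jS)) => u; rewrite chir rnormJ.
by rewrite /F' (negbTE jS); exact: tame0.
Qed.

Let tame_comb f f' (k : C) j : tame f j -> tame f' j -> tame (fun z => k * (f z + f' z)) j.
Proof.
have le z : rnorm ((Y z)%:C * (k * (f z + f' z))) <=
    rnorm k * (rnorm ((Y z)%:C * f z) + rnorm ((Y z)%:C * f' z)).
  have -> : (Y z)%:C * (k * (f z + f' z)) = k * ((Y z)%:C * f z + (Y z)%:C * f' z).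
    by rewrite mulrCA mulrDr.
  rewrite (rnormM k); apply: ler_wpM2l; [exact: rnorm_ge0|exact: rnormD].
move=> [f1 f2] [f'1 f'2]; split=> [Pj|ub].
  have [B BP] := f1 Pj; have [B' B'P] := f'1 Pj; exists (rnorm k * (B + B')) => z Hz.
  apply: le_trans (le z) _; rewrite -mulrA ler_wpM2l ?rnorm_ge0// mulrDl.
  by rewrite lerD ?BP ?B'P.
have [B BP] := f2 ub; have [B' B'P] := f'2 ub; exists (rnorm k * (B + B')) => z Hz zub.
by apply: le_trans (le z) _; rewrite ler_wpM2l ?rnorm_ge0// lerD ?BP ?B'P.
Qed.

Let tame_Re (f : Cn -> C) z : `|complex.Re (f z)| * Y z <= rnorm ((Y z)%:C * f z).
Proof.
have Y0 := mon_gt0 one_real z.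
rewrite rnormM rnormC (gtr0_norm Y0) mulrC ler_pM2l//.
exact: Re_le_rnorm.
Qed.

Let kappa : C := wedge_pow_cst R m * (4^-1 * e p0 * decr e p0 q0)%:C.

Let kappa_neq0 : kappa != 0.
Proof.
by rewrite mulf_neq0 ?wedge_pow_cst_neq0// -mulrA fmorph_eq0 mulf_neq0.
Qed.

Let pos z : R := Y z * (complex.Re (\det (mxsub al al (h z))) * mon (decr (decr e p0) q0) z).

Let det_pos z : HC z -> 0 < complex.Re (\det (mxsub al al (h z))) /\
  \det (mxsub al al (h z)) = (complex.Re (\det (mxsub al al (h z))))%:C.
Proof.
move=> Hz; have := posdef_minor_gt0 (increasing_inj al_increasing)
  (lifted_metric_hermitian g Hz) (fun v => lifted_metric_pos g Hz).
case: (\det _) => x y; rewrite ltcE /= => /andP[/eqP -> x0].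
by split.
Qed.

Let main_term z : HC z ->
  (Y z)%:C * (a p0 q0 z * dzbar q0 (dz p0 w) z) = kappa * (pos z)%:C.
Proof.
move=> Hz; rewrite (dzbar_dz_mon p0 q0 oHC w_dom Hz) /a S_al wedge_pow_minor//.
rewrite (det_pos Hz).2 /kappa /pos !rmorphM /=.
by move: (complex.Re _) (mon _ _) (wedge_pow_cst _ _) => x1 x2 x3; ring.
Qed.

(** Q is [kappa] times the positive function [pos]; it has no zero and its weight has modulus 1.
    Hence 1 / Q is bounded by cocompactness, which bounds [pos] from below. *)
Let pos_lower : exists2 c : R, 0 < c & forall z, HC z -> c <= pos z.
Proof.
pose Q z := (Y z)%:C * (a p0 q0 z * dzbar q0 (dz p0 w) z).
have Q0 z : HC z -> Q z != 0.
  move=> Hz; rewrite /Q main_term// mulf_neq0// fmorph_eq0 /pos.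
  by rewrite !mulf_neq0// lt0r_neq0// ?mon_gt0// (det_pos Hz).1.
have Q1 : of_class_C 1 HC Q.
  apply: (of_class_CM oHC); first exact: Y_smooth.
  apply: (of_class_CM oHC); first exact: W_smooth.
  by apply: (of_class_C_dzbar _ oHC); apply: (of_class_C_dz _ oHC); exact: w_smooth.
have Qc z : HC z -> {for z, continuous (fun z => (Q z)^-1)}.
  by move=> Hz; apply: (@continuousV C Cn Q); [exact: Q0|exact: smooth_continuous Q1 _ Hz].
have eQ := equiM Y_equi (equiM (@W_equi (S :\ l p0 :\ r q0)%SET)
  (equi_dzbar hsigma hU q0 (of_class_C_dz p0 oHC (w_smooth 2))
    (equi_dz hsigma hU p0 (w_smooth 1) (equi_mon hsigma hU e_real)))).
have eQ' : equi (fun u => (((mf one_real u)^-1)%:C * ((\prod_(b in S :\ l p0 :\ r q0) chi b u) *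
    (((mf e u)^-1)%:C * sg p0 u * (sg q0 u)^*)))^-1) (fun z => (Q z)^-1).
  by move=> a' u z ia Uu Hz; rewrite -invfM -(eQ a' u z ia Uu Hz).
have nQ u : U u -> rnorm ((((mf one_real u)^-1)%:C * ((\prod_(b in S :\ l p0 :\ r q0) chi b u) *
    (((mf e u)^-1)%:C * sg p0 u * (sg q0 u)^*)))^-1) = 1.
  move=> Uu; rewrite rnormV -[RHS]invr1; congr (_^-1).
  have m1 := mon_factor_gt0 sigma one_real u; have m2 := mon_factor_gt0 sigma e u.
  have := prod_chi_S Uu; have pS : l p0 \in S by rewrite inS_l.
  have qS : r q0 \in (S :\ l p0)%SET by rewrite finset.in_setD1 eq_rlshift inS_r.
  rewrite (finset.big_setD1 _ pS) (finset.big_setD1 _ qS) /= chil chir rnormJ.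
  rewrite !rnormM !rnormC rnormJ !gtr0_norm ?invr_gt0// rnorm_prod.
  move: (\prod_(b in _) _) (rnorm (sg p0 u)) (rnorm (sg q0 u)) => x1 x2 x3 E.
  transitivity ((mf one_real u)^-1 * (mf e u)^-1 * (x2 * (x3 * x1))); first by ring.
  rewrite E; move: (mf one_real u) (mf e u) m1 m2 => y1 y2 y10 y20; field.
  by rewrite !lt0r_neq0.
have [B BP] := invariant_bounded hU Qc eQ' nQ.
have B1 : 0 < Num.max B 1 by rewrite lt_max ltr01 orbT.
have kap0 : 0 < rnorm kappa by rewrite rnorm_gt0.
exists ((Num.max B 1)^-1 / rnorm kappa); first by rewrite divr_gt0 ?invr_gt0.
move=> z Hz; have pz : 0 < pos z.
  by rewrite /pos !mulr_gt0 ?mon_gt0// (det_pos Hz).1.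
have := BP z Hz; rewrite /Q main_term// rnormV rnormM rnormC gtr0_norm// => h1.
have kp0 : 0 < rnorm kappa * pos z by exact: mulr_gt0.
rewrite ler_pdivrMr// mulrC invf_ple ?posrE//.
by apply: le_trans h1 _; rewrite le_max lexx.
Qed.

Theorem weight_not_astheno_kahler : ~ astheno_kahler g.
Proof.
move=> ak; have [c c0 cP] := pos_lower.
(* This constant removes the sign and [kappa]: Y times the divergence of (X, Z) becomes exactly
   [pos], a real function. *)
pose k : C := (eps p0 q0 * kappa)^-1.
pose X j z := k * (2^-1 * (F j z + F' j z)).
pose Z j z := k * ('i / 2 * (F' j z + -1 * F j z)).
have Xt j : tame (X j) j.
  have := tame_comb (k * 2^-1) (F_tame j) (F'_tame j).
  by rewrite (_ : (fun z => _) = X j)//; apply/funext => z; rewrite /X [RHS]mulrA.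
have Zt j : tame (Z j) j.
  have t1 := tame_comb (-1) (F_tame j) (tame0 j).
  have := tame_comb (k * ('i / 2)) (F'_tame j) t1.
  by rewrite (_ : (fun z => _) = Z j)//; apply/funext => z; rewrite /Z addr0 [RHS]mulrA.
have VE := half_spaces_HC R s t.
have X1 j : of_class_C 1 (half_spaces (@real_place s t)) (X j).
  rewrite VE; apply: (of_class_CM oHC); first exact: of_class_C_cst.
  apply: (of_class_CM oHC); first exact: of_class_C_cst.
  by apply: (of_class_CD oHC); [exact: F_smooth|exact: F'_smooth].
have Z1 j : of_class_C 1 (half_spaces (@real_place s t)) (Z j).
  rewrite VE; apply: (of_class_CM oHC); first exact: of_class_C_cst.
  apply: (of_class_CM oHC); first exact: of_class_C_cst.
  apply: (of_class_CD oHC); first exact: F'_smooth.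
  by apply: (of_class_CM oHC); [exact: of_class_C_cst|exact: F_smooth].
have /choice[B BP] j : exists B, real_place j -> forall z, HC z ->
    rnorm ((Y z)%:C * Z j z) <= B * complex.Im (z 0 j).
  by case Pj: (real_place j); [have [B BP] := (Zt j).1 Pj; exists B|exists 0].
apply: (no_positive_divergence (P := @real_place s t) (X := X) (Z := Z)
  (B := \big[Num.max/0]_j B j) c0 X1 Z1); rewrite VE.
- move=> j z Pj Hz; apply: le_trans (tame_Re _ z) _.
  apply: le_trans (BP j Pj z Hz) _; rewrite ler_pM2r ?(Im_pos Hz)//.
  exact: le_bigmax.
- move=> ub.
  have /choice[B1 B1P] j := (Xt j).2 ub; have /choice[B2 B2P] j := (Zt j).2 ub.
  exists (\big[Num.max/0]_j Num.max (B1 j) (B2 j)) => z j Hz zub; split.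
    apply: le_trans (tame_Re _ z) _; apply: le_trans (B1P j z Hz zub) _.
    apply: le_trans (le_bigmax _ (fun j => Num.max (B1 j) (B2 j)) j).
    by rewrite le_max lexx.
  apply: le_trans (tame_Re _ z) _; apply: le_trans (B2P j z Hz zub) _.
  apply: le_trans (le_bigmax _ (fun j => Num.max (B1 j) (B2 j)) j).
  by rewrite le_max lexx orbT.
move=> z Hz; apply: le_trans (cP z Hz) _.
have ReM (y : R) (x : C) : y * complex.Re x = complex.Re (y%:C * x).
  by case: x => x1 x2 /=; rewrite mul0r subr0.
rewrite -[half_weight _ z]/(Y z) ReM.
have -> : \sum_j (rderive (delta_mx 0 j) (X j) z + rderive ('i *: delta_mx 0 j) (Z j) z) =
    k * (eps p0 q0 * (a p0 q0 z * dzbar q0 (dz p0 w) z)).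
  rewrite -(divergence_identity ak Hz) mulr_sumr; apply: eq_bigr => j _.
  exact: (dz_add_dzbar k j oHC (F_smooth j) (F'_smooth j) Hz).
rewrite mulrCA [(Y z)%:C * _]mulrCA main_term//.
rewrite [eps p0 q0 * _]mulrA mulrA /k mulVf ?mul1r ?lexx//.
by rewrite mulf_neq0.
Qed.

End WeightedObstruction.

(** In both cases the same two indices are missing among the dz and among the dzbar, and composed
    lifts enumerate the others in increasing order. In the swapped case the values 0 and 1 make both
    enumerations x |-> x + 2. *)
Lemma complement_bi_index n (j0 k0 p0 q0 : 'I_n) : p0 != j0 -> q0 != k0 ->
  (j0 = k0 /\ p0 = q0) \/ [/\ j0 = 0%N :> nat, k0 = 1%N :> nat, p0 = k0 & q0 = j0] ->
  exists m (al : 'I_m -> 'I_n), [/\ m = (n - 2)%N, increasing al &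
    (~: [set lshift n j0; rshift n k0] :\ lshift n p0 :\ rshift n q0)%SET = bi_index al al].
Proof.
case: n j0 k0 p0 q0 => [[]//|[|m]] j0 k0 p0 q0 pj qk H; first by move: pj; rewrite !ord1 eqxx.
have id_incr : increasing (id : 'I_m.+2 -> 'I_m.+2) by [].
have lift_inj' (x : 'I_m.+2) : injective (lift x) by exact: lift_inj.
have [p' p'E] : exists p', p0 = lift j0 p'.
  by move: pj; rewrite eq_sym => /unlift_some[p' -> _]; exists p'.
have [q' q'E] : exists q', q0 = lift k0 q'.
  by move: qk; rewrite eq_sym => /unlift_some[q' -> _]; exists q'.
exists m, (lift j0 \o lift p'); split.
- by rewrite subn2.
- by apply: increasing_lift; exact: (increasing_lift j0 id_incr).
have T : bi_index id id = [set: 'I_(m.+2 + m.+2)]%SET.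
  apply/setP => q; rewrite -[q]splitK; case: (fintype.split q) => k /=;
    rewrite ?lshift_bi_index ?rshift_bi_index finset.in_setT; apply/imsetP; by exists k.
have S1 : (~: [set lshift m.+2 j0; rshift m.+2 k0])%SET = bi_index (lift j0) (lift k0).
  rewrite -finset.setTD -T.
  exact: (@bi_index_lift m.+2 m.+1 id id j0 k0 (fun _ _ => id) (fun _ _ => id)).
rewrite S1 finset.setDDl p'E q'E (bi_index_lift p' q' (lift_inj' j0) (lift_inj' k0)).
congr (bi_index _ _); apply/funext => x; apply: val_inj => /=.
case: H => [[jk pq]|[j00 k01 pk qj]].
  have pq' : p' = q' by apply: (lift_inj' j0); rewrite -p'E pq q'E jk.
  by rewrite jk pq'.
have p'0 : p' = 0%N :> nat by have := congr1 val p'E; rewrite pk /= k01 j00 /bump; lia.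
have q'0 : q' = 0%N :> nat.
  by have := congr1 val q'E; rewrite qj /= k01 j00 /bump; case: (nat_of_ord q') => // i; lia.
by rewrite j00 k01 p'0 q'0 /bump; lia.
Qed.

(** * The choice of the weight, according to the number of real places *)

Section Cases.
Variables (R : realType) (s t : nat) (hs : (0 < s)%N) (K : fieldExtType rat).
Variable sigma : 'I_(s + t + t) -> {rmorphism K -> R[i]}.
Hypothesis hsigma : embedding_labelling sigma.
Variables (U : set K) (hU : admissible sigma U).
Variable g : hermitian_metric (OT_manifold hs hsigma hU).

Lemma mon_factorE e u : mon_factor sigma e u =
  expR (\sum_(j < s + t) e j * ln (rnorm (sigma (lshift t j) u))).
Proof. by congr expR; apply: eq_bigr => j _; rewrite mxE. Qed.

Lemma two_real_places : (1 < s)%N -> ~ astheno_kahler g.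
Proof.
move=> s1; pose j0 : 'I_(s + t) := lshift t (Ordinal hs).
pose k0 : 'I_(s + t) := lshift t (Ordinal s1).
have jk : j0 != k0 by rewrite -(inj_eq val_inj).
have kj : k0 != j0 by rewrite eq_sym.
have [m [al [mE al_incr alE]]] : exists m (al : 'I_m -> 'I_(s + t)),
  [/\ m = (s + t - 2)%N, increasing al & (~: [set lshift _ j0; rshift _ k0] :\ lshift _ k0 :\ rshift _ j0)%SET = bi_index al al].
  by apply: complement_bi_index => //; right.
pose e (j : 'I_(s + t)) : R := - (j == j0)%:R - (j == k0)%:R.
have ej : e j0 = -1 by rewrite /e eqxx (negbTE jk) oppr0 addr0.
have ek : e k0 = -1 by rewrite /e eqxx (negbTE kj) oppr0 add0r.
have e0 j : j != j0 -> j != k0 -> e j = 0.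
  by move=> /negbTE j1 /negbTE j2; rewrite /e j1 j2 oppr0 addr0.
have Rj : real_place j0 by [].
have Rk : real_place k0 by [].
have eR j : e j != 0 -> real_place j.
  have [->|j1] := eqVneq j j0; first by [].
  have [->|j2] := eqVneq j k0; first by [].
  by rewrite e0// eqxx.
apply: (weight_not_astheno_kahler (e := e) eR _ _ _ kj jk mE al_incr alE).
- move=> u Uu; have [_ j_gt0] := embedding_real_place hU Uu Rj.
  have [_ k_gt0] := embedding_real_place hU Uu Rk.
  rewrite mon_factorE (bigD1 j0)//= (bigD1 k0)//= big1 ?addr0 => [|j /andP[j1 j2]]; last first.
    by rewrite e0// mul0r.
  rewrite ej ek !mulN1r -opprD expRN -lnM ?posrE// lnK ?posrE ?mulr_gt0// mulVf//.
  by rewrite mulf_neq0// lt0r_neq0.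
- by rewrite ek /decr ej (negbTE jk) mulr0n subr0 mulrNN mulr1 oner_eq0.
(* The monomial involves only the coordinates j0 and k0: p <> j0 leaves p = k0, and q <> k0 leaves q
   = j0. *)
move=> p q pj qk; have [pk|pk] := eqVneq p k0; last by rewrite e0// mul0r eqxx.
have [qj|qj] := eqVneq q j0; first by [].
by rewrite /decr (e0 q qj qk) pk (negbTE qk) mulr0n subr0 mulr0 eqxx.
Qed.

End Cases.

Lemma ln_rnorm_exprz (R : realType) (x : R[i]) (n : int) : x != 0 ->
  ln (rnorm (x ^ n)) = n%:~R * ln (rnorm x).
Proof.
move=> x0; have rX m : rnorm (x ^+ m) = rnorm x ^+ m.
  elim: m => [|m IH]; first by rewrite !expr0 rnorm1.
  by rewrite !exprS rnormM IH.
have r0 : 0 < rnorm x by rewrite rnorm_gt0.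
case: n => m; first by rewrite -exprnP rX lnXn// mulr_natl.
by rewrite NegzE -exprnN rnormV rX lnV ?posrE ?exprn_gt0// lnXn// mulrNz mulNr -mulr_natl.
Qed.

Section OneRealPlaceCase.
Variables (R : realType) (t : nat) (hs : (0 < 1)%N) (K : fieldExtType rat).
Variable sigma : 'I_(1 + t + t) -> {rmorphism K -> R[i]}.
Hypothesis hsigma : embedding_labelling sigma.
Variables (U : set K) (hU : admissible sigma U).
Variable g : hermitian_metric (OT_manifold hs hsigma hU).

Let i0 : 'I_(1 + t) := lshift t ord0.

(** In logarithms, the condition on c is linear in the unit. Rank 1 gives u^a v^b = 1, with b <> 0
    because u has infinite order, so the condition passes from u to v. *)
Lemma rank_one_exponent (k : 'I_t) (u : K) (c : R) : U u ->
  (forall n : int, u ^ n = 1 -> n = 0) ->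
  c * ln (rnorm (sigma (lshift t i0) u)) + 2 * ln (rnorm (sigma (lshift t (rshift 1 k)) u)) = 0 ->
  forall v, U v ->
  c * ln (rnorm (sigma (lshift t i0) v)) + 2 * ln (rnorm (sigma (lshift t (rshift 1 k)) v)) = 0.
Proof.
move=> Uu u_inf cu v Uv.
have [_ /(_ (fun i => if i == ord0 then u else v))dep] := admissible_rank hU.
have [a [b [b0 uv]]] : exists a b : int, b != 0 /\ u ^ a * v ^ b = 1.
  have [|f] := (existsNP _).2 (dep _); first by move=> i; case: (i == ord0).
  move=> /not_implyP[]; rewrite big_ord_recl big_ord1 /= => uv /existsNP[i fi].
  exists (f ord0), (f (lift ord0 ord0)); split => //.
  apply: contra_notN fi => /eqP b0; move: uv; rewrite b0 expr0z mulr1 => /u_inf a0.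
  have [j ->|->//] := unliftP ord0 i.
  by rewrite [j]ord1.
have E (j : 'I_(1 + t + t)) : a%:~R * ln (rnorm (sigma j u)) + b%:~R * ln (rnorm (sigma j v)) = 0.
  have su : sigma j u != 0 by rewrite fmorph_eq0 (unit_subgroup_neq0 hU).
  have sv : sigma j v != 0 by rewrite fmorph_eq0 (unit_subgroup_neq0 hU).
  rewrite -!ln_rnorm_exprz// -lnM ?posrE ?rnorm_gt0 ?expfz_neq0// -rnormM.
  by have := congr1 (sigma j) uv; rewrite rmorphM !fmorphXz rmorph1 => ->; rewrite rnorm1 ln1.
apply: (mulfI (_ : b%:~R != 0 :> R)); first by rewrite intr_eq0.
have := E (lshift t i0); have := E (lshift t (rshift 1 k)); move: cu.
move: (ln (rnorm (_ _ u))) (ln (rnorm (_ _ u))) (ln (rnorm (_ _ v))) (ln (rnorm (_ _ v))).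
move=> x1 x2 x3 x4 H1 H2 H3.
have -> : b%:~R * (c * x3 + 2 * x4) = c * (a%:~R * x2 + b%:~R * x3) +
  2 * (a%:~R * x1 + b%:~R * x4) - a%:~R * (c * x2 + 2 * x1) by ring.
by rewrite H1 H2 H3 !mulr0 addr0 subr0.
Qed.

Lemma one_real_place : (1 < t)%N -> ~ astheno_kahler g.
Proof.
move=> t1; have [[u1 [Uu1 u1_ind]] _] := admissible_rank hU.
pose u := u1 ord0; have Uu : U u by exact: Uu1.
have u_inf (n : int) : u ^ n = 1 -> n = 0.
  by move=> un; apply: (u1_ind (fun=> n) _ ord0); rewrite big_ord1.
have u_neq1 : u != 1 by apply/eqP => u1E; have := u_inf 1; rewrite u1E expr1z => /(_ erefl).
have [k [k1 k2]] := complex_place_exponent hsigma t1 (unit_subgroup_sub hU Uu) u_neq1.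
pose j0 : 'I_(1 + t) := rshift 1 k.
have ij : i0 != j0 by rewrite eq_lrshift.
have Ri : real_place i0 by [].
have [aE a0] := embedding_real_place hU Uu Ri.
have u0 := unit_subgroup_neq0 hU Uu.
have b0 : 0 < rnorm (sigma (lshift t j0) u) by rewrite rnorm_gt0 fmorph_eq0.
set b := rnorm (sigma (lshift t j0) u) in b0.
set a := rnorm (sigma (lshift t i0) u) in a0 aE.
have b1 : b ^+ 2 != 1.
  by apply: contra_neq k1 => b1; rewrite rnormE -rmorphXn b1.
have b2 : b ^+ 2 * a != 1.
  by apply: contra_neq k2 => b1'; rewrite rnormE -rmorphXn aE -rmorphM b1'.
have la : ln a != 0.
  rewrite ln_eq0//; apply: contra_neq u_neq1 => a1; apply: (fmorph_inj (sigma (lshift t i0))).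
  by rewrite rmorph1 aE a1.
have lb : ln (b ^+ 2) = 2 * ln b by rewrite lnXn// mulr_natl.
pose c := - (2 * ln b) / ln a.
have ca : c * ln a = - (2 * ln b) by rewrite mulfVK.
have c0 : c != 0.
  apply: contra_neq b1 => c0; apply: ln_inj; rewrite ?posrE ?exprn_gt0//.
  by rewrite ln1 lb -[LHS]opprK -ca c0 mul0r oppr0.
have c1 : c != 1.
  apply: contra_neq b2 => c1; apply: ln_inj; rewrite ?posrE ?mulr_gt0 ?exprn_gt0//.
  by rewrite ln1 lnM ?posrE ?exprn_gt0// lb; move: ca; rewrite c1 mul1r => ->; rewrite subrr.
have [m [al [mE al_incr alE]]] : exists m (al : 'I_m -> 'I_(1 + t)),
  [/\ m = (1 + t - 2)%N, increasing al & (~: [set lshift _ j0; rshift _ j0] :\ lshift _ i0 :\ rshift _ i0)%SET = bi_index al al].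
  by apply: complement_bi_index => //; left.
pose e (j : 'I_(1 + t)) : R := if j == i0 then c else 0.
have ei : e i0 = c by rewrite /e eqxx.
have e0 j : j != i0 -> e j = 0 by rewrite /e => /negbTE ->.
have eR j : e j != 0 -> real_place j.
  by have [->|j1] := eqVneq j i0; last rewrite e0// eqxx.
apply: (weight_not_astheno_kahler (e := e) eR _ _ _ ij ij mE al_incr alE).
- move=> v Uv; have cu : c * ln a + 2 * ln b = 0 by rewrite ca addNr.
  have cv := rank_one_exponent (k := k) (c := c) Uu u_inf cu Uv.
  have v0 : 0 < rnorm (sigma (lshift t j0) v).
    by rewrite rnorm_gt0 fmorph_eq0 (unit_subgroup_neq0 hU).
  rewrite mon_factorE (bigD1 i0)//= big1 ?addr0 => [|j j1]; last by rewrite e0// mul0r.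
  rewrite ei -[X in _ * X]lnK ?posrE ?mulr_gt0// lnM ?posrE// -expRD.
  by rewrite -[RHS]expR0 -cv mulr2n mulrDl !mul1r.
- by rewrite ei /decr ei eqxx mulf_neq0// subr_eq0.
move=> p q pj qj; have [->|pi] := eqVneq p i0; last by rewrite e0// mul0r eqxx.
have [->|qi] := eqVneq q i0; first by [].
by rewrite /decr (e0 q qi) (negbTE qi) subr0 mulr0 eqxx.
Qed.

End OneRealPlaceCase.

Theorem corollary5 (R : realType) (s t : nat) (hs : (0 < s)%N) (ht : (0 < t)%N)
    (K : fieldExtType rat) (sigma : 'I_(s + t + t) -> {rmorphism K -> R[i]})
    (hsigma : embedding_labelling sigma) (U : set K)
    (hU : admissible sigma U) (hn : (4 <= s + t)%N)
    (g : hermitian_metric (OT_manifold hs hsigma hU)) :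
  ~ astheno_kahler g.
Proof.
case: s hs sigma hsigma hU hn g => [//|[|s']] hs' sigma' hsigma' hU' hn' g'.
  by apply: one_real_place; lia.
exact: two_real_places.
Qed.
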